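(* Let $\mathcal{JS}^{3,1}$ be the variety of complex $4$-dimensional Jordan superalgebras of type $(3,1)$ (even part with basis $e_1,e_2,e_3$, odd part with basis $f$). Then $\mathcal{JS}^{3,1}$ has dimension $15$, and it has exactly $21$ irreducible components, namely the Zariski closures $\overline{O(\mathfrak J)}$ of the orbits of the following $21$ superalgebras (in particular each of them is rigid, and $\mathcal{JS}^{3,1}$ is the closure of the union of their orbits): $\mathfrak J_{1}$: $e_1^2=e_1,\ e_2^2=e_2,\ e_3^2=e_3$; $\mathfrak J_{2}$: $e_1^2=e_1,\ e_2^2=e_2,\ e_3^2=e_3,\ e_1f=f$; $\mathfrak J_{3}$: $e_1^2=e_1,\ e_2^2=e_2,\ e_3^2=e_3,\ e_1f=\frac12f$; $\mathfrak J_{4}$: $e_1^2=e_1,\ e_2^2=e_2,\ e_3^2=e_3,\ e_1f=\frac12f,\ e_2f=\frac12f$; $\mathfrak J_{21}$: $e_1^2=e_1,\ e_1e_2=\frac12e_2,\ e_3^2=e_3$; $\mathfrak J_{22}$: $e_1^2=e_1,\ e_1e_2=\frac12e_2,\ e_3^2=e_3,\ e_3f=f$; $\mathfrak J_{23}$: $e_1^2=e_1,\ e_1e_2=\frac12e_2,\ e_3^2=e_3,\ e_3f=\frac12f$; $\mathfrak J_{24}$: $e_1^2=e_1,\ e_1e_2=\frac12e_2,\ e_3^2=e_3,\ e_1f=f$; $\mathfrak J_{25}$: $e_1^2=e_1,\ e_1e_2=\frac12e_2,\ e_3^2=e_3,\ e_1f=\frac12f$; $\mathfrak J_{26}$: $e_1^2=e_1,\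 e_1e_2=\frac12e_2,\ e_3^2=e_3,\ e_1f=\frac12f,\ e_3f=\frac12f$; $\mathfrak J_{42}$: $e_1^2=e_1,\ e_2^2=e_2,\ e_3^2=e_1+e_2,\ e_1e_3=\frac12e_3,\ e_2e_3=\frac12e_3$; $\mathfrak J_{43}$: $e_1^2=e_1,\ e_2^2=e_2,\ e_3^2=e_1+e_2,\ e_1e_3=\frac12e_3,\ e_2e_3=\frac12e_3,\ e_1f=\frac12f,\ e_2f=\frac12f$; $\mathfrak J_{47}$: $e_1^2=e_1,\ e_1e_2=\frac12e_2,\ e_1e_3=\frac12e_3$; $\mathfrak J_{48}$: $e_1^2=e_1,\ e_1e_2=\frac12e_2,\ e_1e_3=\frac12e_3,\ e_1f=f$; $\mathfrak J_{49}$: $e_1^2=e_1,\ e_1e_2=\frac12e_2,\ e_1e_3=\frac12e_3,\ e_1f=\frac12f$; $\mathfrak J_{51}$: $e_1^2=e_1,\ e_1e_2=\frac12e_2,\ e_2^2=e_3,\ e_1f=f$; $\mathfrak J_{53}$: $e_1^2=e_1,\ e_1e_2=\frac12e_2,\ e_2^2=e_3,\ e_1e_3=e_3$; $\mathfrak J_{54}$: $e_1^2=e_1,\ e_1e_2=\frac12e_2,\ e_2^2=e_3,\ e_1e_3=e_3,\ e_1f=f$; $\mathfrak J_{55}$: $e_1^2=e_1,\ e_1e_2=\frac12e_2,\ e_2^2=e_3,\ e_1e_3=e_3,\ e_1f=\frac12f$; $\mathfrak J_{57}$: $e_1^2=e_1,\ e_2^2=e_2,\ e_1e_3=\frac12e_3,\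 e_2e_3=\frac12e_3,\ e_1f=f$; $\mathfrak J_{58}$: $e_1^2=e_1,\ e_2^2=e_2,\ e_1e_3=\frac12e_3,\ e_2e_3=\frac12e_3,\ e_1f=\frac12f$.
   Context: All vector spaces are over $\mathbb C$. A superalgebra is a $\mathbb Z_2$-graded algebra $\mathfrak J=\mathfrak J_0\oplus\mathfrak J_1$ (here subscripts $0,1$ denote the even and odd parts) with $\mathfrak J_i\mathfrak J_j\subseteq\mathfrak J_{i+j}$; its type is $(\dim\mathfrak J_0,\dim\mathfrak J_1)$; $|x|=i$ for $x$ in the degree-$i$ part. It is a Jordan superalgebra if for all homogeneous $x,y,z,t$: $xy=(-1)^{|x||y|}yx$ and $$((xy)z)t+(-1)^{|y||z|+|y||t|+|z||t|}((xt)z)y+(-1)^{|x||y|+|x||z|+|x||t|+|z||t|}((yt)z)x=(xy)(zt)+(-1)^{|t|(|y|+|z|)}(xt)(yz)+(-1)^{|y||z|}(xz)(yt).$$ Multiplication tables list only nonzero products of basis vectors, up to supercommutativity ($e_i$ denote even and $f$ odd basis vectors; so $e_if=fe_i$, $e_ie_j=e_je_i$, $f^2=0$); all unlisted products are zero. In the claim, $\mathfrak J_{1},\mathfrak J_2,\dots$ are names of superalgebras. Variety: fix a superspace $V=V_0\oplus V_1$ with $\dim V_0=m$, $\dim V_1=n$. The set $\mathcal{JS}^{m,n}$ of all grading-preserving multiplications $\mu:V\otimes V\to V$ that make $V$ a Jordan superalgebra is a Zariski-closed subset of the affine space (of dimension $m^3+3mn^2$) of structure constants of grading-preserving bilinear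 multiplications. The group $G=GL(V_0)\times GL(V_1)$ of grading-preserving linear automorphisms acts by $(g*\mu)(x\otimes y)=g\mu(g^{-1}x\otimes g^{-1}y)$; orbits correspond to isomorphism classes. $O(\mathfrak J)$ denotes the orbit of a multiplication representing $\mathfrak J$ and $\overline{O(\mathfrak J)}$ its Zariski closure. $\mathfrak J$ is rigid if $O(\mathfrak J)$ is open in $\mathcal{JS}^{m,n}$. An irreducible component is a maximal irreducible closed subset. Dimension convention of the paper: the dimension of an orbit is taken to be $\dim O(\mathfrak J)=(m+n)^2-\dim \mathfrak{Der}(\mathfrak J)$, where $\mathfrak{Der}(\mathfrak J)$ is the span of all even and odd superderivations, i.e. homogeneous linear maps $D$ with $D(xy)=D(x)y+(-1)^{|D||x|}xD(y)$; the dimension of the variety is the maximum of the dimensions of its components computed from these orbit dimensions. *)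

(* Defs.v *)
(* Mathematical Components, with multinomials for the Zariski topology and   *)
(* real-closed's R[i] (R : realType) for the field of complex numbers.       *)
From HB Require Import structures.
From mathcomp Require Import all_boot all_order all_algebra.
From mathcomp Require Import classical_sets reals.
From mathcomp Require Import mpoly complex zify.

Set Implicit Arguments.
Unset Strict Implicit.
Unset Printing Implicit Defensive.

Import GRing.Theory.
Local Open Scope ring_scope.
Local Open Scope classical_set_scope.

Section Zariski.
Variables (K : fieldType) (I : finType).
Implicit Types A X Y Z : set {ffun I -> K}.

(* The affine space with coordinates indexed by I; the variables of its      *)
(* polynomials are numbered along enum I.                                    *)
Definition peval (p : {mpoly K[#|I|]}) (c : {ffun I -> K}) : K :=
  p.@[fun i => c (enum_val i)].

Definition zclosed Z : Prop :=
  exists S : set {mpoly K[#|I|]}, Z = [set c | forall p, S p -> peval p c = 0].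

Definition zclosure A : set {ffun I -> K} := smallest zclosed A.

Definition zopen_in A X : Prop := exists2 Z, zclosed Z & X = A `\` Z.

Definition zirreducible X : Prop :=
  X !=set0 /\
  forall Y Z, zclosed Y -> zclosed Z -> X `<=` Y `|` Z ->
    X `<=` Y \/ X `<=` Z.

Definition irreducible_component A X : Prop :=
  [/\ zclosed X, zirreducible X, X `<=` A &
      forall Y, zclosed Y -> zirreducible Y -> Y `<=` A -> X `<=` Y -> Y = X].

End Zariski.

(* The superspace V = V_0 (+) V_1 is 'rV_(m + n); linear maps act on row     *)
(* vectors on the right.                                                     *)
Definition bpar m n (i : 'I_(m + n)) : bool := (m <= i)%N.

(* The triples (i, j, k) for which the coefficient of the k-th basis vector  *)
(* in the product of the i-th and j-th ones may be nonzero.                  *)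
Definition sc_index m n :=
  {t : 'I_(m + n) * 'I_(m + n) * 'I_(m + n)
     | bpar t.2 == bpar t.1.1 (+) bpar t.1.2}.

Lemma card_sc_index m n : #|{: sc_index m n}| = (m ^ 3 + 3 * m * n ^ 2)%N.
Proof.
rewrite card_sig -sum1_card big_mkcond /=.
rewrite -(pair_big xpredT xpredT (fun (p : 'I_(m + n) * 'I_(m + n)) k =>
  if bpar k == bpar p.1 (+) bpar p.2 then 1 else 0)%N) /=.
rewrite -(pair_big xpredT xpredT (fun i j : 'I_(m + n) =>
  \sum_k if bpar k == bpar i (+) bpar j then 1 else 0)%N) /=.
have parl i : bpar (lshift n i : 'I_(m + n)) = false.
  by rewrite /bpar /= leqNgt ltn_ord.
have parr i : bpar (rshift m i : 'I_(m + n)) = true by rewrite /bpar /= leq_addr.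
have sum_par (F : bool -> nat) :
    (\sum_(k < m + n) F (bpar k) = m * F false + n * F true)%N.
  rewrite big_split_ord /=.
  rewrite (eq_bigr (fun=> F false)) => [|k _]; last by rewrite parl.
  rewrite [X in (_ + X)%N](eq_bigr (fun=> F true)) => [|k _]; last by rewrite parr.
  by rewrite !sum_nat_const !card_ord.
rewrite (sum_par (fun b => \sum_(j < m + n) \sum_(k < m + n)
  if bpar k == b (+) bpar j then 1 else 0)%N).
rewrite !(sum_par (fun b => \sum_(k < m + n)
  if bpar k == _ (+) b then 1 else 0)%N).
rewrite !(sum_par (fun b => if b == _ then 1 else 0)%N) /=.
rewrite !muln1 !muln0 !addn0 !add0n; lia.
Qed.

Section JordanSuperalgebras.
Variables (K : fieldType) (m n : nat).
Implicit Types (c : {ffun sc_index m n -> K}) (x y z t : 'rV[K]_(m + n)).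

Definition has_parity (d : bool) x : Prop :=
  if d then lsubmx x = 0 else rsubmx x = 0.

Definition smul c x y : 'rV[K]_(m + n) :=
  \sum_(s : sc_index m n)
    (c s * x 0 (val s).1.1 * y 0 (val s).1.2) *: delta_mx 0 (val s).2.

(* The degrees, being booleans, are read as 0 and 1 in the exponents.        *)
Definition supercommutative c : Prop :=
  forall (dx dy : bool) x y, has_parity dx x -> has_parity dy y ->
    smul c x y = (-1) ^+ (dx * dy) *: smul c y x.

Definition jordan_identity c : Prop :=
  forall (dx dy dz dt : bool) x y z t,
    has_parity dx x -> has_parity dy y -> has_parity dz z -> has_parity dt t ->
    let mul := smul c in
    mul (mul (mul x y) z) t
    + (-1) ^+ (dy * dz + dy * dt + dz * dt) *: mul (mul (mul x t) z) y
    + (-1) ^+ (dx * dy + dx * dz + dx * dt + dz * dt) *: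
        mul (mul (mul y t) z) x
    = mul (mul x y) (mul z t)
      + (-1) ^+ (dt * (dy + dz)) *: mul (mul x t) (mul y z)
      + (-1) ^+ (dy * dz) *: mul (mul x z) (mul y t).

Definition JS : set {ffun sc_index m n -> K} :=
  [set c | supercommutative c /\ jordan_identity c].

Definition alg_orbit c : set {ffun sc_index m n -> K} :=
  [set c' | exists g0 : 'M[K]_m, exists g1 : 'M[K]_n,
     [/\ g0 \in unitmx, g1 \in unitmx &
         let g := block_mx g0 0 0 g1 in
         forall x y,
           smul c' x y = smul c (x *m invmx g) (y *m invmx g) *m g]].

Definition rigid c : Prop := zopen_in JS (alg_orbit c).

Definition superderivation c (d : bool) (D : 'M[K]_(m + n)) : Prop :=
  (forall (dx : bool) x, has_parity dx x -> has_parity (d (+) dx) (x *m D)) /\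
  (forall (dx dy : bool) x y, has_parity dx x -> has_parity dy y ->
     smul c x y *m D
     = smul c (x *m D) y + (-1) ^+ (d * dx) *: smul c x (y *m D)).

(* U is the span of all even and odd superderivations.                       *)
Definition is_Der c (U : {vspace 'M[K]_(m + n)}) : Prop :=
  (forall d D, superderivation c d D -> D \in U) /\
  (forall W : {vspace 'M[K]_(m + n)},
     (forall d D, superderivation c d D -> D \in W) -> (U <= W)%VS).

(* This counts odd superderivations too, so it is not the dimension of the   *)
(* orbit as an algebraic variety.                                            *)
Definition orbit_dim c (k : nat) : Prop :=
  exists2 U, is_Der c U & k = ((m + n) ^ 2 - \dim U)%N.

Definition component_dim (X : set {ffun sc_index m n -> K}) (k : nat) : Prop :=
  exists c, [/\ JS c, X = zclosure (alg_orbit c) & orbit_dim c k].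

Definition JS_dim (k : nat) : Prop :=
  (exists2 X, irreducible_component JS X & component_dim X k) /\
  (forall X l, irreducible_component JS X -> component_dim X l -> (l <= k)%N).

(* A multiplication table is a list of entries (i, j, v), the product of the *)
(* i-th and j-th basis vectors being v, given up to supercommutativity.  It  *)
(* must have no entry with i and j both odd, for which (j, i, v) would need  *)
(* the opposite sign.                                                        *)
Definition of_table (s : seq ('I_(m + n) * 'I_(m + n) * 'rV[K]_(m + n))) :
    {ffun sc_index m n -> K} :=
  [ffun t : sc_index m n =>
     \sum_(r <- s | (r.1 == ((val t).1.1, (val t).1.2))
                    || (r.1 == ((val t).1.2, (val t).1.1))) r.2 0 (val t).2].

End JordanSuperalgebras.

Arguments JS K m n : clear implicits.

Local Definition e1 : 'I_(3 + 1) := @Ordinal 4 0 isT.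
Local Definition e2 : 'I_(3 + 1) := @Ordinal 4 1 isT.
Local Definition e3 : 'I_(3 + 1) := @Ordinal 4 2 isT.
Local Definition f : 'I_(3 + 1) := @Ordinal 4 3 isT.

Section Type31.
Variable K : fieldType.

Local Definition v (i : 'I_(3 + 1)) : 'rV[K]_(3 + 1) := delta_mx 0 i.
Local Definition h (i : 'I_(3 + 1)) : 'rV[K]_(3 + 1) := 2^-1 *: v i.

Definition J1 := of_table
  [:: (e1, e1, v e1); (e2, e2, v e2); (e3, e3, v e3)].
Definition J2 := of_table
  [:: (e1, e1, v e1); (e2, e2, v e2); (e3, e3, v e3); (e1, f, v f)].
Definition J3 := of_table
  [:: (e1, e1, v e1); (e2, e2, v e2); (e3, e3, v e3); (e1, f, h f)].
Definition J4 := of_table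
  [:: (e1, e1, v e1); (e2, e2, v e2); (e3, e3, v e3); (e1, f, h f);
      (e2, f, h f)].
Definition J21 := of_table
  [:: (e1, e1, v e1); (e1, e2, h e2); (e3, e3, v e3)].
Definition J22 := of_table
  [:: (e1, e1, v e1); (e1, e2, h e2); (e3, e3, v e3); (e3, f, v f)].
Definition J23 := of_table
  [:: (e1, e1, v e1); (e1, e2, h e2); (e3, e3, v e3); (e3, f, h f)].
Definition J24 := of_table
  [:: (e1, e1, v e1); (e1, e2, h e2); (e3, e3, v e3); (e1, f, v f)].
Definition J25 := of_table
  [:: (e1, e1, v e1); (e1, e2, h e2); (e3, e3, v e3); (e1, f, h f)].
Definition J26 := of_table
  [:: (e1, e1, v e1); (e1, e2, h e2); (e3, e3, v e3); (e1, f, h f);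
      (e3, f, h f)].
Definition J42 := of_table
  [:: (e1, e1, v e1); (e2, e2, v e2); (e3, e3, v e1 + v e2); (e1, e3, h e3);
      (e2, e3, h e3)].
Definition J43 := of_table
  [:: (e1, e1, v e1); (e2, e2, v e2); (e3, e3, v e1 + v e2); (e1, e3, h e3);
      (e2, e3, h e3); (e1, f, h f); (e2, f, h f)].
Definition J47 := of_table
  [:: (e1, e1, v e1); (e1, e2, h e2); (e1, e3, h e3)].
Definition J48 := of_table
  [:: (e1, e1, v e1); (e1, e2, h e2); (e1, e3, h e3); (e1, f, v f)].
Definition J49 := of_table
  [:: (e1, e1, v e1); (e1, e2, h e2); (e1, e3, h e3); (e1, f, h f)].
Definition J51 := of_table
  [:: (e1, e1, v e1); (e1, e2, h e2); (e2, e2, v e3); (e1, f, v f)].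
Definition J53 := of_table
  [:: (e1, e1, v e1); (e1, e2, h e2); (e2, e2, v e3); (e1, e3, v e3)].
Definition J54 := of_table
  [:: (e1, e1, v e1); (e1, e2, h e2); (e2, e2, v e3); (e1, e3, v e3);
      (e1, f, v f)].
Definition J55 := of_table
  [:: (e1, e1, v e1); (e1, e2, h e2); (e2, e2, v e3); (e1, e3, v e3);
      (e1, f, h f)].
Definition J57 := of_table
  [:: (e1, e1, v e1); (e2, e2, v e2); (e1, e3, h e3); (e2, e3, h e3);
      (e1, f, v f)].
Definition J58 := of_table
  [:: (e1, e1, v e1); (e2, e2, v e2); (e1, e3, h e3); (e2, e3, h e3);
      (e1, f, h f)].

Definition rigid31 : 21.-tuple {ffun sc_index 3 1 -> K} :=
  [tuple J1; J2; J3; J4; J21; J22; J23; J24; J25; J26; J42; J43; J47; J48; J49;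
         J51; J53; J54; J55; J57; J58].

End Type31.

(* Main.v *)
(** A Jordan superalgebra [J] of type (3, 1) is a three-dimensional commutative
    algebra [J_0] with a linear form [lam] given by [e f = lam e f]; the super
    Jordan identity says that [J_0] is a Jordan algebra and that [lam] satisfies
    one cubic identity.  To every [J] of the list we attach finitely many closed,
    isomorphism-invariant conditions (associativity, degeneracy of the trace form,
    eigenvalues of [L_x], linear relations between [lam] and the trace) which [J]
    violates, whereas every Jordan superalgebra outside the orbit of [J] satisfies
    one of them.  Hence each of the 21 orbits is open and no orbit lies in the closure
    of another.  On the other hand every Jordan superalgebra is a limit of algebras
    in one of the 21 orbits: either [x, x^2, x^3] is a basis for some [x], and the
    algebra is a limit of those whose characteristic polynomial of [L_x] has distinct
    nonzero roots; or there is a nonzero idempotent and the Peirce decomposition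
    leaves few cases; or all [x^3] vanish.  Orbits being irreducible, their closures
    are the components.  The dimension follows since [f |-> f] is always a derivation
    and the only one for the split algebra with [lam = 0]. *)

(* Neither orbit dimensions nor the theory of algebraic groups is used to find the components.
   Closures are controlled from inside by curves: a polynomial that vanishes at almost all points of
   a rational curve vanishes on all of it. This gives the limits, and, along segments of matrices,
   the irreducibility of the orbits. They are controlled from outside by the closed conditions. Both
   controls are checked at every leaf of one case analysis, recorded in [classified], from which
   covering, openness and non-inclusion follow formally. Two consequences of the cubic identity keep
   the cases finite: an idempotent has [lam] equal to 0, 1 or 1/2, and [lam] vanishes on
   associators, hence on the half spaces of a Peirce decomposition. The numbers in the conditions
   are the ratios between [tr L_x], an eigenvalue of [L_x] and [lam x] in the families of normal
   forms. Nilpotent parts do not show in these ratios; they are seen by associators and their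
   squares. *)
Require Import Defs.
From mathcomp Require Import all_boot all_order all_algebra.
From mathcomp Require Import classical_sets boolp reals.
From mathcomp Require Import mpoly complex ring.

Set Implicit Arguments.
Unset Strict Implicit.
Unset Printing Implicit Defensive.

Import Order.TTheory GRing.Theory Num.Theory.
Local Open Scope ring_scope.
Local Open Scope classical_set_scope.

(** * Zariski-closed sets and rational curves *)

Section ZariskiTheory.
Variables (K : numClosedFieldType) (I : finType).
Implicit Types (c : {ffun I -> K}) (Z Y X A : set {ffun I -> K}).

Definition pfun (F : {ffun I -> K} -> K) := exists p, forall c, peval p c = F c.

Lemma pfun_ext F G : (forall c, F c = G c) -> pfun F -> pfun G.
Proof. by move=> FG [p hp]; exists p => c; rewrite hp FG. Qed.
Lemma pfunC a : pfun (fun=> a).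
Proof. by exists a%:MP => c; rewrite /peval mevalC. Qed.
Lemma pfun_coord i : pfun (fun c => c i).
Proof. by exists 'X_(enum_rank i) => c; rewrite /peval mevalXU enum_rankK. Qed.
Lemma pfunD F G : pfun F -> pfun G -> pfun (fun c => F c + G c).
Proof. by move=> [p hp] [q hq]; exists (p + q) => c; rewrite -hp -hq /peval mevalD. Qed.
Lemma pfunM F G : pfun F -> pfun G -> pfun (fun c => F c * G c).
Proof. by move=> [p hp] [q hq]; exists (p * q) => c; rewrite -hp -hq /peval mevalM. Qed.
Lemma pfunN F : pfun F -> pfun (fun c => - F c).
Proof. by move=> [p hp]; exists (- p) => c; rewrite -hp /peval mevalN. Qed.
Lemma pfunX F n : pfun F -> pfun (fun c => F c ^+ n).
Proof. by move=> [p hp]; exists (p ^+ n) => c; rewrite -hp /peval rmorphXn. Qed.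
Lemma pfun_sum (T : Type) (r : seq T) (F : T -> _) :
  (forall t, pfun (F t)) -> pfun (fun c => \sum_(t <- r) F t c).
Proof.
move=> hF; elim: r => [|t r IH].
  by apply: (pfun_ext _ (pfunC 0)) => c; rewrite big_nil.
by apply: (pfun_ext _ (pfunD (hF t) IH)) => c; rewrite big_cons.
Qed.
Lemma pfun_prod (T : Type) (r : seq T) (F : T -> _) :
  (forall t, pfun (F t)) -> pfun (fun c => \prod_(t <- r) F t c).
Proof.
move=> hF; elim: r => [|t r IH].
  by apply: (pfun_ext _ (pfunC 1)) => c; rewrite big_nil.
by apply: (pfun_ext _ (pfunM (hF t) IH)) => c; rewrite big_cons.
Qed.
Lemma pfun_comp p (phi : {ffun I -> K} -> {ffun I -> K}) :
  (forall i, pfun (fun c => phi c i)) -> pfun (fun c => peval p (phi c)).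
Proof.
move=> hphi.
apply: (@pfun_ext (fun c => \sum_(m <- msupp p) p@_m *
  \prod_(i < #|I|) phi c (enum_val i) ^+ m i)) => [c|]; first by rewrite /peval mevalE.
apply: pfun_sum => m; apply: pfunM; first exact: pfunC.
by apply: pfun_prod => i; apply: pfunX.
Qed.

Lemma zclosed_zeros (T : Type) (F : T -> {ffun I -> K} -> K) :
  (forall t, pfun (F t)) -> zclosed [set c | forall t, F t c = 0].
Proof.
move=> hF; exists [set p | exists t, forall c, peval p c = F t c].
apply/seteqP; split=> c /= h => [p [t ->] //|t].
by have [p hp] := hF t; rewrite -hp; apply: h; exists t.
Qed.

Lemma zclosed_preim Z (phi : {ffun I -> K} -> {ffun I -> K}) :
  (forall i, pfun (fun c => phi c i)) -> zclosed Z -> zclosed [set c | Z (phi c)].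
Proof.
move=> hphi [S ->] /=.
have := @zclosed_zeros {p | S p} (fun p c => peval (sval p) (phi c)).
move/(_ (fun p => pfun_comp _ hphi)); congr zclosed.
by apply/seteqP; split=> c /= h => [p Sp|[p Sp]] /=; [exact: (h (exist _ p Sp))|exact: h].
Qed.

Lemma zclosedI (T : Type) (Z : T -> set {ffun I -> K}) :
  (forall t, zclosed (Z t)) -> zclosed [set c | forall t, Z t c].
Proof.
move=> hZ; have [S hS] := choice hZ; exists [set p | exists t, S t p].
apply/seteqP; split=> c /= h => [p [t Stp]|t].
  by have := h t; rewrite hS; apply.
by rewrite hS => p Sp; apply: h; exists t.
Qed.

Lemma zclosedU Y Z : zclosed Y -> zclosed Z -> zclosed (Y `|` Z).
Proof.
move=> [S hS] [T hT]; exists [set p | exists q r, [/\ S q, T r & p = q * r]].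
apply/seteqP; split=> c /=.
  move=> h _ [q [r [Sq Tr ->]]]; rewrite /peval mevalM; apply/eqP; rewrite mulf_eq0.
  by case: h; [rewrite hS => /(_ q Sq)|rewrite hT => /(_ r Tr)]; rewrite /peval => ->;
    rewrite eqxx ?orbT.
move=> h; have [hY|/existsNP [q /not_implyP [Sq nq]]] :=
  pselect (forall p, S p -> peval p c = 0); first by left; rewrite hS.
right; rewrite hT => r Tr /=; have := h _ (ex_intro _ q (ex_intro _ r (And3 Sq Tr erefl))).
by rewrite /peval mevalM => /eqP; rewrite mulf_eq0 => /orP[/eqP|/eqP].
Qed.

Lemma zclosed_false : zclosed (set0 : set {ffun I -> K}).
Proof.
exists setT; apply/seteqP; split=> c //= /(_ 1 Logic.I) /eqP.
by rewrite /peval meval1 oner_eq0.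
Qed.

Lemma zclosed_bigU (s : seq (set {ffun I -> K})) :
  (forall Z, List.In Z s -> zclosed Z) -> zclosed [set c | exists2 Z, List.In Z s & Z c].
Proof.
elim: s => [|Y s IH] h.
  by rewrite (_ : [set _ | _] = set0); [exact: zclosed_false|apply/seteqP; split=> c // []].
have := zclosedU (h Y (or_introl erefl)) (IH (fun Z hZ => h Z (or_intror hZ))).
congr zclosed; apply/seteqP; split=> c /=.
  by case=> [hY|[Z hZ hc]]; [exists Y => //; left|exists Z => //; right].
by move=> [Z [<-|hZ] hc]; [left|right; exists Z].
Qed.

Lemma zclosed_zclosure A : zclosed (zclosure A).
Proof.
rewrite /zclosure /smallest.
have := @zclosedI {Z | zclosed Z /\ A `<=` Z} (fun t => sval t)
  (fun t => (svalP t).1).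
congr zclosed; apply/seteqP; split=> c /= h.
  by move=> Z hZ; exact: (h (exist _ Z hZ)).
by move=> [Z hZ] /=; exact: h.
Qed.
Lemma sub_zclosure A : A `<=` zclosure A.
Proof. by move=> c Ac Z [_]; apply. Qed.
Lemma zclosure_sub A Z : zclosed Z -> A `<=` Z -> zclosure A `<=` Z.
Proof. by move=> hZ AZ c; apply. Qed.

Lemma zirreducible_closure A : zirreducible A -> zirreducible (zclosure A).
Proof.
case=> [[c Ac] irr]; split; first by exists c; exact: sub_zclosure.
move=> Y Z hY hZ h; have := irr Y Z hY hZ (subset_trans (@sub_zclosure A) h).
by case=> ?; [left|right]; apply: zclosure_sub.
Qed.

Lemma zirreducible_bigU (s : seq (set {ffun I -> K})) X :
  (forall Z, List.In Z s -> zclosed Z) -> zirreducible X ->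
  X `<=` [set c | exists2 Z, List.In Z s & Z c] -> exists2 Z, List.In Z s & X `<=` Z.
Proof.
elim: s => [|Y s IH] h irr hX.
  by case: irr => [[c Xc] _]; have [] := hX c Xc.
have hs Z hZ := h Z (or_intror hZ).
have [//|||XY|Xs] := irr.2 Y [set c | exists2 Z, List.In Z s & Z c].
- exact: h (or_introl erefl).
- exact: zclosed_bigU hs.
- by move=> c /hX [Z [<-|sZ] Zc]; [left|right; exists Z].
- by exists Y => //; left.
- by have [Z sZ XZ] := IH hs irr Xs; exists Z => //; right.
Qed.

(** The elements of the localization of [K[s]] at [d], as functions: only the values where [d] does
    not vanish are constrained. *)
Definition rfun (d : {poly K}) (f : K -> K) :=
  exists n P, forall s, d.[s] != 0 -> f s * d.[s] ^+ n = P.[s].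

Lemma rfun_ext d f g : (forall s, d.[s] != 0 -> f s = g s) -> rfun d f -> rfun d g.
Proof. by move=> fg [n [P h]]; exists n, P => s ds; rewrite -fg // h. Qed.
Lemma rfunP d P : rfun d (fun s => P.[s]).
Proof. by exists 0%N, P => s _; rewrite mulr1. Qed.
Lemma rfunC d a : rfun d (fun=> a).
Proof. by exists 0%N, a%:P => s _; rewrite mulr1 hornerC. Qed.
Lemma rfunV d : rfun d (fun s => d.[s]^-1).
Proof. by exists 1%N, 1 => s ds; rewrite mulVf // hornerC. Qed.
Lemma rfunD d f g : rfun d f -> rfun d g -> rfun d (fun s => f s + g s).
Proof.
move=> [n [P hP]] [m [Q hQ]]; exists (n + m)%N, (P * d ^+ m + Q * d ^+ n) => s ds.
rewrite hornerD !hornerM !horner_exp -hP // -hQ // mulrDl exprD !mulrA.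
by congr (_ + _); rewrite -!mulrA [d.[s] ^+ n * _]mulrC.
Qed.
Lemma rfunM d f g : rfun d f -> rfun d g -> rfun d (fun s => f s * g s).
Proof.
move=> [n [P hP]] [m [Q hQ]]; exists (n + m)%N, (P * Q) => s ds.
by rewrite hornerM -hP // -hQ // exprD mulrACA.
Qed.
Lemma rfun_peval d (gam : K -> {ffun I -> K}) p :
  (forall i, rfun d (fun s => gam s i)) -> rfun d (fun s => peval p (gam s)).
Proof.
move=> hg.
apply: (@rfun_ext d (fun s => \sum_(m <- msupp p) p@_m *
  \prod_(i < #|I|) gam s (enum_val i) ^+ m i)) => [s|]; first by rewrite /peval mevalE.
elim: (msupp p) => [|m r IH].
  by apply: (rfun_ext _ (rfunC d 0)) => s; rewrite big_nil.
apply: (@rfun_ext d (fun s => p@_m * \prod_(i < #|I|) gam s (enum_val i) ^+ m i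
  + \sum_(m <- r) p@_m * \prod_(i < #|I|) gam s (enum_val i) ^+ m i)).
  by move=> s _; rewrite big_cons.
apply: rfunD IH; apply: rfunM; first exact: rfunC.
elim: (index_enum _) => [|i e IH].
  by apply: (rfun_ext _ (rfunC d 1)) => s; rewrite big_nil.
apply: (@rfun_ext d (fun s => gam s (enum_val i) ^+ m i *
  \prod_(j <- e) gam s (enum_val j) ^+ m j)) => [s _|]; first by rewrite big_cons.
apply: rfunM IH; elim: (m i) => [|k IH].
  by apply: (rfun_ext _ (rfunC d 1)) => s; rewrite expr0.
by apply: (rfun_ext _ (rfunM (hg (enum_val i)) IH)) => s _; rewrite exprS.
Qed.

(** In characteristic zero the numerals below [size p] are distinct, which is one root more than the
    degree allows. *)
Lemma poly_eq0_infinite (p : {poly K}) : (forall x, p.[x] = 0) -> p = 0.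
Proof.
move=> h; apply/eqP; apply: contraT => p0.
pose rs : seq K := [seq i%:R | i <- iota 0 (size p)].
have rt : all (root p) rs by apply/allP => x _; apply/rootP.
have un : uniq rs.
  by rewrite map_inj_uniq ?iota_uniq // => i j /eqP; rewrite eqr_nat => /eqP.
by have := max_poly_roots p0 rt un; rewrite size_map size_iota ltnn.
Qed.

(** Along the curve an equation of [Z] is a quotient of some [P] by a power of [d]. The factors [w]
    and [d] absorb the excluded points, so [P * w * d] vanishes everywhere and [P = 0]; thus [Z]
    also contains the points where [w] vanishes. *)
Lemma zclosed_curve d w (gam : K -> {ffun I -> K}) Z s :
  (forall i, rfun d (fun s => gam s i)) -> zclosed Z -> w != 0 ->
  (forall s, d.[s] != 0 -> w.[s] != 0 -> Z (gam s)) -> d.[s] != 0 -> Z (gam s).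
Proof.
move=> hg [S ->] w0 h ds p Sp /=.
have [n [P hP]] := rfun_peval p hg.
have d0 : d != 0 by apply: contraNneq ds => ->; rewrite horner0.
have : P * w * d = 0.
  apply: poly_eq0_infinite => x; rewrite !hornerM.
  have [->|dx] := eqVneq d.[x] 0; first by rewrite mulr0.
  have [->|wx] := eqVneq w.[x] 0; first by rewrite mulr0 mul0r.
  by rewrite -hP // h // !mul0r.
move/eqP; rewrite !mulf_eq0 (negPf w0) (negPf d0) !orbF => /eqP P0.
by have := hP s ds; rewrite P0 horner0 => /eqP; rewrite mulf_eq0 expf_eq0 (negPf ds)
  andbF orbF => /eqP.
Qed.

(** If neither closed set contains [A], take [a] outside the first and [b] outside the second. On a
    curve joining them the product of the two separating polynomials vanishes, so one factor
    vanishes on the whole curve, which contradicts its value at an end. *)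
Lemma zirreducible_curves A : A !=set0 ->
  (forall a b, A a -> A b -> exists d (gam : K -> {ffun I -> K}) s t,
     [/\ forall i, rfun d (fun s => gam s i), d.[s] != 0 /\ d.[t] != 0,
         gam s = a /\ gam t = b & forall s, d.[s] != 0 -> A (gam s)]) ->
  zirreducible A.
Proof.
move=> A0 h; split=> // Y Z [S hS] [T hT] hYZ.
have [?|/existsNP [a /not_implyP [Aa nYa]]] := pselect (A `<=` Y); first by left.
have [?|/existsNP [b /not_implyP [Ab nZb]]] := pselect (A `<=` Z); first by right.
move: nYa nZb; rewrite {1}hS {1}hT => /existsNP [p /not_implyP [Sp npa]].
move=> /existsNP [q /not_implyP [Tq nqb]].
have [d [gam [s [t [hg [ds dt] [gs gt] hA]]]]] := h a b Aa Ab.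
have [n [P hP]] := rfun_peval p hg; have [m [Q hQ]] := rfun_peval q hg.
have : P * Q * d = 0.
  apply: poly_eq0_infinite => x; rewrite !hornerM.
  have [->|dx] := eqVneq d.[x] 0; first by rewrite mulr0.
  rewrite -hP // -hQ //; have := hYZ _ (hA x dx).
  by rewrite hS hT => -[/(_ p Sp)|/(_ q Tq)] ->; rewrite !(mul0r, mulr0).
move/eqP; rewrite !mulf_eq0 => /orP[/orP[]|] /eqP E.
- have := hP s ds; rewrite E horner0 gs => /eqP; rewrite mulf_eq0 expf_eq0 (negPf ds).
  by rewrite andbF orbF => /eqP.
- have := hQ t dt; rewrite E horner0 gt => /eqP; rewrite mulf_eq0 expf_eq0 (negPf dt).
  by rewrite andbF orbF => /eqP.
- by move: ds; rewrite E horner0 eqxx.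
Qed.

End ZariskiTheory.

(** * Products and linear forms in dimension three *)

Section Alg3.
Variable K : numClosedFieldType.

Record vec := Vec {v1 : K; v2 : K; v3 : K}.
(** The [r_i] are the images of the basis vectors. *)
Record mat := Mat {r1 : vec; r2 : vec; r3 : vec}.

Definition vadd x y := Vec (v1 x + v1 y) (v2 x + v2 y) (v3 x + v3 y).
Definition vscale a x := Vec (a * v1 x) (a * v2 x) (a * v3 x).
Definition vzero := Vec 0 0 0.
Definition vsub x y := vadd x (vscale (-1) y).
Definition b1 := Vec 1 0 0.
Definition b2 := Vec 0 1 0.
Definition b3 := Vec 0 0 1.

Definition app B x :=
  vadd (vscale (v1 x) (r1 B)) (vadd (vscale (v2 x) (r2 B)) (vscale (v3 x) (r3 B))).
Definition idm := Mat b1 b2 b3.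
Definition compm A B := Mat (app A (r1 B)) (app A (r2 B)) (app A (r3 B)).
Definition det3 x y z :=
  v1 x * (v2 y * v3 z - v3 y * v2 z) - v2 x * (v1 y * v3 z - v3 y * v1 z)
  + v3 x * (v1 y * v2 z - v2 y * v1 z).
Definition detm B := det3 (r1 B) (r2 B) (r3 B).
Definition trm B := v1 (r1 B) + v2 (r2 B) + v3 (r3 B).
Definition adjm B :=
  let: Mat (Vec a b c) (Vec d e f) (Vec g h i) := B in
  Mat (Vec (e * i - f * h) (c * h - b * i) (b * f - c * e))
      (Vec (f * g - d * i) (a * i - c * g) (c * d - a * f))
      (Vec (d * h - e * g) (b * g - a * h) (a * e - b * d)).
Definition scalem a B := Mat (vscale a (r1 B)) (vscale a (r2 B)) (vscale a (r3 B)).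
Definition invm B := scalem (detm B)^-1 (adjm B).

(** [pij] is the product of the basis vectors [i] and [j]; [wt] is the linear form
    [lam] with [e f = lam e f]. *)
Record alg := Alg
  {p11 : vec; p12 : vec; p13 : vec; p22 : vec; p23 : vec; p33 : vec; wt : vec}.

Definition amul D x y :=
  vadd (vscale (v1 x * v1 y) (p11 D))
 (vadd (vscale (v1 x * v2 y + v2 x * v1 y) (p12 D))
 (vadd (vscale (v1 x * v3 y + v3 x * v1 y) (p13 D))
 (vadd (vscale (v2 x * v2 y) (p22 D))
 (vadd (vscale (v2 x * v3 y + v3 x * v2 y) (p23 D))
       (vscale (v3 x * v3 y) (p33 D)))))).
Definition lam D x := v1 (wt D) * v1 x + v2 (wt D) * v2 x + v3 (wt D) * v3 x.

(** The structure of [E] transported along [B], when [B'] is its inverse. With [B'] a separate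
    argument the entries are polynomial in those of [B], [B'] and [E]. *)
Definition trans B B' E := Alg
  (app B (amul E (r1 B') (r1 B'))) (app B (amul E (r1 B') (r2 B')))
  (app B (amul E (r1 B') (r3 B'))) (app B (amul E (r2 B') (r2 B')))
  (app B (amul E (r2 B') (r3 B'))) (app B (amul E (r3 B') (r3 B')))
  (Vec (lam E (r1 B')) (lam E (r2 B')) (lam E (r3 B'))).

(** The scalar by which an isomorphism multiplies [f] cancels in [e f = lam e f], so only the even
    part [B], going from [E] to [D], is recorded. *)
Definition iso D E := exists2 B, detm B != 0 &
  (forall x y, amul D (app B x) (app B y) = app B (amul E x y)) /\
  (forall x, lam D (app B x) = lam E x).

Lemma vecP x y : v1 x = v1 y -> v2 x = v2 y -> v3 x = v3 y -> x = y.
Proof. by case: x y => [a b c] [a' b' c'] /= -> -> ->. Qed.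

Lemma vaddA x y z : vadd x (vadd y z) = vadd (vadd x y) z.
Proof. by apply: vecP => /=; ring. Qed.
Lemma appD B x y : app B (vadd x y) = vadd (app B x) (app B y).
Proof. by apply: vecP => /=; ring. Qed.
Lemma appZ B a x : app B (vscale a x) = vscale a (app B x).
Proof. by apply: vecP => /=; ring. Qed.
Lemma appB B x y : app B (vsub x y) = vsub (app B x) (app B y).
Proof. by apply: vecP => /=; ring. Qed.
Lemma app_id x : app idm x = x.
Proof. by apply: vecP => /=; ring. Qed.
Lemma app_comp A B x : app (compm A B) x = app A (app B x).
Proof. by apply: vecP => /=; ring. Qed.
Lemma app_b1 B : app B b1 = r1 B. Proof. by apply: vecP => /=; ring. Qed.
Lemma app_b2 B : app B b2 = r2 B. Proof. by apply: vecP => /=; ring. Qed.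
Lemma app_b3 B : app B b3 = r3 B. Proof. by apply: vecP => /=; ring. Qed.
Lemma vec_basis x :
  x = vadd (vscale (v1 x) b1) (vadd (vscale (v2 x) b2) (vscale (v3 x) b3)).
Proof. by apply: vecP => /=; ring. Qed.

Lemma detm_comp A B : detm (compm A B) = detm A * detm B.
Proof. by rewrite /detm /det3 /=; ring. Qed.
Lemma detm_id : detm idm = 1.
Proof. by rewrite /detm /det3 /=; ring. Qed.

Lemma amulC D x y : amul D x y = amul D y x.
Proof. by apply: vecP => /=; ring. Qed.
Lemma amulDl D x y z : amul D (vadd x y) z = vadd (amul D x z) (amul D y z).
Proof. by apply: vecP => /=; ring. Qed.
Lemma amulDr D x y z : amul D z (vadd x y) = vadd (amul D z x) (amul D z y).
Proof. by apply: vecP => /=; ring. Qed.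
Lemma amulZl D a x y : amul D (vscale a x) y = vscale a (amul D x y).
Proof. by apply: vecP => /=; ring. Qed.
Lemma amulZr D a x y : amul D x (vscale a y) = vscale a (amul D x y).
Proof. by apply: vecP => /=; ring. Qed.
Lemma lamD D x y : lam D (vadd x y) = lam D x + lam D y.
Proof. by rewrite /lam /=; ring. Qed.
Lemma lamZ D a x : lam D (vscale a x) = a * lam D x.
Proof. by rewrite /lam /=; ring. Qed.

Lemma adjmK B : compm B (adjm B) = scalem (detm B) idm.
Proof.
case: B => [[a b c] [d e f] [g h i]].
by rewrite /compm /scalem /=; congr Mat; apply: vecP; rewrite /detm /det3 /=; ring.
Qed.
Lemma adjmKV B : compm (adjm B) B = scalem (detm B) idm.
Proof.
case: B => [[a b c] [d e f] [g h i]].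
by rewrite /compm /scalem /=; congr Mat; apply: vecP; rewrite /detm /det3 /=; ring.
Qed.
Lemma app_scalem a B x : app (scalem a B) x = vscale a (app B x).
Proof. by apply: vecP => /=; ring. Qed.
Lemma scalevA a b x : vscale a (vscale b x) = vscale (a * b) x.
Proof. by apply: vecP => /=; ring. Qed.
Lemma scale1v x : vscale 1 x = x.
Proof. by apply: vecP => /=; ring. Qed.

Lemma invmK B x : detm B != 0 -> app B (app (invm B) x) = x.
Proof.
move=> dB; rewrite app_scalem appZ -app_comp adjmK app_scalem app_id scalevA.
by rewrite mulVf // scale1v.
Qed.
Lemma invmKV B x : detm B != 0 -> app (invm B) (app B x) = x.
Proof.
move=> dB; rewrite app_scalem -app_comp adjmKV app_scalem app_id scalevA.
by rewrite mulVf // scale1v.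
Qed.
Lemma invm_comp B : detm B != 0 -> compm (invm B) B = idm.
Proof.
move=> dB; rewrite /compm -[r1 B]app_b1 -[r2 B]app_b2 -[r3 B]app_b3.
by rewrite !invmKV.
Qed.
Lemma detm_inv B : detm B != 0 -> detm (invm B) != 0.
Proof.
move=> dB; apply/eqP => d0; have := detm_comp (invm B) B.
by rewrite invm_comp // detm_id d0 mul0r => /eqP; rewrite oner_eq0.
Qed.

Lemma iso_refl D : iso D D.
Proof. by exists idm; rewrite ?detm_id ?oner_eq0 //; split=> *; rewrite !app_id. Qed.
Lemma iso_sym D E : iso D E -> iso E D.
Proof.
case=> B dB [hm hl]; exists (invm B); first exact: detm_inv.
split=> [x y|x]; last by rewrite -hl invmK.
by rewrite -[LHS](invmKV _ dB) -hm !invmK.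
Qed.
Lemma iso_trans D E F : iso D E -> iso E F -> iso D F.
Proof.
case=> B dB [hm hl] [C dC [hm' hl']]; exists (compm B C).
  by rewrite detm_comp mulf_neq0.
by split=> [x y|x]; rewrite !app_comp ?hm ?hm' ?hl ?hl'.
Qed.

Lemma amul_basis D :
  [/\ amul D b1 b1 = p11 D, amul D b1 b2 = p12 D & amul D b1 b3 = p13 D] /\
  [/\ amul D b2 b2 = p22 D, amul D b2 b3 = p23 D & amul D b3 b3 = p33 D].
Proof. by split; split; apply: vecP => /=; ring. Qed.

Lemma alg_ext D E : amul D =2 amul E -> lam D =1 lam E -> D = E.
Proof.
move=> hm hl.
have [[d11 d12 d13] [d22 d23 d33]] := amul_basis D.
have [[h1 h2 h3] [h4 h5 h6]] := amul_basis E.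
move: h1 h2 h3 h4 h5 h6; rewrite -!hm d11 d12 d13 d22 d23 d33 => h1 h2 h3 h4 h5 h6.
have wtE F : wt F = Vec (lam F b1) (lam F b2) (lam F b3).
  by apply: vecP; rewrite /lam /=; ring.
have : wt D = wt E by rewrite !wtE !hl.
by case: D E h1 h2 h3 h4 h5 h6 {hm hl d11 d12 d13 d22 d23 d33} =>
  ? ? ? ? ? ? ? [? ? ? ? ? ? ?] /= -> -> -> -> -> -> ->.
Qed.

Lemma amul_trans B B' E x y :
  amul (trans B B' E) x y = app B (amul E (app B' x) (app B' y)).
Proof.
rewrite [app B' x]/app [app B' y]/app !(amulDl, amulDr, amulZl, amulZr).
rewrite (amulC E (r2 B') (r1 B')) (amulC E (r3 B') (r1 B')) (amulC E (r3 B') (r2 B')).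
rewrite [in LHS]/amul /trans; cbn [p11 p12 p13 p22 p23 p33].
move: (amul E (r1 _) (r1 _)) (amul E (r1 _) (r2 _)) (amul E (r1 _) (r3 _))
  (amul E (r2 _) (r2 _)) (amul E (r2 _) (r3 _)) (amul E (r3 _) (r3 _)) => A1 A2 A3 A4 A5 A6.
by rewrite !(appD, appZ); apply: vecP => /=; ring.
Qed.
Lemma lam_trans B B' E x : lam (trans B B' E) x = lam E (app B' x).
Proof. by rewrite /trans /lam /=; ring. Qed.

Lemma iso_transP D E :
  iso D E <-> exists2 B, detm B != 0 & D = trans B (invm B) E.
Proof.
split=> [[B dB [hm hl]]|[B dB ->]]; exists B => //.
  apply: alg_ext => [x y|x]; rewrite ?amul_trans ?lam_trans.
    by rewrite -hm !invmK.
  by rewrite -hl invmK.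
by split=> *; rewrite ?amul_trans ?lam_trans !invmKV.
Qed.

Lemma iso_basis D E x y z : det3 x y z != 0 ->
  let B := Mat x y z in
  amul D x x = app B (p11 E) -> amul D x y = app B (p12 E) ->
  amul D x z = app B (p13 E) -> amul D y y = app B (p22 E) ->
  amul D y z = app B (p23 E) -> amul D z z = app B (p33 E) ->
  lam D x = v1 (wt E) -> lam D y = v2 (wt E) -> lam D z = v3 (wt E) ->
  iso D E.
Proof.
move=> dB B h11 h12 h13 h22 h23 h33 l1 l2 l3; exists B => //; split=> [u v|u].
  rewrite [in LHS]/app /= !(amulDl, amulDr, amulZl, amulZr).
  rewrite [amul D y x]amulC [amul D z x]amulC [amul D z y]amulC.
  rewrite h11 h12 h13 h22 h23 h33 /amul !(appD, appZ).
  by apply: vecP => /=; ring.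
by rewrite /app !(lamD, lamZ) /= l1 l2 l3 /lam; ring.
Qed.

(** The second clause is the super identity with the odd vector in the place of [t], read off on the
    coefficient of [f]. *)
Definition jordan D :=
  (forall x y z t, let m := amul D in
     vadd (m (m (m x y) z) t) (vadd (m (m (m x t) z) y) (m (m (m y t) z) x))
     = vadd (m (m x y) (m z t)) (vadd (m (m x t) (m y z)) (m (m x z) (m y t)))) /\
  (forall x y z, let l := lam D in let m := amul D in
     l (m (m x y) z) = l (m x y) * l z + l (m y z) * l x + l (m x z) * l y
                       - 2 * (l x * l y * l z)).

Lemma jordan_iso D E : iso D E -> jordan D -> jordan E.
Proof.
case=> B dB [hm hl] [j1 j2]; split=> [x y z t|x y z] /=; last first.
  by have := j2 (app B x) (app B y) (app B z); rewrite /= !hm !hl.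
have := j1 (app B x) (app B y) (app B z) (app B t).
by rewrite /= !hm -!appD => /(congr1 (app (invm B))); rewrite !invmKV.
Qed.

(** * Conditions invariant under isomorphism *)

Definition Lm D x := Mat (amul D x b1) (amul D x b2) (amul D x b3).
Definition tr D x := trm (Lm D x).

Definition assoc D := forall x y z, amul D (amul D x y) z = amul D x (amul D y z).
(** In [E8 1] and [E11 1] below, [e2] is a multiple of an associator and [e2^2 = e3]; this condition
    separates them from the algebras where the associators square to zero. *)
Definition assoc2 D := forall x y z,
  let a := vsub (amul D (amul D x y) z) (amul D x (amul D y z)) in amul D a a = vzero.
Definition gramdet D x y z :=
  let T u v := tr D (amul D u v) in
  det3 (Vec (T x x) (T x y) (T x z)) (Vec (T x y) (T y y) (T y z))
       (Vec (T x z) (T y z) (T z z)).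
Definition gram D := forall x y z, gramdet D x y z = 0.
Definition shiftm n s A :=
  Mat (vsub (vscale n (r1 A)) (vscale s b1)) (vsub (vscale n (r2 A)) (vscale s b2))
      (vsub (vscale n (r3 A)) (vscale s b3)).
(** The number [(a tr L_x + b lam x) / n] is an eigenvalue of [L_x]. *)
Definition wdet n a b D :=
  forall x, detm (shiftm n (a * tr D x + b * lam D x) (Lm D x)) = 0.
Definition wlin a b D := forall x, a * tr D x + b * lam D x = 0.
(** If [L_x] has the eigenvalues [r], [r / 2], [s] and [tr L_(x^2) = 3 r^2 / 2 + s^2],
    then [d = r^2 / 4] and [t2 - (tr L_x)^2 + 3 d = - 3 r s]; this relation is what
    remains after eliminating [r] and [s]. *)
Definition quart D := forall x,
  let t2 := tr D (amul D x x) in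
  let d := t2 - trm (compm (Lm D x) (Lm D x)) in
  (t2 - tr D x ^+ 2 + 3 * d) ^+ 2 = 36 * d * (t2 - 6 * d).

Lemma Lm_app D x y : app (Lm D x) y = amul D x y.
Proof. by rewrite [in RHS](vec_basis y) !(amulDr, amulZr). Qed.

Lemma compm_ext A B : app A =1 app B -> A = B.
Proof.
move=> h; have := (h b1, h b2, h b3); rewrite !app_b1 !app_b2 !app_b3.
by case: A B {h} => ? ? ? [? ? ?] [[/= -> ->] ->].
Qed.

(** An isomorphism conjugates the multiplication operators, so conditions on traces and determinants
    of the [L_x] are invariant. *)
Lemma iso_Lm D E B : detm B != 0 ->
  (forall x y, amul D (app B x) (app B y) = app B (amul E x y)) ->
  forall x, Lm D (app B x) = compm B (compm (Lm E x) (invm B)).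
Proof.
move=> dB hm x; apply: compm_ext => y.
by rewrite !app_comp !Lm_app -hm invmK.
Qed.

Lemma trm_comp A B : trm (compm A B) = trm (compm B A).
Proof. by rewrite /trm /=; ring. Qed.
Lemma compmA A B C : compm A (compm B C) = compm (compm A B) C.
Proof. by apply: compm_ext => x; rewrite !app_comp. Qed.
Lemma compm_id A : compm A idm = A.
Proof. by apply: compm_ext => x; rewrite !app_comp app_id. Qed.
Lemma trm_conj A B : detm B != 0 -> trm (compm B (compm A (invm B))) = trm A.
Proof.
by move=> dB; rewrite trm_comp -compmA invm_comp // compm_id.
Qed.
Lemma compm_conj A A' B : detm B != 0 ->
  compm (compm B (compm A (invm B))) (compm B (compm A' (invm B)))
  = compm B (compm (compm A A') (invm B)).
Proof.
by move=> dB; apply: compm_ext => x; rewrite !app_comp invmKV.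
Qed.
Lemma detm_conj A B : detm B != 0 -> detm (compm B (compm A (invm B))) = detm A.
Proof.
move=> dB; rewrite !detm_comp mulrC -mulrA -detm_comp invm_comp //.
by rewrite detm_id mulr1.
Qed.
Lemma app_shiftm n s A x :
  app (shiftm n s A) x = vsub (vscale n (app A x)) (vscale s x).
Proof. by apply: vecP => /=; ring. Qed.
Lemma shiftm_conj n s A B : detm B != 0 ->
  shiftm n s (compm B (compm A (invm B))) = compm B (compm (shiftm n s A) (invm B)).
Proof.
move=> dB; apply: compm_ext => x; rewrite !app_comp !app_shiftm !app_comp.
by rewrite appB !appZ invmK.
Qed.

Section Invariance.
Variables (D E : alg) (hiso : iso D E).
Lemma assoc_iso : assoc D -> assoc E.
Proof.
case: hiso => B dB [hm hl] h x y z.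
by rewrite -[LHS](invmKV _ dB) -!hm h !hm invmKV.
Qed.
Lemma assoc2_iso : assoc2 D -> assoc2 E.
Proof.
case: hiso => B dB [hm hl] h x y z /=.
have := h (app B x) (app B y) (app B z); rewrite /= !hm.
rewrite -appB hm => /(congr1 (app (invm B))); rewrite invmKV // => ->.
by apply: vecP => /=; ring.
Qed.
Lemma gram_iso : gram D -> gram E.
Proof.
case: hiso => B dB [hm hl] h x y z /=.
have := h (app B x) (app B y) (app B z).
by rewrite /gramdet /tr !hm !(iso_Lm dB hm) !trm_conj.
Qed.
Lemma wdet_iso n a b : wdet n a b D -> wdet n a b E.
Proof.
case: hiso => B dB [hm hl] h x /=; have := h (app B x).
by rewrite /tr (iso_Lm dB hm) trm_conj // shiftm_conj // detm_conj // hl.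
Qed.
Lemma wlin_iso a b : wlin a b D -> wlin a b E.
Proof.
case: hiso => B dB [hm hl] h x /=; have := h (app B x).
by rewrite /tr (iso_Lm dB hm) trm_conj // hl.
Qed.
Lemma quart_iso : quart D -> quart E.
Proof.
case: hiso => B dB [hm hl] h x /=; have := h (app B x).
by rewrite /tr !hm !(iso_Lm dB hm) compm_conj // !trm_conj.
Qed.
End Invariance.

End Alg3.

Arguments v1 {K} _.
Arguments v2 {K} _.
Arguments v3 {K} _.
Arguments b1 {K}.
Arguments b2 {K}.
Arguments b3 {K}.
Arguments vzero {K}.
Arguments idm {K}.

(** * Structure constants of type (3, 1) *)

Section Coef.
Variables (K : fieldType) (m n : nat).
Implicit Types c : {ffun sc_index m n -> K}.
(** Extended by zero to the triples of wrong parity, so that sums may run over all indices. *)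
Definition coef c (i j k : 'I_(m + n)) : K :=
  if (insub (i, j, k) : option (sc_index m n)) is Some s then c s else 0.
Lemma coef_val c (s : sc_index m n) :
  coef c (val s).1.1 (val s).1.2 (val s).2 = c s.
Proof. by rewrite /coef -!surjective_pairing valK. Qed.
Lemma coef_odd c i j k : bpar k != bpar i (+) bpar j -> coef c i j k = 0.
Proof. by move=> h; rewrite /coef insubF //=; apply: negPf. Qed.
Lemma smulE c (x y : 'rV_(m + n)) k :
  smul c x y 0 k = \sum_i \sum_j coef c i j k * x 0 i * y 0 j.
Proof.
rewrite /smul summxE pair_big /=.
pose G (t : 'I_(m + n) * 'I_(m + n) * 'I_(m + n)) :=
  coef c t.1.1 t.1.2 t.2 * x 0 t.1.1 * y 0 t.1.2.
rewrite (eq_bigr (fun p => \sum_l if l == k then G (p, l) else 0)); last first.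
  by move=> p _; rewrite -big_mkcond big_pred1_eq.
rewrite pair_big /= (eq_bigr (fun t => if t.2 == k then G t else 0)); last by case.
rewrite [RHS](bigID (fun t => bpar t.2 == bpar t.1.1 (+) bpar t.1.2)) /=.
rewrite [X in _ = _ + X]big1 ?addr0; last first.
  by move=> t ht; case: eqP => // _; rewrite /G coef_odd ?mul0r.
rewrite (reindex_omap (fun s : sc_index m n => val s) insub) /=; last first.
  by move=> t ht; rewrite insubT.
apply: eq_big => [s|s _].
  by rewrite (valP s) (valK s) eqxx.
rewrite !mxE eqxx /= eq_sym /G coef_val.
by case: eqP => _; rewrite ?mulr1 ?mulr0.
Qed.
Lemma smul_delta c i j k : smul c (delta_mx 0 i) (delta_mx 0 j) 0 k = coef c i j k.
Proof.
rewrite smulE (bigD1 i) //= (bigD1 j) //= !mxE !eqxx !mulr1.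
rewrite !big1 ?addr0 // => [i' h|j' h].
  by rewrite big1 // => j' _; rewrite !mxE (negPf h) mulr0 mul0r.
by rewrite !mxE (negPf h) mulr0.
Qed.
Lemma has_parity_delta (i : 'I_(m + n)) : has_parity (bpar i) (delta_mx 0 i : 'rV[K]_(m+n)).
Proof.
rewrite /has_parity /bpar; case: ifP => h; apply/rowP=> j; rewrite !mxE eqxx /=.
  by case: eqP => // E; move: h; rewrite -E /= leqNgt ltn_ord.
by case: eqP => // E; move: h; rewrite -E /= leq_addr.
Qed.
Lemma supercomm_coef c i j k : supercommutative c ->
  coef c i j k = (-1) ^+ (bpar i * bpar j) * coef c j i k.
Proof.
move=> /(_ _ _ _ _ (has_parity_delta i) (has_parity_delta j)) /rowP /(_ k).
by rewrite mxE !smul_delta.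
Qed.
End Coef.

(** * Algebras with a linear form as points of the variety *)

Section Bridge.
Variable K : numClosedFieldType.
Notation sc := {ffun sc_index 3 1 -> K}.
Notation alg := (alg K).
Notation vec := (vec K).
Implicit Types (c : sc) (D E : alg) (x y z t : vec).

Definition o0 : 'I_(3 + 1) := @Ordinal 4 0 isT.
Definition o1 : 'I_(3 + 1) := @Ordinal 4 1 isT.
Definition o2 : 'I_(3 + 1) := @Ordinal 4 2 isT.
Definition o3 : 'I_(3 + 1) := @Ordinal 4 3 isT.

Lemma ord4P (P : 'I_(3 + 1) -> Prop) : P o0 -> P o1 -> P o2 -> P o3 -> forall i, P i.
Proof.
move=> h0 h1 h2 h3 [[|[|[|[|i]]]] hi] //=.
- by rewrite (_ : Ordinal hi = o0) //; apply: val_inj.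
- by rewrite (_ : Ordinal hi = o1) //; apply: val_inj.
- by rewrite (_ : Ordinal hi = o2) //; apply: val_inj.
- by rewrite (_ : Ordinal hi = o3) //; apply: val_inj.
Qed.

Lemma sum_ord4 (F : 'I_(3 + 1) -> K) : \sum_i F i = F o0 + (F o1 + (F o2 + F o3)).
Proof.
rewrite !big_ord_recl big_ord0 addr0.
by congr (F _ + (F _ + (F _ + F _))); apply: val_inj.
Qed.

Definition ventry x (k : nat) : K :=
  match k with 0 => v1 x | 1 => v2 x | 2 => v3 x | _ => 0 end.

Definition tab D (i j k : nat) : K :=
  match i, j with
  | 0, 0 => ventry (p11 D) k
  | 0, 1 | 1, 0 => ventry (p12 D) k
  | 0, 2 | 2, 0 => ventry (p13 D) k
  | 1, 1 => ventry (p22 D) k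
  | 1, 2 | 2, 1 => ventry (p23 D) k
  | 2, 2 => ventry (p33 D) k
  | 3, l | l, 3 => if k is 3 then ventry (wt D) l else 0
  | _, _ => 0
  end.

Definition ofalg D : sc := [ffun s : sc_index 3 1 => tab D (val s).1.1 (val s).1.2 (val s).2].

Lemma coef_ofalg D i j k : coef (ofalg D) i j k = tab D i j k.
Proof.
rewrite /coef; case: insubP => [s _ hs|]; first by rewrite ffunE hs.
by elim/ord4P: i; elim/ord4P: j; elim/ord4P: k.
Qed.

Definition cvec c i j := Vec (coef c i j o0) (coef c i j o1) (coef c i j o2).
Definition toalg c := Alg (cvec c o0 o0) (cvec c o0 o1) (cvec c o0 o2)
  (cvec c o1 o1) (cvec c o1 o2) (cvec c o2 o2)
  (Vec (coef c o0 o3 o3) (coef c o1 o3 o3) (coef c o2 o3 o3)).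

Lemma ofalgK D : toalg (ofalg D) = D.
Proof.
rewrite /toalg /cvec !coef_ofalg /=.
by case: D => [[? ? ?] [? ? ?] [? ? ?] [? ? ?] [? ? ?] [? ? ?] [? ? ?]].
Qed.

(** Parity kills the coefficient of [f] in [e_i e_j] and the even coefficients of [e_i f], and
    [f f = - f f] is zero; what remains is what [toalg] records. *)
Lemma supercomm_alg c : supercommutative c -> c = ofalg (toalg c).
Proof.
move=> hc; apply/ffunP => s; rewrite ffunE -[LHS]coef_val.
have {}hc i j k := supercomm_coef i j k hc.
have h33 k : coef c o3 o3 k = 0.
  have := hc o3 o3 k; rewrite /= expr1 mulN1r => /eqP.
  by rewrite -addr_eq0 -mulr2n mulrn_eq0 => /eqP.
have hf i j k : (coef c i j k = 0) \/ bpar k = bpar i (+) bpar j.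
  by case: (eqVneq (bpar k) (bpar i (+) bpar j)) => h; [right|left; rewrite coef_odd].
case: s => [[[i j] k] /= hs].
move: hs; elim/ord4P: i; elim/ord4P: j; elim/ord4P: k => //= _;
  rewrite ?h33 // hc /= ?expr0 mul1r //.
Qed.

Definition row4 x (a : K) : 'rV[K]_(3 + 1) :=
  \row_i match val i with 0 => v1 x | 1 => v2 x | 2 => v3 x | _ => a end.
Definition vec_of (u : 'rV[K]_(3 + 1)) := Vec (u 0 o0) (u 0 o1) (u 0 o2).

Lemma row4E (u : 'rV_(3 + 1)) : u = row4 (vec_of u) (u 0 o3).
Proof. by apply/rowP; elim/ord4P; rewrite mxE. Qed.
Lemma row4_inj x y a b : row4 x a = row4 y b -> x = y /\ a = b.
Proof.
move=> /rowP h; have := (h o0, h o1, h o2, h o3); rewrite !mxE /= => -[[[h0 h1] h2] h3].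
by split=> //; apply: vecP.
Qed.
Lemma row4D x y a b : row4 x a + row4 y b = row4 (vadd x y) (a + b).
Proof. by apply/rowP; elim/ord4P; rewrite !mxE. Qed.
Lemma row4Z x a b : b *: row4 x a = row4 (vscale b x) (b * a).
Proof. by apply/rowP; elim/ord4P; rewrite !mxE. Qed.

Lemma smul_row4 D x y a b :
  smul (ofalg D) (row4 x a) (row4 y b) = row4 (amul D x y) (lam D x * b + a * lam D y).
Proof.
apply/rowP => k; rewrite smulE !sum_ord4 !coef_ofalg !mxE /=.
by elim/ord4P: k; rewrite /= /lam /=; ring.
Qed.

Lemma has_parity_even x : has_parity false (row4 x 0).
Proof.
apply/rowP => i; rewrite !mxE /=.
by case: i => [[|i] hi].
Qed.
Lemma has_parity_odd a : has_parity true (row4 vzero a).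
Proof. by apply/rowP => i; rewrite !mxE /=; case: i => [[|[|[|i]]] hi]. Qed.
Lemma has_parityP (d : bool) u : has_parity d u ->
  if d then exists a, u = row4 vzero a else exists x, u = row4 x 0.
Proof.
case: d => /= /rowP h.
  exists (u 0 o3); rewrite [LHS]row4E; congr row4.
  have := (h (@Ordinal 3 0 isT), h (@Ordinal 3 1 isT), h (@Ordinal 3 2 isT)).
  rewrite !mxE => -[[h0 h1] h2]; apply: vecP => /=.
  - by rewrite -h0; congr (u 0 _); apply: val_inj.
  - by rewrite -h1; congr (u 0 _); apply: val_inj.
  - by rewrite -h2; congr (u 0 _); apply: val_inj.
exists (vec_of u); rewrite [LHS]row4E; congr row4.
by have := h ord0; rewrite !mxE => <-; congr (u 0 _); apply: val_inj.
Qed.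

Lemma supercomm_ofalg D : supercommutative (ofalg D).
Proof.
move=> dx dy u v /has_parityP hu /has_parityP hv.
case: dx hu; case: dy hv => /= -[y ->] [x ->];
  rewrite !smul_row4 row4Z; congr row4; try (by apply: vecP => /=; ring);
  by rewrite /lam /=; ring.
Qed.

Lemma JS_ofalg D : jordan D <-> JS K 3 1 (ofalg D).
Proof.
split=> [[j1 j2]|[_ hj]].
  split; first exact: supercomm_ofalg.
  move=> dx dy dz dt u v w s /has_parityP hu /has_parityP hv /has_parityP hw
    /has_parityP hs /=.
  have l0 : lam D vzero = 0 by rewrite /lam /=; ring.
  have m0 x : amul D vzero x = vzero by apply: vecP => /=; ring.
  have m0' x : amul D x vzero = vzero by apply: vecP => /=; ring.
  have a0 : vadd vzero vzero = vzero :> vec by apply: vecP => /=; ring.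
  have s0 a : vscale a vzero = vzero :> vec by apply: vecP => /=; ring.
  (* Two odd arguments make every term vanish, since [f f = 0]. A single odd one gives the cubic
     identity in the places [x], [y] and [t], and a tautology in the place [z]. *)
  case: dx hu; case: dy hv; case: dz hw; case: dt hs => /= -[t ->] [z ->] [y ->] [x ->];
  rewrite !smul_row4 ?(m0, m0', l0) ?row4Z !row4D ?(m0, m0', l0, a0, s0);
  congr row4; rewrite ?(mul0r, mulr0, addr0, add0r, a0) ?expr0 ?mul1r ?scale1v //;
  try (by rewrite /=; ring).
  - by rewrite j2 /= (amulC D t z); ring.
  - by rewrite j2 /= (amulC D t z); ring.
  - by rewrite j2 /=; ring.
  - by rewrite -[LHS]vaddA -[RHS]vaddA; exact: j1.
split=> [x y z t|x y z] /=.
  have := hj _ _ _ _ _ _ _ _ (has_parity_even x) (has_parity_even y)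
     (has_parity_even z) (has_parity_even t).
  rewrite /= !smul_row4 /= !expr0 !scale1r !row4D => /row4_inj [+ _].
  by rewrite -[LHS]vaddA -[RHS]vaddA.
have := hj _ _ _ _ _ _ _ _ (has_parity_even x) (has_parity_even y)
     (has_parity_even z) (has_parity_odd 1).
rewrite /= !smul_row4 /= !expr0 !scale1r !row4D => /row4_inj [_ h].
apply/eqP; rewrite -subr_eq0; apply/eqP.
move/eqP: h; rewrite -subr_eq0 => /eqP <-; rewrite !mulr1 !mul0r !addr0; ring.
Qed.

Lemma JSP c : JS K 3 1 c <-> c = ofalg (toalg c) /\ jordan (toalg c).
Proof.
split=> [hc|[-> hj]]; last by rewrite ofalgK in hj *; apply/JS_ofalg.
have cE := supercomm_alg hc.1; split=> //; apply/JS_ofalg; by rewrite -cE.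
Qed.

Definition mx_of (B : mat K) : 'M[K]_3 := \matrix_(i, j)
  ventry match val i with 0 => r1 B | 1 => r2 B | _ => r3 B end j.
Definition rvec (A : 'M[K]_3) i :=
  Vec (A i (@Ordinal 3 0 isT)) (A i (@Ordinal 3 1 isT)) (A i (@Ordinal 3 2 isT)).
Definition of_mx (A : 'M[K]_3) :=
  Mat (rvec A (@Ordinal 3 0 isT)) (rvec A (@Ordinal 3 1 isT)) (rvec A (@Ordinal 3 2 isT)).

Lemma ord3P (P : 'I_3 -> Prop) : P (@Ordinal 3 0 isT) -> P (@Ordinal 3 1 isT) ->
  P (@Ordinal 3 2 isT) -> forall i, P i.
Proof.
move=> h0 h1 h2 [[|[|[|i]]] hi] //=.
- by rewrite (_ : Ordinal hi = @Ordinal 3 0 isT) //; apply: val_inj.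
- by rewrite (_ : Ordinal hi = @Ordinal 3 1 isT) //; apply: val_inj.
- by rewrite (_ : Ordinal hi = @Ordinal 3 2 isT) //; apply: val_inj.
Qed.
Lemma sum_ord3 (F : 'I_3 -> K) : \sum_i F i =
  F (@Ordinal 3 0 isT) + (F (@Ordinal 3 1 isT) + F (@Ordinal 3 2 isT)).
Proof.
rewrite !big_ord_recl big_ord0 addr0.
by congr (F _ + (F _ + F _)); apply: val_inj.
Qed.

Lemma of_mxK A : mx_of (of_mx A) = A.
Proof. by apply/matrixP; elim/ord3P; elim/ord3P; rewrite mxE. Qed.
Lemma mx_ofK B : of_mx (mx_of B) = B.
Proof.
by case: B => [[? ? ?] [? ? ?] [? ? ?]]; rewrite /of_mx /rvec !mxE.
Qed.
Lemma mx_of_comp A B : mx_of (compm A B) = mx_of B *m mx_of A.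
Proof.
by apply/matrixP; elim/ord3P; elim/ord3P; rewrite !mxE sum_ord3 !mxE /=; ring.
Qed.
Lemma mx_of_id : mx_of idm = 1%:M.
Proof. by apply/matrixP; elim/ord3P; elim/ord3P; rewrite !mxE. Qed.
Lemma unit_mx_of B : detm B != 0 -> mx_of B \in unitmx.
Proof.
move=> dB; have := mx_of_comp (invm B) B; rewrite invm_comp // mx_of_id.
by move=> /esym /mulmx1_unit [].
Qed.
Lemma detm_of_mx A : A \in unitmx -> detm (of_mx A) != 0.
Proof.
move=> uA; apply/eqP => d0.
have := detm_comp (of_mx (invmx A)) (of_mx A).
rewrite (_ : compm _ _ = idm) ?detm_id ?d0 ?mulr0; last first.
  by rewrite -[LHS]mx_ofK mx_of_comp !of_mxK mulmxV // -mx_of_id mx_ofK.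
by move/eqP; rewrite oner_eq0.
Qed.

Lemma row4_mul B (g : K) x a :
  row4 x a *m block_mx (mx_of B) 0 0 g%:M = row4 (app B x) (a * g).
Proof.
have lE (i : 'I_3) : row4 x a 0 (lshift 1 i) = ventry x i.
  by rewrite mxE; elim/ord3P: i.
have rE : row4 x a = row_mx (\row_i ventry x i) a%:M.
  apply/rowP => j; rewrite -[j]splitK; case: (split j) => k /=.
    by rewrite lE row_mxEl mxE.
  by rewrite row_mxEr ord1 !mxE eqxx.
rewrite rE mul_row_block !mulmx0 addr0 add0r -scalar_mxM.
apply/rowP=> j; rewrite -[j]splitK; case: (split j) => k /=.
  rewrite row_mxEl !mxE sum_ord3 !mxE /=.
  by elim/ord3P: k => /=; ring.
by rewrite row_mxEr ord1 !mxE eqxx.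
Qed.

Lemma orbitP E c : alg_orbit (ofalg E) c <-> exists2 D, c = ofalg D & iso D E.
Proof.
split=> [[g0 [g1 [u0 u1 h]]]|[D -> [B dB [hm hl]]]]; last first.
  exists (mx_of B), 1%:M; split; first exact: unit_mx_of; first exact: unitmx1.
  set g := block_mx _ _ _ _.
  have ug : g \in unitmx by rewrite block_diag_mx_unit unit_mx_of ?unitmx1.
  move=> /= x y; rewrite -{1}(mulmxKV ug x) -{1}(mulmxKV ug y).
  rewrite [x *m _]row4E [y *m _]row4E.
  by rewrite !row4_mul !smul_row4 row4_mul hm !hl !mulr1.
pose g := block_mx g0 0 0 g1.
have ug : g \in unitmx by rewrite block_diag_mx_unit u0.
have {}h (x y : 'rV[K]_(3 + 1)) : smul c (x *m g) (y *m g) = smul (ofalg E) x y *m g.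
  by rewrite h !mulmxK.
pose B := of_mx g0; pose a := g1 0 0.
have gE : g = block_mx (mx_of B) 0 0 a%:M.
  by rewrite of_mxK; congr block_mx; apply/matrixP => i j; rewrite !ord1 mxE.
have a0 : a != 0.
  by move: u1; rewrite unitmxE unitfE det_mx11.
have dB : detm B != 0 by exact: detm_of_mx.
(* This is what allows [c] to be written as [ofalg (toalg c)]; it holds because the inverse of the
   block diagonal [g] preserves parity. *)
have sc : supercommutative c.
  have pg (d : bool) (x : 'rV[K]_(3 + 1)) : has_parity d x -> has_parity d (x *m invmx g).
    rewrite -{1}(mulmxKV ug x) [x *m _]row4E gE row4_mul.
    move: (vec_of _) (_ 0 o3) => y b /has_parityP; case: d => -[z] /row4_inj [E1 E2].
      suff -> : y = vzero by exact: has_parity_odd.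
      by rewrite -(invmKV y dB) E1; apply: vecP => /=; ring.
    move/eqP: E2; rewrite mulf_eq0 (negPf a0) orbF => /eqP ->.
    exact: has_parity_even.
  move=> dx dy x y hx hy; rewrite -(mulmxKV ug x) -(mulmxKV ug y) !h.
  by rewrite (supercomm_ofalg E (pg _ _ hx) (pg _ _ hy)) scalemxAl.
exists (toalg c); first exact: supercomm_alg.
exists B => //.
move: h; rewrite (supercomm_alg sc) ofalgK => h.
split=> [x y|x].
  have := h (row4 x 0) (row4 y 0).
  by rewrite gE !(row4_mul, smul_row4) => /row4_inj [].
have := h (row4 x 0) (row4 vzero 1).
rewrite gE !(row4_mul, smul_row4) => /row4_inj [_].
rewrite !(mul0r, mulr1, addr0, mul1r) => h1.
exact: (mulIf a0).
Qed.

End Bridge.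

(** * Closedness, degenerations and components *)

Section FunctionRings.
Variables (K : numClosedFieldType) (X : Type) (P : (X -> K) -> Prop).

(** Used for three classes of functions: polynomials in the structure constants (closed sets),
    polynomials in one parameter (limits), and regular functions on a punctured line (irreducibility
    of orbits). *)
Record funring : Prop := FunRing {
  fr_ext : forall f g, (forall x, f x = g x) -> P f -> P g;
  fr_const : forall a, P (fun=> a);
  fr_add : forall f g, P f -> P g -> P (fun x => f x + g x);
  fr_mul : forall f g, P f -> P g -> P (fun x => f x * g x) }.
Hypothesis hP : funring.

Lemma fr_opp f : P f -> P (fun x => - f x).
Proof.
move=> h; apply: (fr_ext hP _ (fr_mul hP (fr_const hP (-1)) h)) => x.
by rewrite mulN1r.
Qed.
Lemma fr_sub f g : P f -> P g -> P (fun x => f x - g x).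
Proof. by move=> hf hg; apply: (fr_add hP hf (fr_opp hg)). Qed.

Definition frv (F : X -> vec K) :=
  [/\ P (fun x => v1 (F x)), P (fun x => v2 (F x)) & P (fun x => v3 (F x))].
Definition frm (F : X -> mat K) :=
  [/\ frv (fun x => r1 (F x)), frv (fun x => r2 (F x)) & frv (fun x => r3 (F x))].
Definition fra (F : X -> alg K) :=
  [/\ frv (fun x => p11 (F x)), frv (fun x => p12 (F x)) & frv (fun x => p13 (F x))] /\
  [/\ frv (fun x => p22 (F x)), frv (fun x => p23 (F x)), frv (fun x => p33 (F x))
    & frv (fun x => wt (F x))].

Lemma frv_const v : frv (fun=> v).
Proof. by split; apply: fr_const. Qed.
Lemma frm_const B : frm (fun=> B).
Proof. by split; apply: frv_const. Qed.
Lemma frv_add F G : frv F -> frv G -> frv (fun x => vadd (F x) (G x)).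
Proof. by case=> ? ? ? [? ? ?]; split; apply: fr_add. Qed.
Lemma frv_scale f F : P f -> frv F -> frv (fun x => vscale (f x) (F x)).
Proof. by move=> ? [? ? ?]; split; apply: fr_mul. Qed.
Lemma frv_sub F G : frv F -> frv G -> frv (fun x => vsub (F x) (G x)).
Proof. by move=> hF hG; apply: frv_add hF (frv_scale (fr_const hP _) hG). Qed.
Lemma frv_app B F : frm B -> frv F -> frv (fun x => app (B x) (F x)).
Proof. by case=> ? ? ? [? ? ?]; do 2?apply: frv_add; apply: frv_scale. Qed.
Lemma frm_comp A B : frm A -> frm B -> frm (fun x => compm (A x) (B x)).
Proof. by move=> hA [? ? ?]; split; apply: frv_app. Qed.
Lemma fr_det3 F G H : frv F -> frv G -> frv H -> P (fun x => det3 (F x) (G x) (H x)).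
Proof.
case=> ? ? ? [? ? ?] [? ? ?]; apply: fr_add => //; first apply: fr_sub;
  by apply: fr_mul => //; apply: fr_sub; apply: fr_mul.
Qed.
Lemma fr_detm B : frm B -> P (fun x => detm (B x)).
Proof. by case=> ? ? ?; apply: fr_det3. Qed.
Lemma fr_trm B : frm B -> P (fun x => trm (B x)).
Proof. by case=> [[? ? ?] [? ? ?] [? ? ?]]; do 2?apply: fr_add. Qed.
Lemma frm_scale f B : P f -> frm B -> frm (fun x => scalem (f x) (B x)).
Proof. by move=> ? [? ? ?]; split; apply: frv_scale. Qed.

Lemma frv_mul D F G : fra D -> frv F -> frv G -> frv (fun x => amul (D x) (F x) (G x)).
Proof.
case=> [[? ? ?] [? ? ? ?]] [? ? ?] [? ? ?].
by do 5?apply: frv_add; apply: frv_scale => //; do ?apply: fr_add => //; apply: fr_mul.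
Qed.
Lemma fr_lam D F : fra D -> frv F -> P (fun x => lam (D x) (F x)).
Proof.
by case=> [_ [_ _ _ [? ? ?]]] [? ? ?]; do 2?apply: fr_add => //; apply: fr_mul.
Qed.
Lemma frm_Lm D F : fra D -> frv F -> frm (fun x => Lm (D x) (F x)).
Proof. by move=> ? ?; split; apply: frv_mul => //; apply: frv_const. Qed.
Lemma fr_tr D F : fra D -> frv F -> P (fun x => tr (D x) (F x)).
Proof. by move=> ? ?; apply: fr_trm; apply: frm_Lm. Qed.
Lemma frm_shiftm n f B : P f -> frm B -> frm (fun x => shiftm n (f x) (B x)).
Proof.
move=> hf [? ? ?]; split; apply: frv_sub;
  apply: frv_scale => //; by [exact: fr_const|exact: frv_const].
Qed.
Lemma fra_trans B B' D : frm B -> frm B' -> fra D ->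
  fra (fun x => trans (B x) (B' x) (D x)).
Proof.
move=> hB [? ? ?] hD; split; split; try by apply: frv_app => //; apply: frv_mul.
by split; apply: fr_lam.
Qed.
Lemma fra_const D : fra (fun=> D).
Proof. by split; split; apply: frv_const. Qed.

Lemma fr_ofalg D : fra D -> forall s, P (fun x => ofalg (D x) s).
Proof.
case=> [[[? ? ?] [? ? ?] [? ? ?]] [[? ? ?] [? ? ?] [? ? ?] [? ? ?]]] s.
apply: (@fr_ext hP (fun x => tab (D x) (val s).1.1 (val s).1.2 (val s).2)) => [x|].
  by rewrite ffunE.
case: (val s) => [[i j] k] /=; have h0 : P (fun=> 0) by exact: fr_const.
by elim/ord4P: i; elim/ord4P: j; elim/ord4P: k.
Qed.
End FunctionRings.

Section ClosedConditions.
Variable K : numClosedFieldType.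
Notation sc := {ffun sc_index 3 1 -> K}.
Implicit Types (D E : alg K) (c : sc).

Lemma pfun_funring (I : finType) : funring (@pfun K I).
Proof. by split; [exact: pfun_ext|exact: pfunC|exact: pfunD|exact: pfunM]. Qed.
Notation pfr := (pfun_funring (sc_index 3 1)).
Notation pfv := (frv (@pfun K (sc_index 3 1))).

Lemma pfun_coef i j k : pfun (fun c : sc => coef c i j k).
Proof.
rewrite /coef; case: insubP => [s _ _|_]; [exact: pfun_coord|exact: pfunC].
Qed.
Lemma pfa_toalg : fra (@pfun K (sc_index 3 1)) (@toalg K).
Proof. by split; split; split; apply: pfun_coef. Qed.
Let ht := pfa_toalg.

Lemma zclosed_veq (T : Type) (F G : T -> sc -> vec K) :
  (forall t, pfv (F t)) -> (forall t, pfv (G t)) ->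
  zclosed [set c | forall t, F t c = G t c].
Proof.
move=> hF hG.
have hd t : pfv (fun c => vsub (F t c) (G t c)) by apply: frv_sub => //; exact: pfr.
pose H (p : T * 'I_3) c := ventry (vsub (F p.1 c) (G p.1 c)) p.2.
have : zclosed [set c | forall p, H p c = 0].
  apply: zclosed_zeros => -[t i]; have [h1 h2 h3] := hd t.
  by elim/ord3P: i.
congr zclosed; apply/seteqP; split=> c /= h => [t|[t i]]; last first.
  by rewrite /H /= h; elim/ord3P: i => /=; ring.
have := (h (t, @Ordinal 3 0 isT), h (t, @Ordinal 3 1 isT), h (t, @Ordinal 3 2 isT)).
rewrite /H /= !mulN1r => -[[/eqP + /eqP] + /eqP]; rewrite !subr_eq0.
by move=> /eqP ? /eqP ? /eqP ?; apply: vecP.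
Qed.

(** In the first two patterns [?v] cannot depend on [x], so they match constant functions only. *)
Ltac pf := cbv beta; repeat match goal with
 | |- frv _ (fun x => ?v) => exact: (frv_const pfr)
 | |- frm _ (fun x => ?v) => exact: (frm_const pfr)
 | |- frv _ (fun x => amul _ _ _) => apply: (frv_mul pfr)
 | |- frv _ (fun x => vadd _ _) => apply: (frv_add pfr)
 | |- frv _ (fun x => vsub _ _) => apply: (frv_sub pfr)
 | |- frv _ (fun x => vscale _ _) => apply: (frv_scale pfr)
 | |- frm _ (fun x => Lm _ _) => apply: (frm_Lm pfr)
 | |- frm _ (fun x => compm _ _) => apply: (frm_comp pfr)
 | |- fra _ _ => exact: ht
 | |- pfun (fun x => tr _ _) => apply: (fr_tr pfr)
 | |- pfun (fun x => trm _) => apply: (fr_trm pfr)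
 | |- pfun (fun x => detm _) => apply: (fr_detm pfr)
 | |- pfun (fun x => det3 _ _ _) => apply: (fr_det3 pfr)
 | |- pfun (fun x => lam _ _) => apply: (fr_lam pfr)
 | |- pfun (fun x => _ ^+ _) => apply: pfunX
 | |- pfun (fun x => _ * _) => apply: pfunM
 | |- pfun (fun x => _ + _) => apply: pfunD
 | |- pfun (fun x => - _) => apply: pfunN
 | |- pfun (fun x => _) => exact: pfunC
 end.

Lemma zclosed_eqset (A B : set sc) : zclosed A -> (forall c, A c <-> B c) -> zclosed B.
Proof. by move=> hA AB; rewrite (_ : B = A) //; apply/seteqP; split=> c /AB. Qed.

Lemma zclosed_assoc : zclosed [set c : sc | assoc (toalg c)].
Proof.
refine (zclosed_eqset (@zclosed_veq (vec K * vec K * vec K)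
  (fun p c => amul (toalg c) (amul (toalg c) p.1.1 p.1.2) p.2)
  (fun p c => amul (toalg c) p.1.1 (amul (toalg c) p.1.2 p.2)) _ _) _); try by move=> p; pf.
by move=> c; split=> [h x y z|h [[x y] z]]; [exact: (h (x, y, z))|exact: h].
Qed.
Lemma zclosed_assoc2 : zclosed [set c : sc | assoc2 (toalg c)].
Proof.
pose a (p : vec K * vec K * vec K) (c : sc) :=
  vsub (amul (toalg c) (amul (toalg c) p.1.1 p.1.2) p.2)
       (amul (toalg c) p.1.1 (amul (toalg c) p.1.2 p.2)).
refine (zclosed_eqset (@zclosed_veq _ (fun p c => amul (toalg c) (a p c) (a p c))
  (fun p c => vzero) _ _) _); try by move=> p; rewrite /a; pf.
by move=> c; split=> [h x y z|h [[x y] z]]; [exact: (h (x, y, z))|exact: h].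
Qed.
Lemma zclosed_gram : zclosed [set c : sc | gram (toalg c)].
Proof.
refine (zclosed_eqset (@zclosed_zeros _ _ (vec K * vec K * vec K)
  (fun p c => gramdet (toalg c) p.1.1 p.1.2 p.2) _) _).
  by move=> p; apply: (fr_det3 pfr); split; cbn [v1 v2 v3]; pf.
by move=> c; split=> [h x y z|h [[x y] z]]; [exact: (h (x, y, z))|exact: h].
Qed.
Lemma zclosed_wdet n a b : zclosed [set c : sc | wdet n a b (toalg c)].
Proof.
refine (zclosed_eqset (@zclosed_zeros _ _ (vec K) (fun x c =>
  detm (shiftm n (a * tr (toalg c) x + b * lam (toalg c) x) (Lm (toalg c) x))) _) _).
  by move=> x; apply: (fr_detm pfr); apply: (frm_shiftm pfr); pf.
by move=> c; split.
Qed.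
Lemma zclosed_wlin a b : zclosed [set c : sc | wlin a b (toalg c)].
Proof.
refine (zclosed_eqset (@zclosed_zeros _ _ (vec K) (fun x c =>
  a * tr (toalg c) x + b * lam (toalg c) x) _) _).
  by move=> x; pf.
by move=> c; split.
Qed.
Lemma zclosed_quart : zclosed [set c : sc | quart (toalg c)].
Proof.
pose t2 x (c : sc) := tr (toalg c) (amul (toalg c) x x).
pose d x (c : sc) := t2 x c - trm (compm (Lm (toalg c) x) (Lm (toalg c) x)).
refine (zclosed_eqset (@zclosed_zeros _ _ (vec K) (fun x c =>
  (t2 x c - tr (toalg c) x ^+ 2 + 3 * d x c) ^+ 2 - 36 * d x c * (t2 x c - 6 * d x c)) _) _).
  by move=> x; rewrite /d /t2; pf.
move=> c; split=> h x; last by apply/eqP; rewrite subr_eq0; apply/eqP; exact: (h x).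
by move/eqP: (h x); rewrite subr_eq0 => /eqP.
Qed.

Inductive cond := Assoc | Assoc2 | Gram | Wdet (n a b : K) | Wlin (a b : K) | Quart.
Definition holds q D := match q with
  | Assoc => assoc D | Assoc2 => assoc2 D | Gram => gram D
  | Wdet n a b => wdet n a b D | Wlin a b => wlin a b D | Quart => quart D end.
Definition barred s D := exists2 q, List.In q s & holds q D.

Lemma holds_iso q D E : iso D E -> holds q D -> holds q E.
Proof.
move=> h; case: q => [|||n a b|a b|] /=; [exact: assoc_iso|exact: assoc2_iso
  |exact: gram_iso|exact: wdet_iso|exact: wlin_iso|exact: quart_iso].
Qed.
Lemma barred_iso s D E : iso D E -> barred s D -> barred s E.
Proof. by move=> h [q qs hq]; exists q => //; apply: holds_iso hq. Qed.

Lemma zclosed_barred s : zclosed [set c : sc | barred s (toalg c)].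
Proof.
elim: s => [|q s IH].
  by apply: zclosed_eqset (@zclosed_false _ _) _ => c; split=> // -[].
have hq : zclosed [set c : sc | holds q (toalg c)].
  case: q => [|||n a b|a b|] /=; [exact: zclosed_assoc|exact: zclosed_assoc2
    |exact: zclosed_gram|exact: zclosed_wdet|exact: zclosed_wlin|exact: zclosed_quart].
apply: zclosed_eqset (zclosedU hq IH) _ => c; split=> /=.
  by case=> [h|[r rs h]]; [exists q => //; left|exists r => //; right].
by case=> r [<-|rs] h; [left|right; exists r].
Qed.

Lemma zclosed_JS : zclosed (JS K 3 1).
Proof.
have hfix : zclosed [set c : sc | c = ofalg (toalg c)].
  refine (zclosed_eqset (@zclosed_zeros _ _ (sc_index 3 1)
    (fun s c => c s - ofalg (toalg c) s) _) _).
    move=> s; apply: (fr_sub pfr); first exact: pfun_coord.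
    exact: (fr_ofalg pfr).
  move=> c; split=> [h|h s]; last by rewrite -h subrr.
  by apply/ffunP => s; apply/eqP; rewrite -subr_eq0 h.
pose m (c : sc) := amul (toalg c); pose l (c : sc) := lam (toalg c).
have hj1 : zclosed [set c : sc | forall x y z t,
   vadd (m c (m c (m c x y) z) t)
     (vadd (m c (m c (m c x t) z) y) (m c (m c (m c y t) z) x))
   = vadd (m c (m c x y) (m c z t))
     (vadd (m c (m c x t) (m c y z)) (m c (m c x z) (m c y t)))].
  refine (zclosed_eqset (@zclosed_veq (vec K * vec K * vec K * vec K)
   (fun p c => let: (x, y, z, t) := p in vadd (m c (m c (m c x y) z) t)
     (vadd (m c (m c (m c x t) z) y) (m c (m c (m c y t) z) x)))
   (fun p c => let: (x, y, z, t) := p in vadd (m c (m c x y) (m c z t))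
     (vadd (m c (m c x t) (m c y z)) (m c (m c x z) (m c y t)))) _ _) _);
    try by move=> [[[x y] z] t]; rewrite /m; pf.
  by move=> c; split=> [h x y z t|h [[[x y] z] t]]; [exact: (h (x, y, z, t))|exact: h].
have hj2 : zclosed [set c : sc | forall x y z,
  l c (m c (m c x y) z) = l c (m c x y) * l c z + l c (m c y z) * l c x
    + l c (m c x z) * l c y - 2 * (l c x * l c y * l c z)].
  refine (zclosed_eqset (@zclosed_zeros _ _ (vec K * vec K * vec K)
   (fun p c => let: (x, y, z) := p in l c (m c (m c x y) z) -
    (l c (m c x y) * l c z + l c (m c y z) * l c x
    + l c (m c x z) * l c y - 2 * (l c x * l c y * l c z))) _) _).
   by move=> [[x y] z]; rewrite /m /l; pf.
  move=> c; split=> [h x y z|h [[x y] z]]; last by rewrite h subrr.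
  by apply/eqP; rewrite -subr_eq0 (h (x, y, z)).
(* Binary intersections are taken as families indexed by [bool]. *)
have h3 := @zclosedI _ _ bool (fun b => if b then _ else _)
  (fun b => if b as b return zclosed (if b then _ else _) then hj1 else hj2).
have h4 := @zclosedI _ _ bool (fun b => if b then _ else _)
  (fun b => if b as b return zclosed (if b then _ else _) then hfix else h3).
apply: zclosed_eqset h4 _ => c; split.
  move=> h; apply/JSP; split; first exact: (h true).
  by have h' := h false; split; [exact: (h' true)|exact: (h' false)].
by move=> /JSP [h [h1 h2]] []; [exact: h|case; [exact: h1|exact: h2]].
Qed.
End ClosedConditions.

(** * Degenerations along curves and irreducibility of orbits *)

Section Orbits.
Variable K : numClosedFieldType.
Notation sc := {ffun sc_index 3 1 -> K}.
Implicit Types (D E F : alg K) (c : sc).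
Notation orb E := (alg_orbit (ofalg E)).

(** A base change is a polynomial map of the structure constants that preserves the orbit, so the
    preimage of a closed set containing the orbit is again such a set. *)
Lemma zclosure_iso D D' E : iso D D' ->
  zclosure (orb E) (ofalg D') -> zclosure (orb E) (ofalg D).
Proof.
move=> /iso_transP [B dB ->] h Z [hZ hE].
have := @zclosed_preim _ _ Z (fun c => ofalg (trans B (invm B) (toalg c))) _ hZ.
have hf : forall i, pfun (fun c => ofalg (trans B (invm B) (toalg c)) i).
  apply: (fr_ofalg (pfun_funring K _)); apply: (fra_trans (pfun_funring K _)).
  - exact: (frm_const (pfun_funring K _)).
  - exact: (frm_const (pfun_funring K _)).
  - exact: pfa_toalg.
move=> /(_ hf) hZ'; have := h _ (conj hZ' _); rewrite /= ofalgK; apply.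
move=> _ /orbitP [F -> hF] /=; rewrite ofalgK; apply: hE; apply/orbitP.
exists (trans B (invm B) F) => //.
by apply: iso_trans hF; apply/iso_transP; exists B.
Qed.

Lemma rfun_funring d : funring (@rfun K d).
Proof.
split; [|exact: rfunC|exact: rfunD|exact: rfunM].
by move=> f g fg; apply: rfun_ext => s _.
Qed.

Definition ppoly (f : K -> K) := exists P : {poly K}, forall s, f s = P.[s].
Lemma ppoly_funring : funring ppoly.
Proof.
split=> [f g fg [P hP]|a|f g [P hP] [Q hQ]|f g [P hP] [Q hQ]].
- by exists P => s; rewrite -fg.
- by exists a%:P => s; rewrite hornerC.
- by exists (P + Q) => s; rewrite hornerD hP hQ.
- by exists (P * Q) => s; rewrite hornerM hP hQ.
Qed.
Lemma ppoly_id : ppoly id.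
Proof. by exists 'X => s; rewrite hornerX. Qed.
Lemma rfun_ppoly d f : ppoly f -> rfun d f.
Proof. by move=> [P hP]; apply: (rfun_ext _ (rfunP d P)) => s _; rewrite hP. Qed.

(** The form in which every degeneration is proved: the limit point [s0] may be a zero of [w], and
    [s1] witnesses that [w] is not the zero polynomial. *)
Lemma zclosure_curve (Gam : K -> alg K) (w : K -> K) D E s0 s1 :
  fra ppoly Gam -> ppoly w -> w s1 != 0 ->
  (forall s, w s != 0 -> iso (Gam s) E) -> iso D (Gam s0) ->
  zclosure (orb E) (ofalg D).
Proof.
move=> hG [W hW] w0 hE hD; apply: zclosure_iso hD _.
apply: (@zclosed_curve _ _ 1 W (fun s => ofalg (Gam s))).
- by move=> i; apply: rfun_ppoly; apply: (fr_ofalg ppoly_funring).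
- exact: zclosed_zclosure.
- by apply: contraNneq w0 => W0; rewrite hW W0 horner0.
- move=> s _ ws; apply: sub_zclosure; apply/orbitP; exists (Gam s) => //.
  by apply: hE; rewrite hW.
- by rewrite hornerC oner_neq0.
Qed.

(** Two points of the orbit come from invertible [B1] and [B2]. Transport along the segment from
    [B1] to [B2] is a rational curve, whose denominators are powers of a determinant that is nonzero
    at both ends. *)
Lemma zirreducible_orbit E : zirreducible (orb E).
Proof.
apply: zirreducible_curves.
  by exists (ofalg E); apply/orbitP; exists E => //; exact: iso_refl.
move=> a b /orbitP [D1 -> /iso_transP [B1 dB1 ->]] /orbitP [D2 -> /iso_transP [B2 dB2 ->]].
pose f (x y : vec K) s := vadd (vscale (1 - s) x) (vscale s y).
pose B s := Mat (f (r1 B1) (r1 B2) s) (f (r2 B1) (r2 B2) s) (f (r3 B1) (r3 B2) s).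
have p1 : ppoly (fun s => 1 - s).
  apply: (fr_sub ppoly_funring); [exact: (fr_const ppoly_funring)|exact: ppoly_id].
have hf x y : frv ppoly (f x y).
  apply: (frv_add ppoly_funring); apply: (frv_scale ppoly_funring) => //;
    try exact: (frv_const ppoly_funring); exact: ppoly_id.
have hB : frm ppoly B by split; apply: hf.
have [d hd] := fr_detm ppoly_funring hB.
have f0 x y : f x y 0 = x by apply: vecP; rewrite /=; ring.
have f1 x y : f x y 1 = y by apply: vecP; rewrite /=; ring.
have B0 : B 0 = B1 by rewrite /B !f0; case: (B1).
have B1E : B 1 = B2 by rewrite /B !f1; case: (B2).
exists d, (fun s => ofalg (trans (B s) (invm (B s)) E)), 0, 1; split.
- have hr : frm (rfun d) B.
    by case: hB => [[? ? ?] [? ? ?] [? ? ?]]; split; split; apply: rfun_ppoly.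
  apply: (fr_ofalg (rfun_funring d)); apply: (fra_trans (rfun_funring d)) => //.
    apply: (frm_scale (rfun_funring d)).
      by apply: (rfun_ext _ (rfunV d)) => s _; rewrite hd.
    case: hr => [[? ? ?] [? ? ?] [? ? ?]].
    by split; split; apply: (fr_sub (rfun_funring d)); apply: rfunM.
  exact: (fra_const (rfun_funring d)).
- by rewrite -!hd B0 B1E.
- by rewrite B0 B1E.
- move=> s; rewrite -hd => ds; apply/orbitP; exists (trans (B s) (invm (B s)) E) => //.
  by apply/iso_transP; exists (B s).
Qed.

(** * From the classification to the components *)

Section Components.
Variables (Ds : 'I_21 -> alg K) (bar : 'I_21 -> seq (cond K)).
(** [D] lies in the closure of an orbit, and satisfies a condition of [bar k] for
    every [k], except for at most one [k], for which it is isomorphic to [Ds k]. *)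
Definition classified D :=
  (exists k, zclosure (orb (Ds k)) (ofalg D)) /\
  (exists o : option 'I_21, (forall k, o != Some k -> barred (bar k) D) /\
     (forall k, o = Some k -> iso D (Ds k))).
Hypothesis Ds_jordan : forall k, jordan (Ds k).
Hypothesis Ds_free : forall k, ~ barred (bar k) (Ds k).
Hypothesis all_classified : forall D, jordan D -> classified D.

Lemma classified_iso D E : iso D E -> classified E -> classified D.
Proof.
move=> h [[k hk] [o [h1 h2]]]; split; first by exists k; apply: zclosure_iso hk.
exists o; split=> j hj; last by apply: iso_trans (h2 _ hj).
by apply: barred_iso (h1 _ hj); apply: iso_sym.
Qed.

Lemma iso_barred D k : iso D (Ds k) -> ~ barred (bar k) D.
Proof. by move=> h hb; apply: (@Ds_free k); apply: barred_iso hb. Qed.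

(** The exempt index of [Ds j] can only be [j]: any other choice would bar [Ds j] by its own
    list. *)
Lemma Ds_barred j k : j != k -> barred (bar k) (Ds j).
Proof.
move=> jk; have [_ [o [h1 h2]]] := all_classified (Ds_jordan j).
apply: (h1); apply/eqP => E; have oj : o != Some j.
  by rewrite E; apply/eqP => -[/esym/eqP]; apply/negP.
by have := h1 _ oj; exact: Ds_free.
Qed.

Lemma orbit_JS k : orb (Ds k) `<=` JS K 3 1.
Proof.
move=> _ /orbitP [D -> hD]; apply/JS_ofalg; apply: jordan_iso (Ds_jordan k).
exact: iso_sym.
Qed.
(** A point not barred by [bar k] has [k] as its exempt index, hence is isomorphic to [Ds k]. The
    set removed is closed, so this is the openness of the orbit. *)
Lemma orbitE k : orb (Ds k) = JS K 3 1 `\` [set c | barred (bar k) (toalg c)].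
Proof.
apply/seteqP; split=> c.
  move=> hc; split; first exact: orbit_JS hc.
  by move: hc => /orbitP [D -> hD] /=; rewrite ofalgK; exact: iso_barred.
move=> [/JSP [cE hj] /= hb]; rewrite cE; apply/orbitP; exists (toalg c) => //.
have [_ [o [h1 h2]]] := all_classified hj.
by apply: h2; apply/eqP; apply: contraT => /h1.
Qed.
Lemma rigid_Ds k : rigid (ofalg (Ds k)).
Proof.
exists [set c | barred (bar k) (toalg c)]; first exact: zclosed_barred.
exact: orbitE.
Qed.

Lemma zclosure_JS k : zclosure (orb (Ds k)) `<=` JS K 3 1.
Proof. by apply: zclosure_sub; [exact: zclosed_JS|exact: orbit_JS]. Qed.

Lemma self_orbit k : orb (Ds k) (ofalg (Ds k)).
Proof. by apply/orbitP; exists (Ds k) => //; exact: iso_refl. Qed.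

(** For [j != k] the closed condition [bar k] holds on the orbit of [Ds j], hence on its closure,
    but it fails at [Ds k]. *)
Lemma orbit_sub_zclosure j k : orb (Ds k) `<=` zclosure (orb (Ds j)) -> j = k.
Proof.
move=> h; apply/eqP; apply: contraT => jk.
have hb : zclosure (orb (Ds j)) `<=` [set c | barred (bar k) (toalg c)].
  apply: zclosure_sub; first exact: zclosed_barred.
  move=> _ /orbitP [D -> hD] /=; rewrite ofalgK.
  by apply: barred_iso (Ds_barred jk); exact: iso_sym.
have /= := hb _ (h _ (self_orbit k)); rewrite ofalgK => hk.
by case: (@Ds_free k).
Qed.

Lemma zclosure_inj : injective (fun k => zclosure (orb (Ds k))).
Proof. by move=> j k /= E; apply: orbit_sub_zclosure; rewrite E; exact: sub_zclosure. Qed.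

Lemma JS_covered c : JS K 3 1 c -> exists k, zclosure (orb (Ds k)) c.
Proof.
move=> /JSP [cE hj]; have [[k hk] _] := all_classified hj.
by exists k; rewrite cE.
Qed.

Lemma JS_zclosure : JS K 3 1 = zclosure (\bigcup_k orb (Ds k)).
Proof.
apply/seteqP; split=> [c /JS_covered [k]|].
  apply: zclosure_sub; first exact: zclosed_zclosure.
  by move=> d hd; apply: sub_zclosure; exists k.
apply: zclosure_sub; first exact: zclosed_JS.
by move=> c [k _]; exact: orbit_JS.
Qed.

Lemma irreducible_in_zclosure X : zirreducible X -> X `<=` JS K 3 1 ->
  exists k, X `<=` zclosure (orb (Ds k)).
Proof.
move=> irr XJ; pose s := [seq zclosure (orb (Ds k)) | k <- enum 'I_21].
have sP Z : List.In Z s -> exists k, Z = zclosure (orb (Ds k)).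
  rewrite /s; elim: (enum _) => [[]|k r IH] /= [<-|/IH //]; by exists k.
have [||Z /sP [k ->] XZ] := @zirreducible_bigU _ _ s X _ irr.
- by move=> Z /sP [k ->]; exact: zclosed_zclosure.
- move=> c /XJ /JS_covered [k hk]; exists (zclosure (orb (Ds k))) => //.
  rewrite /s; have : k \in enum 'I_21 by rewrite mem_enum.
  elim: (enum _) => //= j r IH; rewrite inE => /orP[/eqP ->|/IH]; by [left|right].
- by exists k.
Qed.

Lemma irreducible_componentE X :
  irreducible_component (JS K 3 1) X <-> exists k, X = zclosure (orb (Ds k)).
Proof.
have comp k := zirreducible_closure (zirreducible_orbit (Ds k)).
split=> [[hX irr XJ hmax]|[k ->]].
  have [k hk] := irreducible_in_zclosure irr XJ; exists k.
  by rewrite -(hmax _ (@zclosed_zclosure _ _ _) (comp k) (@zclosure_JS k) hk).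
split; [exact: zclosed_zclosure|exact: comp|exact: zclosure_JS|].
move=> Y hY irr YJ sub; have [j hj] := irreducible_in_zclosure irr YJ.
have E : j = k.
  by apply: orbit_sub_zclosure => c hc; apply: hj; apply: sub; exact: sub_zclosure.
by apply/seteqP; split=> //; rewrite -E.
Qed.
End Components.
End Orbits.

Arguments Assoc {K}.
Arguments Assoc2 {K}.
Arguments Gram {K}.
Arguments Quart {K}.

(** * Normal forms *)

Ltac unf := rewrite /assoc /assoc2 /gramdet /wdet /wlin /quart /detm /det3 /tr /trm
  /amul /lam /shiftm /Lm /compm /vsub /app /=.
Ltac fld := by field; rewrite ?pnatr_eq0.
Ltac nat_cases :=
  first [by move=> ?; rewrite !ltnS ltn0|case; [move=> _ /=|nat_cases]].

Tactic Notation "coordwise" hyp(e) := apply: vecP;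
  [have := congr1 v1 e|have := congr1 v2 e|have := congr1 v3 e];
  clear e; intro e; simpl in e.

Section Classification.
Variable K : numClosedFieldType.
Implicit Types (D E : alg K) (x y z t : vec K) (q : cond K).
Notation h := (2^-1 : K).
Notation o := (@vzero K).
(** With the values of [l] occurring in [Dlist] below these are J_1 - J_4 ([C3]),
    J_21 - J_26 ([E4]), J_42, J_43 ([E5 1]), J_57, J_58 ([E5 0]), J_53 - J_55 ([E8 1]),
    J_47 - J_49 ([E10]) and J_51 ([E11 1]). *)
Definition C3 l1 l2 := Alg b1 o o b2 o b3 (Vec l1 l2 0).
Definition E4 l1 l3 := Alg b1 (vscale h b2) o o o b3 (Vec l1 0 l3).
Definition E5 g l1 l2 :=
  Alg b1 o (vscale h b3) b2 (vscale h b3) (Vec g g 0) (Vec l1 l2 0).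
Definition E8 g l := Alg b1 (vscale h b2) b3 (vscale g b3) o o (Vec l 0 0).
Definition E10 l := Alg b1 (vscale h b2) (vscale h b3) o o o (Vec l 0 0).
Definition E11 g l := Alg b1 (vscale h b2) o (vscale g b3) o o (Vec l 0 0).

(** * Products and traces of the normal forms in coordinates *)

Definition mC3 x y := Vec (v1 x * v1 y) (v2 x * v2 y) (v3 x * v3 y).
Definition mE4 x y := Vec (v1 x * v1 y) (h * (v1 x * v2 y + v2 x * v1 y)) (v3 x * v3 y).
Definition mE5 (g : K) x y := Vec (v1 x * v1 y + g * (v3 x * v3 y))
  (v2 x * v2 y + g * (v3 x * v3 y))
  (h * ((v1 x + v2 x) * v3 y + v3 x * (v1 y + v2 y))).
Definition mE8 (g : K) x y := Vec (v1 x * v1 y) (h * (v1 x * v2 y + v2 x * v1 y))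
  (g * (v2 x * v2 y) + v1 x * v3 y + v3 x * v1 y).
Definition mE10 x y := Vec (v1 x * v1 y) (h * (v1 x * v2 y + v2 x * v1 y))
  (h * (v1 x * v3 y + v3 x * v1 y)).
Definition mE11 (g : K) x y :=
  Vec (v1 x * v1 y) (h * (v1 x * v2 y + v2 x * v1 y)) (g * (v2 x * v2 y)).

Lemma amul_C3 l1 l2 : amul (C3 l1 l2) =2 mC3.
Proof. by move=> [? ? ?] [? ? ?]; apply: vecP; unf; fld. Qed.
Lemma tr_C3 l1 l2 x : tr (C3 l1 l2) x = v1 x + v2 x + v3 x.
Proof. by case: x => ? ? ?; unf; fld. Qed.
Lemma amul_E4 l1 l3 : amul (E4 l1 l3) =2 mE4.
Proof. by move=> [? ? ?] [? ? ?]; apply: vecP; unf; fld. Qed.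
Lemma tr_E4 l1 l3 x : tr (E4 l1 l3) x = 3 / 2 * v1 x + v3 x.
Proof. by case: x => ? ? ?; unf; fld. Qed.
Lemma amul_E5 g l1 l2 : amul (E5 g l1 l2) =2 mE5 g.
Proof. by move=> [? ? ?] [? ? ?]; apply: vecP; unf; fld. Qed.
Lemma tr_E5 g l1 l2 x : tr (E5 g l1 l2) x = 3 / 2 * (v1 x + v2 x).
Proof. by case: x => ? ? ?; unf; fld. Qed.
Lemma amul_E8 g l : amul (E8 g l) =2 mE8 g.
Proof. by move=> [? ? ?] [? ? ?]; apply: vecP; unf; fld. Qed.
Lemma tr_E8 g l x : tr (E8 g l) x = 5 / 2 * v1 x.
Proof. by case: x => ? ? ?; unf; fld. Qed.
Lemma amul_E10 l : amul (E10 l) =2 mE10.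
Proof. by move=> [? ? ?] [? ? ?]; apply: vecP; unf; fld. Qed.
Lemma tr_E10 l x : tr (E10 l) x = 2 * v1 x.
Proof. by case: x => ? ? ?; unf; fld. Qed.
Lemma amul_E11 g l : amul (E11 g l) =2 mE11 g.
Proof. by move=> [? ? ?] [? ? ?]; apply: vecP; unf; fld. Qed.
Lemma tr_E11 g l x : tr (E11 g l) x = 3 / 2 * v1 x.
Proof. by case: x => ? ? ?; unf; fld. Qed.
Ltac amul_tac := lazymatch goal with
  | |- amul (C3 _ _) =2 _ => exact: amul_C3
  | |- amul (E4 _ _) =2 _ => exact: amul_E4
  | |- amul (E5 _ _ _) =2 _ => exact: amul_E5
  | |- amul (E8 _ _) =2 _ => exact: amul_E8
  | |- amul (E10 _) =2 _ => exact: amul_E10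
  | |- amul (E11 _ _) =2 _ => exact: amul_E11
  end.

Ltac jordan_mul_tac := by move=> [? ? ?] [? ? ?] [? ? ?] [? ? ?]; apply: vecP;
  rewrite /=; fld.

Definition jordan_mul (M : vec K -> vec K -> vec K) := forall x y z t,
  vadd (M (M (M x y) z) t) (vadd (M (M (M x t) z) y) (M (M (M y t) z) x))
  = vadd (M (M x y) (M z t)) (vadd (M (M x t) (M y z)) (M (M x z) (M y t))).

Lemma jordan_mC3 : jordan_mul mC3.
Proof. jordan_mul_tac. Qed.
Lemma jordan_mE4 : jordan_mul mE4.
Proof. jordan_mul_tac. Qed.
Lemma jordan_mE5 g : jordan_mul (mE5 g).
Proof. jordan_mul_tac. Qed.
Lemma jordan_mE8 g : jordan_mul (mE8 g).
Proof. jordan_mul_tac. Qed.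
Lemma jordan_mE10 : jordan_mul mE10.
Proof. jordan_mul_tac. Qed.
Lemma jordan_mE11 g : jordan_mul (mE11 g).
Proof. jordan_mul_tac. Qed.

Lemma jordanP D (M : vec K -> vec K -> vec K) : amul D =2 M -> jordan_mul M ->
  (forall x y z, let l := lam D in l (M (M x y) z) = l (M x y) * l z
     + l (M y z) * l x + l (M x z) * l y - 2 * (l x * l y * l z)) -> jordan D.
Proof. by move=> hM h1 h2; split=> [x y z t|x y z] /=; rewrite !hM; [exact: h1|exact: h2]. Qed.

Lemma assoc2P D (M : vec K -> vec K -> vec K) : amul D =2 M ->
  (forall x y z, let a := vsub (M (M x y) z) (M x (M y z)) in M a a = o) -> assoc2 D.
Proof. by move=> hM hA x y z /=; rewrite !hM; exact: hA. Qed.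

Lemma assoc2_nil D (M : vec K -> vec K -> vec K) : amul D =2 M ->
  (forall x y z, v1 (M (M x y) z) = v1 (M x (M y z))) ->
  (forall u, v1 u = 0 -> M u u = o) -> assoc2 D.
Proof.
move=> hM h1 h2; apply: (assoc2P hM) => x y z /=.
by apply: h2; rewrite /= h1; ring.
Qed.

Lemma gramP D (M : vec K -> vec K -> vec K) (T : vec K -> K) :
  amul D =2 M -> (forall x, tr D x = T x) -> forall x y z, gramdet D x y z =
  det3 (Vec (T (M x x)) (T (M x y)) (T (M x z))) (Vec (T (M x y)) (T (M y y)) (T (M y z)))
       (Vec (T (M x z)) (T (M y z)) (T (M z z))).
Proof. by move=> hM hT x y z; rewrite /gramdet !hM !hT. Qed.
Lemma gram_coord D (M : vec K -> vec K -> vec K) (T : vec K -> K) :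
  amul D =2 M -> (forall x, tr D x = T x) -> gram D -> forall x y z,
  det3 (Vec (T (M x x)) (T (M x y)) (T (M x z))) (Vec (T (M x y)) (T (M y y)) (T (M y z)))
       (Vec (T (M x z)) (T (M y z)) (T (M z z))) = 0.
Proof. by move=> hM hT hG x y z; rewrite -(gramP hM hT) hG. Qed.
Lemma assoc_coord (p : vec K -> K) D (M : vec K -> vec K -> vec K) : amul D =2 M ->
  assoc D -> forall x y z, p (M (M x y) z) - p (M x (M y z)) = 0.
Proof. by move=> hM hA x y z; rewrite -!hM hA subrr. Qed.
Lemma assoc2_coord (p : vec K -> K) D (M : vec K -> vec K -> vec K) : amul D =2 M ->
  assoc2 D -> forall x y z, let a := vsub (M (M x y) z) (M x (M y z)) in
  p (M a a) = p o.
Proof. by move=> hM hA x y z /=; rewrite -!hM hA. Qed.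

Definition Dlist : seq (alg K) := [:: C3 0 0; C3 1 0; C3 h 0; C3 h h; E4 0 0; E4 0 1;
  E4 0 h; E4 1 0; E4 h 0; E4 h h; E5 1 0 0; E5 1 h h; E10 0; E10 1; E10 h; E11 1 1;
  E8 1 0; E8 1 1; E8 1 h; E5 0 1 0; E5 0 h 0].
(** Each list contains a property of every normal form other than its own. Here [Gram] fails for
    [C3] and [E5 1] only. The eigenvalue [tr / 3] belongs to [E5], [2 tr / 5] to [E8], [tr / 2] to
    [E10], [2 tr / 3] to [E11], and [Quart] holds on [E4]. The conditions with [b != 0] tell the
    values of [lam] apart: [Wdet 1 0 1] and [Wdet 1 0 2] say that [lam] or [2 lam] is an eigenvalue,
    [Wlin] gives the ratio of [tr] to [lam], and the mixed ones isolate one eigenvalue, such as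
    [2 tr - 3 lam = 2 v3] on [E4 1 0]. *)
Definition bars : seq (seq (cond K)) := [::
  [:: Gram; Wdet 3 1 0; Wdet 1 0 1; Wdet 1 0 2; Wdet 1 1 (-2)];
  [:: Gram; Wdet 3 1 0; Wlin 0 1; Wdet 1 0 2; Wdet 1 1 (-2)];
  [:: Gram; Wdet 3 1 0; Wlin 0 1; Wdet 1 0 1; Wdet 1 1 (-2)];
  [:: Gram; Wdet 3 1 0; Wlin 0 1; Wdet 1 0 1; Wdet 1 0 2];
  [:: Assoc; Wdet 3 1 0; Wdet 5 2 0; Wdet 2 1 0; Wdet 3 2 0; Wdet 1 0 1; Wdet 1 0 2; Wdet 1 1 (-2)];
  [:: Assoc; Wdet 3 1 0; Wdet 5 2 0; Wdet 2 1 0; Wdet 3 2 0; Wlin 0 1; Wdet 2 2 (-3);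
      Wdet 1 1 (-3); Wdet 1 0 2; Wdet 1 1 (-2)];
  [:: Assoc; Wdet 3 1 0; Wdet 5 2 0; Wdet 2 1 0; Wdet 3 2 0; Wlin 0 1; Wdet 2 2 (-3);
      Wdet 1 1 (-3); Wdet 1 0 1; Wdet 1 1 (-2)];
  [:: Assoc; Wdet 3 1 0; Wdet 5 2 0; Wdet 2 1 0; Wdet 3 2 0; Wlin 0 1; Wdet 3 2 (-2);
      Wdet 3 2 (-4); Wdet 1 1 (-3); Wdet 1 1 (-2)];
  [:: Assoc; Wdet 3 1 0; Wdet 5 2 0; Wdet 2 1 0; Wdet 3 2 0; Wlin 0 1; Wdet 2 2 (-3);
      Wdet 3 2 (-2); Wdet 3 2 (-4); Wdet 1 1 (-2)];
  [:: Assoc; Wdet 3 1 0; Wdet 5 2 0; Wdet 2 1 0; Wdet 3 2 0; Wlin 0 1; Wdet 2 2 (-3);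
      Wdet 1 1 (-3); Wdet 3 2 (-2); Wdet 3 2 (-4)];
  [:: Gram; Assoc; Wlin 1 (-3)];
  [:: Gram; Assoc; Wlin 0 1];
  [:: Assoc; Wdet 3 1 0; Wdet 5 2 0; Wdet 3 2 0; Quart; Wlin 1 (-2); Wlin 1 (-4)];
  [:: Assoc; Wdet 3 1 0; Wdet 5 2 0; Wdet 3 2 0; Quart; Wlin 0 1; Wlin 1 (-4)];
  [:: Assoc; Wdet 3 1 0; Wdet 5 2 0; Wdet 3 2 0; Quart; Wlin 0 1; Wlin 1 (-2)];
  [:: Assoc2; Wdet 5 2 0; Wlin 0 1; Wlin 1 (-3)];
  [:: Assoc2; Wdet 3 1 0; Wdet 3 2 0; Wlin 2 (-5); Wlin 1 (-5)];
  [:: Assoc2; Wdet 3 1 0; Wdet 3 2 0; Wlin 0 1; Wlin 1 (-5)];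
  [:: Assoc2; Wdet 3 1 0; Wdet 3 2 0; Wlin 0 1; Wlin 2 (-5)];
  [:: Assoc; Wdet 5 2 0; Wdet 2 1 0; Wdet 3 2 0; Quart; Wlin 0 1; Wlin 1 (-3); Wdet 1 0 2];
  [:: Assoc; Wdet 5 2 0; Wdet 2 1 0; Wdet 3 2 0; Quart; Wlin 0 1; Wlin 1 (-3); Wdet 1 0 1]].
Definition Ds (k : 'I_21) := nth (C3 0 0) Dlist k.
Definition bar (k : 'I_21) := nth [::] bars k.

Lemma not_barred_nil D : ~ barred [::] D.
Proof. by case. Qed.
Lemma not_barred_cons q s D : ~ holds q D -> ~ barred s D -> ~ barred (q :: s) D.
Proof. by move=> hq hs [r [<-|rs] hr]; [exact: hq|apply: hs; exists r]. Qed.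
Lemma eq_sub0 (a b : K) : a = b -> a - b = 0.
Proof. by move=> ->; rewrite subrr. Qed.
Lemma refute_num (e c : K) : e = 0 -> c != 0 -> e = c -> False.
Proof. by move=> -> /eqP h e0; apply: h. Qed.
Tactic Notation "refute" uconstr(H) uconstr(c) := refine (@refute_num _ c H _ _);
  [by rewrite ?oppr_eq0 ?oner_neq0 ?pnatr_eq0|unf; fld].

(* The arguments are scaled by 2 to make the values of the conditions integral. *)
Lemma Ds_free k : ~ barred (bar k) (Ds k).
Proof.
case: k => k hk; rewrite /bar /Ds /=; move: k hk; nat_cases.
- apply: not_barred_cons => [H|]; first by
    refute (gram_coord (amul_C3 _ _) (tr_C3 _ _) H b1 b2 b3) 1.
  apply: not_barred_cons => [H|]; first by refute (H (Vec 0 0 2)) 16.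
  apply: not_barred_cons => [H|]; first by refute (H (Vec 2 2 2)) 8.
  apply: not_barred_cons => [H|]; first by refute (H (Vec 2 2 2)) 8.
  apply: not_barred_cons => [H|]; first by refute (H (Vec 0 2 2)) (-16).
  exact: not_barred_nil.
- apply: not_barred_cons => [H|]; first by
    refute (gram_coord (amul_C3 _ _) (tr_C3 _ _) H b1 b2 b3) 1.
  apply: not_barred_cons => [H|]; first by refute (H (Vec 0 0 2)) 16.
  apply: not_barred_cons => [H|]; first by refute (H (Vec 2 0 0)) 2.
  apply: not_barred_cons => [H|]; first by refute (H (Vec 2 0 0)) (-32).
  apply: not_barred_cons => [H|]; first by refute (H (Vec 2 0 0)) 16.
  exact: not_barred_nil.
- apply: not_barred_cons => [H|]; first by
    refute (gram_coord (amul_C3 _ _) (tr_C3 _ _) H b1 b2 b3) 1.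
  apply: not_barred_cons => [H|]; first by refute (H (Vec 0 0 2)) 16.
  apply: not_barred_cons => [H|]; first by refute (H (Vec 2 0 0)) 1.
  apply: not_barred_cons => [H|]; first by refute (H (Vec 2 0 0)) 1.
  apply: not_barred_cons => [H|]; first by refute (H (Vec 0 2 2)) (-16).
  exact: not_barred_nil.
- apply: not_barred_cons => [H|]; first by
    refute (gram_coord (amul_C3 _ _) (tr_C3 _ _) H b1 b2 b3) 1.
  apply: not_barred_cons => [H|]; first by refute (H (Vec 0 0 2)) 16.
  apply: not_barred_cons => [H|]; first by refute (H (Vec 0 2 0)) 1.
  apply: not_barred_cons => [H|]; first by refute (H (Vec 0 2 0)) 1.
  apply: not_barred_cons => [H|]; first by refute (H (Vec 2 2 0)) (-16).
  exact: not_barred_nil.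
- apply: not_barred_cons => [H|]; first by
    refute (assoc_coord v2 (amul_E4 _ _) H (Vec 2 0 0) (Vec 2 0 0) (Vec 0 2 0)) 2.
  apply: not_barred_cons => [H|]; first by refute (H (Vec 0 0 2)) 16.
  apply: not_barred_cons => [H|]; first by refute (H (Vec 0 0 2)) 96.
  apply: not_barred_cons => [H|]; first by refute (H (Vec 0 0 2)) 8.
  apply: not_barred_cons => [H|]; first by refute (H (Vec 0 0 2)) 32.
  apply: not_barred_cons => [H|]; first by refute (H (Vec 2 0 2)) 4.
  apply: not_barred_cons => [H|]; first by refute (H (Vec 2 0 2)) 4.
  apply: not_barred_cons => [H|]; first by refute (H (Vec 2 0 0)) (-6).
  exact: not_barred_nil.
- apply: not_barred_cons => [H|]; first by
    refute (assoc_coord v2 (amul_E4 _ _) H (Vec 2 0 0) (Vec 2 0 0) (Vec 0 2 0)) 2.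
  apply: not_barred_cons => [H|]; first by refute (H (Vec 0 0 2)) 16.
  apply: not_barred_cons => [H|]; first by refute (H (Vec 0 0 2)) 96.
  apply: not_barred_cons => [H|]; first by refute (H (Vec 0 0 2)) 8.
  apply: not_barred_cons => [H|]; first by refute (H (Vec 0 0 2)) 32.
  apply: not_barred_cons => [H|]; first by refute (H (Vec 0 0 2)) 2.
  apply: not_barred_cons => [H|]; first by refute (H (Vec 0 0 2)) 24.
  apply: not_barred_cons => [H|]; first by refute (H (Vec 0 0 2)) 96.
  apply: not_barred_cons => [H|]; first by refute (H (Vec 0 0 2)) (-32).
  apply: not_barred_cons => [H|]; first by refute (H (Vec 0 0 2)) 16.
  exact: not_barred_nil.
- apply: not_barred_cons => [H|]; first by
    refute (assoc_coord v2 (amul_E4 _ _) H (Vec 2 0 0) (Vec 2 0 0) (Vec 0 2 0)) 2.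
  apply: not_barred_cons => [H|]; first by refute (H (Vec 0 0 2)) 16.
  apply: not_barred_cons => [H|]; first by refute (H (Vec 0 0 2)) 96.
  apply: not_barred_cons => [H|]; first by refute (H (Vec 0 0 2)) 8.
  apply: not_barred_cons => [H|]; first by refute (H (Vec 0 0 2)) 32.
  apply: not_barred_cons => [H|]; first by refute (H (Vec 0 0 2)) 1.
  apply: not_barred_cons => [H|]; first by refute (H (Vec 0 0 2)) 3.
  apply: not_barred_cons => [H|]; first by refute (H (Vec 0 0 2)) 3.
  apply: not_barred_cons => [H|]; first by refute (H (Vec 0 0 2)) 1.
  apply: not_barred_cons => [H|]; first by refute (H (Vec 2 0 0)) (-6).
  exact: not_barred_nil.
- apply: not_barred_cons => [H|]; first by
    refute (assoc_coord v2 (amul_E4 _ _) H (Vec 2 0 0) (Vec 2 0 0) (Vec 0 2 0)) 2.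
  apply: not_barred_cons => [H|]; first by refute (H (Vec 0 0 2)) 16.
  apply: not_barred_cons => [H|]; first by refute (H (Vec 0 0 2)) 96.
  apply: not_barred_cons => [H|]; first by refute (H (Vec 0 0 2)) 8.
  apply: not_barred_cons => [H|]; first by refute (H (Vec 0 0 2)) 32.
  apply: not_barred_cons => [H|]; first by refute (H (Vec 2 0 0)) 2.
  apply: not_barred_cons => [H|]; first by refute (H (Vec 0 0 2)) 32.
  apply: not_barred_cons => [H|]; first by refute (H (Vec 0 0 2)) 32.
  apply: not_barred_cons => [H|]; first by refute (H (Vec 2 0 0)) 60.
  apply: not_barred_cons => [H|]; first by refute (H (Vec 2 0 0)) 6.
  exact: not_barred_nil.
- apply: not_barred_cons => [H|]; first by
    refute (assoc_coord v2 (amul_E4 _ _) H (Vec 2 0 0) (Vec 2 0 0) (Vec 0 2 0)) 2.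
  apply: not_barred_cons => [H|]; first by refute (H (Vec 0 0 2)) 16.
  apply: not_barred_cons => [H|]; first by refute (H (Vec 0 0 2)) 96.
  apply: not_barred_cons => [H|]; first by refute (H (Vec 0 0 2)) 8.
  apply: not_barred_cons => [H|]; first by refute (H (Vec 0 0 2)) 32.
  apply: not_barred_cons => [H|]; first by refute (H (Vec 2 0 0)) 1.
  apply: not_barred_cons => [H|]; first by refute (H (Vec 2 0 0)) 3.
  apply: not_barred_cons => [H|]; first by refute (H (Vec 0 0 2)) 32.
  apply: not_barred_cons => [H|]; first by refute (H (Vec 0 0 2)) 32.
  apply: not_barred_cons => [H|]; first by refute (H (Vec 2 0 2)) (-2).
  exact: not_barred_nil.
- apply: not_barred_cons => [H|]; first by
    refute (assoc_coord v2 (amul_E4 _ _) H (Vec 2 0 0) (Vec 2 0 0) (Vec 0 2 0)) 2.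
  apply: not_barred_cons => [H|]; first by refute (H (Vec 0 0 2)) 16.
  apply: not_barred_cons => [H|]; first by refute (H (Vec 0 0 2)) 96.
  apply: not_barred_cons => [H|]; first by refute (H (Vec 0 0 2)) 8.
  apply: not_barred_cons => [H|]; first by refute (H (Vec 0 0 2)) 32.
  apply: not_barred_cons => [H|]; first by refute (H (Vec 0 0 2)) 1.
  apply: not_barred_cons => [H|]; first by refute (H (Vec 0 0 2)) 3.
  apply: not_barred_cons => [H|]; first by refute (H (Vec 0 0 2)) 3.
  apply: not_barred_cons => [H|]; first by refute (H (Vec 0 0 2)) 16.
  apply: not_barred_cons => [H|]; first by refute (H (Vec 2 0 0)) (-8).
  exact: not_barred_nil.
- apply: not_barred_cons => [H|]; first by
    refute (gram_coord (amul_E5 _ _ _) (tr_E5 _ _ _) H b1 (vscale 2 b2) b3) 27.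
  apply: not_barred_cons => [H|]; first by
    refute (assoc_coord v3 (amul_E5 _ _ _) H (Vec 2 0 0) (Vec 2 0 0) (Vec 0 0 2)) 2.
  apply: not_barred_cons => [H|]; first by refute (H (Vec 0 2 0)) 3.
  exact: not_barred_nil.
- apply: not_barred_cons => [H|]; first by
    refute (gram_coord (amul_E5 _ _ _) (tr_E5 _ _ _) H b1 (vscale 2 b2) b3) 27.
  apply: not_barred_cons => [H|]; first by
    refute (assoc_coord v3 (amul_E5 _ _ _) H (Vec 2 0 0) (Vec 2 0 0) (Vec 0 0 2)) 2.
  apply: not_barred_cons => [H|]; first by refute (H (Vec 0 2 0)) 1.
  exact: not_barred_nil.
- apply: not_barred_cons => [H|]; first by
    refute (assoc_coord v2 (amul_E10 _) H (Vec 2 0 0) (Vec 2 0 0) (Vec 0 2 0)) 2.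
  apply: not_barred_cons => [H|]; first by refute (H (Vec 2 0 0)) 2.
  apply: not_barred_cons => [H|]; first by refute (H (Vec 2 0 0)) 18.
  apply: not_barred_cons => [H|]; first by refute (H (Vec 2 0 0)) (-50).
  apply: not_barred_cons => [H|]; first by refute (eq_sub0 (H (Vec 2 0 0))) 292.
  apply: not_barred_cons => [H|]; first by refute (H (Vec 2 0 0)) 4.
  apply: not_barred_cons => [H|]; first by refute (H (Vec 2 0 0)) 4.
  exact: not_barred_nil.
- apply: not_barred_cons => [H|]; first by
    refute (assoc_coord v2 (amul_E10 _) H (Vec 2 0 0) (Vec 2 0 0) (Vec 0 2 0)) 2.
  apply: not_barred_cons => [H|]; first by refute (H (Vec 2 0 0)) 2.
  apply: not_barred_cons => [H|]; first by refute (H (Vec 2 0 0)) 18.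
  apply: not_barred_cons => [H|]; first by refute (H (Vec 2 0 0)) (-50).
  apply: not_barred_cons => [H|]; first by refute (eq_sub0 (H (Vec 2 0 0))) 292.
  apply: not_barred_cons => [H|]; first by refute (H (Vec 2 0 0)) 2.
  apply: not_barred_cons => [H|]; first by refute (H (Vec 2 0 0)) (-4).
  exact: not_barred_nil.
- apply: not_barred_cons => [H|]; first by
    refute (assoc_coord v2 (amul_E10 _) H (Vec 2 0 0) (Vec 2 0 0) (Vec 0 2 0)) 2.
  apply: not_barred_cons => [H|]; first by refute (H (Vec 2 0 0)) 2.
  apply: not_barred_cons => [H|]; first by refute (H (Vec 2 0 0)) 18.
  apply: not_barred_cons => [H|]; first by refute (H (Vec 2 0 0)) (-50).
  apply: not_barred_cons => [H|]; first by refute (eq_sub0 (H (Vec 2 0 0))) 292.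
  apply: not_barred_cons => [H|]; first by refute (H (Vec 2 0 0)) 1.
  apply: not_barred_cons => [H|]; first by refute (H (Vec 2 0 0)) 2.
  exact: not_barred_nil.
- apply: not_barred_cons => [H|]; first by
    refute (assoc2_coord v3 (amul_E11 _ _) H (Vec 2 0 0) (Vec 2 0 0) (Vec 0 2 0)) 4.
  apply: not_barred_cons => [H|]; first by refute (H (Vec 2 0 0)) 24.
  apply: not_barred_cons => [H|]; first by refute (H (Vec 2 0 0)) 2.
  apply: not_barred_cons => [H|]; first by refute (H (Vec 2 0 0)) (-3).
  exact: not_barred_nil.
- apply: not_barred_cons => [H|]; first by
    refute (assoc2_coord v3 (amul_E8 _ _) H (Vec 2 0 0) (Vec 2 0 0) (Vec 0 2 0)) 4.
  apply: not_barred_cons => [H|]; first by refute (H (Vec 2 0 0)) (-2).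
  apply: not_barred_cons => [H|]; first by refute (H (Vec 2 0 0)) (-112).
  apply: not_barred_cons => [H|]; first by refute (H (Vec 2 0 0)) 10.
  apply: not_barred_cons => [H|]; first by refute (H (Vec 2 0 0)) 5.
  exact: not_barred_nil.
- apply: not_barred_cons => [H|]; first by
    refute (assoc2_coord v3 (amul_E8 _ _) H (Vec 2 0 0) (Vec 2 0 0) (Vec 0 2 0)) 4.
  apply: not_barred_cons => [H|]; first by refute (H (Vec 2 0 0)) (-2).
  apply: not_barred_cons => [H|]; first by refute (H (Vec 2 0 0)) (-112).
  apply: not_barred_cons => [H|]; first by refute (H (Vec 2 0 0)) 2.
  apply: not_barred_cons => [H|]; first by refute (H (Vec 2 0 0)) (-5).
  exact: not_barred_nil.
- apply: not_barred_cons => [H|]; first by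
    refute (assoc2_coord v3 (amul_E8 _ _) H (Vec 2 0 0) (Vec 2 0 0) (Vec 0 2 0)) 4.
  apply: not_barred_cons => [H|]; first by refute (H (Vec 2 0 0)) (-2).
  apply: not_barred_cons => [H|]; first by refute (H (Vec 2 0 0)) (-112).
  apply: not_barred_cons => [H|]; first by refute (H (Vec 2 0 0)) 1.
  apply: not_barred_cons => [H|]; first by refute (H (Vec 2 0 0)) 5.
  exact: not_barred_nil.
- apply: not_barred_cons => [H|]; first by
    refute (assoc_coord v3 (amul_E5 _ _ _) H (Vec 2 0 0) (Vec 2 0 0) (Vec 0 0 2)) 2.
  apply: not_barred_cons => [H|]; first by refute (H (Vec 0 2 0)) 24.
  apply: not_barred_cons => [H|]; first by refute (H (Vec 0 2 0)) 3.
  apply: not_barred_cons => [H|]; first by refute (H (Vec 2 2 0)) (-216).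
  apply: not_barred_cons => [H|]; first by refute (eq_sub0 (H (Vec 2 2 0))) 576.
  apply: not_barred_cons => [H|]; first by refute (H (Vec 2 0 0)) 2.
  apply: not_barred_cons => [H|]; first by refute (H (Vec 0 2 0)) 3.
  apply: not_barred_cons => [H|]; first by refute (H (Vec 2 0 0)) (-24).
  exact: not_barred_nil.
- apply: not_barred_cons => [H|]; first by
    refute (assoc_coord v3 (amul_E5 _ _ _) H (Vec 2 0 0) (Vec 2 0 0) (Vec 0 0 2)) 2.
  apply: not_barred_cons => [H|]; first by refute (H (Vec 0 2 0)) 24.
  apply: not_barred_cons => [H|]; first by refute (H (Vec 0 2 0)) 3.
  apply: not_barred_cons => [H|]; first by refute (H (Vec 2 2 0)) (-216).
  apply: not_barred_cons => [H|]; first by refute (eq_sub0 (H (Vec 2 2 0))) 576.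
  apply: not_barred_cons => [H|]; first by refute (H (Vec 2 0 0)) 1.
  apply: not_barred_cons => [H|]; first by refute (H (Vec 0 2 0)) 3.
  apply: not_barred_cons => [H|]; first by refute (H (Vec 2 2 0)) 1.
  exact: not_barred_nil.
Qed.
Notation classified := (classified Ds bar).
Notation zcl D := (zclosure (alg_orbit (ofalg D))).

(** The trace form [T] is bilinear and symmetric, so its Gram determinant changes by the square of
    the determinant of the base change; [gram] then has to be checked on the standard basis only. *)
Lemma gramdet_basis D x y z :
  gramdet D x y z = det3 x y z ^+ 2 * gramdet D b1 b2 b3.
Proof.
pose T u v := tr D (amul D u v).
have tD u v : tr D (vadd u v) = tr D u + tr D v.
  by rewrite /tr /trm /=; ring.
have tZ a u : tr D (vscale a u) = a * tr D u.
  by rewrite /tr /trm /=; ring.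
have TE u v : T u v = v1 u * v1 v * T b1 b1 + (v1 u * v2 v + v2 u * v1 v) * T b1 b2
  + (v1 u * v3 v + v3 u * v1 v) * T b1 b3 + v2 u * v2 v * T b2 b2
  + (v2 u * v3 v + v3 u * v2 v) * T b2 b3 + v3 u * v3 v * T b3 b3.
  rewrite {1}/T /amul !(tD, tZ) /T.
  have [[-> -> ->] [-> -> ->]] := amul_basis D; ring.
rewrite /gramdet -!/(T _ _) !(TE x) !(TE y) !(TE z) /det3.
cbn [v1 v2 v3].
by move: (T b1 b1) (T b1 b2) (T b1 b3) (T b2 b2) (T b2 b3) (T b3 b3) => *; ring.
Qed.
Lemma gram_basis D : gramdet D b1 b2 b3 = 0 -> gram D.
Proof. by move=> h0 x y z; rewrite gramdet_basis h0 mulr0. Qed.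

Lemma classified_at D (k0 : 'I_21) : iso D (Ds k0) ->
  (forall k, (k < 21)%N -> k != k0 :> nat -> barred (nth [::] bars k) D) ->
  classified D.
Proof.
move=> hiso hb; split.
  by exists k0; apply: sub_zclosure; apply/orbitP; exists D.
exists (Some k0); split=> [k kk0|k [<-//]].
by apply: hb (ltn_ord k) _; move: kk0; apply: contra => /eqP /val_inj ->.
Qed.
Lemma classified_none D (k0 : 'I_21) : zcl (Ds k0) (ofalg D) ->
  (forall k, (k < 21)%N -> barred (nth [::] bars k) D) -> classified D.
Proof.
move=> hcl hb; split; first by exists k0.
by exists None; split=> // k _; apply: hb (ltn_ord k).
Qed.

Lemma assoc_assoc2 D : assoc D -> assoc2 D.
Proof.
move=> hD x y z /=; rewrite hD.
have -> u : vsub u u = o by apply: vecP => /=; ring.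
by apply: vecP => /=; ring.
Qed.

Ltac gram_tac := rewrite /holds; apply: gram_basis; unf; fld.
Tactic Notation "gram_by" uconstr(M) uconstr(T) :=
  rewrite /holds; apply: gram_basis; rewrite (gramP M T); unf; fld.
Ltac weight_tac := rewrite /holds; move=> [? ? ?]; unf; fld.
Ltac assoc2_tac := apply: assoc2P;
  [amul_tac|by move=> [? ? ?] [? ? ?] [? ? ?]; apply: vecP; rewrite /=; fld].
Ltac nil_assoc2_tac := apply: assoc2_nil;
  [amul_tac|by move=> [? ? ?] [? ? ?] [? ? ?]; rewrite /=; ring
  |by move=> [? ? ?] /= ->; apply: vecP; rewrite /=; ring].
Ltac assoc_tac := rewrite /holds; move=> [? ? ?] [? ? ?] [? ? ?]; apply: vecP; unf; fld.
(** The index of the algebra itself is discharged by its false hypothesis. Otherwise the matching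
    backtracks over the facts [holds q D] of the context until one occurs in the list, so each proof
    below only gathers enough facts. *)
Ltac findbar := try (by move/eqP); try (move=> _);
  match goal with f : holds ?q ?D |- barred _ ?D =>
    exists q; [by repeat (first [left; reflexivity | right])|exact: f] end.
Ltac bars_tac := nat_cases; findbar.

(** Every list of [bars] contains [Assoc], [Assoc2] or [Gram]. *)
Lemma classified_assoc_gram D (k0 : 'I_21) : zcl (Ds k0) (ofalg D) ->
  assoc D -> gram D -> classified D.
Proof.
move=> hcl hA hG; apply: (classified_none hcl).
have f1 : holds Assoc D by []. have f2 : holds Gram D by [].
have f3 : holds Assoc2 D by exact: assoc_assoc2.
bars_tac.
Qed.

Lemma C3_assoc l1 l2 : assoc (C3 l1 l2).
Proof. assoc_tac. Qed.

Lemma C3_classified l1 l2 : [\/ l1 = 0 /\ l2 = 0, l1 = 1 /\ l2 = 0, l1 = h /\ l2 = 0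
  | l1 = h /\ l2 = h] -> classified (C3 l1 l2).
Proof.
move=> hl; have f1 : holds Assoc (C3 l1 l2) by exact: C3_assoc.
have f3 : holds Assoc2 (C3 l1 l2) by exact: assoc_assoc2.
case: hl => -[] -> -> in f1 f3 *.
- have f4 : holds (Wlin 0 1) (C3 0 0) by weight_tac.
  apply: (@classified_at _ (inord 0)); rewrite /Ds inordK //; first exact: iso_refl.
  bars_tac.
- have f4 : holds (Wdet 1 0 1) (C3 1 0) by weight_tac.
  apply: (@classified_at _ (inord 1)); rewrite /Ds inordK //; first exact: iso_refl.
  bars_tac.
- have f4 : holds (Wdet 1 0 2) (C3 h 0) by weight_tac.
  apply: (@classified_at _ (inord 2)); rewrite /Ds inordK //; first exact: iso_refl.
  bars_tac.
- have f4 : holds (Wdet 1 1 (-2)) (C3 h h) by weight_tac.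
  apply: (@classified_at _ (inord 3)); rewrite /Ds inordK //; first exact: iso_refl.
  bars_tac.
Qed.

Ltac pp_tac := split; split; split; rewrite /=; repeat first
  [ exact: ppoly_id | exact: (fr_const (ppoly_funring K))
  | apply: (fr_add (ppoly_funring K)) | apply: (fr_sub (ppoly_funring K))
  | apply: (fr_opp (ppoly_funring K)) | apply: (fr_mul (ppoly_funring K)) ].
(* The vectors [x], [y], [z] form a basis of the first algebra in which its table is that of the
   second; [d] is their determinant in a visibly nonzero form. *)
Tactic Notation "iso_by" uconstr(x) uconstr(y) uconstr(z) uconstr(d) :=
  refine (@iso_basis _ _ _ x y z _ _ _ _ _ _ _ _ _ _);
  [ rewrite (_ : det3 _ _ _ = d); last (by rewrite /det3 /=; fld);
    first [assumption|rewrite ?(mulf_neq0, expf_neq0, invr_neq0, oppr_eq0, oner_eq0, pnatr_eq0) //]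
  | (apply: vecP; unf; fld) .. | unf; fld | unf; fld | unf; fld].

Lemma iso_eq D E : D = E -> iso D E.
Proof. by move=> ->; exact: iso_refl. Qed.
Ltac eq_tac := apply: iso_eq; congr Alg; apply: vecP; rewrite /=; ring.

(** In [U0] and [Z0] an idempotent acts as 1 or 0 on a null ideal; [N0], [N1] and [N2] are the
    algebras in which all cubes vanish. All five are associative with degenerate trace form, and are
    limits of some [C3]. *)
Definition U0 l : alg K := Alg b1 b2 b3 o o o (Vec l 0 0).
Definition Z0 l : alg K := Alg b1 o o o o o (Vec l 0 0).
Definition N0 : alg K := Alg o o o o o o o.
Definition N1 : alg K := Alg b2 o o o o o o.
Definition N2 : alg K := Alg o b3 o o o o o.

(** In this and the next degenerations, the curve is the table of the larger algebra in the basis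
    displayed after [iso_by], which degenerates at [s = 0] while the table has a limit. *)
Lemma U0_zclosure l : zcl (C3 l 0) (ofalg (U0 l)).
Proof.
apply: (@zclosure_curve K (fun s => Alg b1 b2 b3 (vscale s b2) o (vscale s b3)
  (Vec l 0 0)) id _ _ 0 1).
- pp_tac.
- exact: ppoly_id.
- exact: oner_neq0.
- move=> s s0; apply: iso_sym; iso_by (Vec 1 1 1) (Vec 0 s 0) (Vec 0 0 s) (s ^+ 2).
- eq_tac.
Qed.
Lemma Z0_zclosure l : zcl (C3 l 0) (ofalg (Z0 l)).
Proof.
apply: (@zclosure_curve K (fun s => Alg b1 o o (vscale s b2) o (vscale s b3)
  (Vec l 0 0)) id _ _ 0 1).
- pp_tac.
- exact: ppoly_id.
- exact: oner_neq0.
- move=> s s0; apply: iso_sym; iso_by (Vec 1 0 0) (Vec 0 s 0) (Vec 0 0 s) (s ^+ 2).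
- eq_tac.
Qed.
Lemma N0_zclosure : zcl (C3 0 0) (ofalg N0).
Proof.
apply: (@zclosure_curve K (fun s => Alg (vscale s b1) o o (vscale s b2) o (vscale s b3)
  o) id _ _ 0 1).
- pp_tac.
- exact: ppoly_id.
- exact: oner_neq0.
- move=> s s0; apply: iso_sym; iso_by (Vec s 0 0) (Vec 0 s 0) (Vec 0 0 s) (s ^+ 3).
- eq_tac.
Qed.
Lemma N1_zclosure : zcl (C3 0 0) (ofalg N1).
Proof.
apply: (@zclosure_curve K (fun s => Alg b2 (Vec (- 2 * (s * s)) (3 * s) 0) o
  (Vec (- 6 * (s * s * s)) (7 * (s * s)) 0) o (vscale s b3) o) id _ _ 0 1).
- pp_tac.
- exact: ppoly_id.
- exact: oner_neq0.
- move=> s s0; apply: iso_sym.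
  (* The vector [x = s e1 + 2 s e2] and its square: [x^3 = 3 s x^2 - 2 s^2 x] tends to zero. *)
  iso_by (Vec s (2 * s) 0) (Vec (s ^+ 2) (4 * s ^+ 2) 0) (Vec 0 0 s) (2 * s ^+ 4).
- eq_tac.
Qed.
Lemma N2_zclosure : zcl (C3 0 0) (ofalg N2).
Proof.
apply: (@zclosure_curve K (fun s => Alg (vscale s b1) b3 (vscale s b3)
  (vscale s b2) (vscale s b3) (vscale (s * s) b3) o) id _ _ 0 1).
- pp_tac.
- exact: ppoly_id.
- exact: oner_neq0.
- move=> s s0; apply: iso_sym; iso_by (Vec s 0 s) (Vec 0 s s) (Vec 0 0 (s ^+ 2)) (s ^+ 4).
- eq_tac.
Qed.
Lemma E5_zclosure l : zcl (E5 1 l l) (ofalg (E5 0 l l)).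
Proof.
apply: (@zclosure_curve K (fun s => E5 (s * s) l l) id _ _ 0 1).
- pp_tac.
- exact: ppoly_id.
- exact: oner_neq0.
- by move=> s s0; apply: iso_sym; iso_by b1 b2 (Vec 0 0 s) s.
- eq_tac.
Qed.
Lemma E8_zclosure l : zcl (E8 1 l) (ofalg (E8 0 l)).
Proof.
apply: (@zclosure_curve K (fun s => E8 s l) id _ _ 0 1).
- pp_tac.
- exact: ppoly_id.
- exact: oner_neq0.
- by move=> s s0; apply: iso_sym; iso_by b1 (Vec 0 s 0) (Vec 0 0 s) (s ^+ 2).
- eq_tac.
Qed.
Lemma E11_zclosure l : zcl (E11 1 l) (ofalg (E11 0 l)).
Proof.
apply: (@zclosure_curve K (fun s => E11 s l) id _ _ 0 1).
- pp_tac.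
- exact: ppoly_id.
- exact: oner_neq0.
- by move=> s s0; apply: iso_sym; iso_by b1 (Vec 0 s 0) (Vec 0 0 s) (s ^+ 2).
- eq_tac.
Qed.
(** The third vector is the square of the second and [s^2] times the unit of [E5 1 l l]. That
    algebra is in [Dlist] for [l = 0] and [l = h] only; the remaining value gives the rigid
    [E11 1 1]. *)
Lemma E11_E5_zclosure l : zcl (E5 1 l l) (ofalg (E11 1 l)).
Proof.
apply: (@zclosure_curve K (fun s => Alg b1 (vscale h b2) (Vec (s * s) 0 0) b3
  (Vec 0 (s * s) 0) (Vec 0 0 (s * s)) (Vec l 0 (2 * l * (s * s)))) id _ _ 0 1).
- pp_tac.
- exact: ppoly_id.
- exact: oner_neq0.
- move=> s s0; apply: iso_sym.
  iso_by b1 (Vec 0 0 s) (Vec (s ^+ 2) (s ^+ 2) 0) (- s ^+ 3).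
- eq_tac.
Qed.
Lemma E11_E5_zclosure0 l : zcl (E5 1 l l) (ofalg (E11 0 l)).
Proof.
apply: (@zclosure_curve K (fun s => Alg b1 (vscale h b2) (Vec s 0 0) (vscale s b3)
  (Vec 0 s 0) (Vec 0 0 s) (Vec l 0 (2 * l * s))) id _ _ 0 1).
- pp_tac.
- exact: ppoly_id.
- exact: oner_neq0.
- move=> s s0; apply: iso_sym; iso_by b1 (Vec 0 0 s) (Vec s s 0) (- s ^+ 2).
- eq_tac.
Qed.
Tactic Notation "at_tac" constr(n) :=
  apply: (@classified_at _ (inord n)); rewrite /Ds inordK //; [try exact: iso_refl|bars_tac].
Tactic Notation "at_none" constr(n) constr(zclosed_lemma) :=
  apply: (@classified_none _ (inord n));
  [rewrite /Ds inordK //=; apply zclosed_lemma|bars_tac].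

(** * Every normal form is classified *)

Definition lvals (l : K) := [\/ l = 0, l = 1 | l = h].

Lemma C3_Ds l : lvals l -> exists k, Ds k = C3 l 0.
Proof. by case=> ->; [exists (inord 0)|exists (inord 1)|exists (inord 2)]; rewrite /Ds inordK. Qed.

Lemma U0_classified l : lvals l -> classified (U0 l).
Proof.
move=> /C3_Ds [k hk]; apply: (@classified_assoc_gram _ k); [|assoc_tac|gram_tac].
by rewrite hk; exact: U0_zclosure.
Qed.
Lemma Z0_classified l : lvals l -> classified (Z0 l).
Proof.
move=> /C3_Ds [k hk]; apply: (@classified_assoc_gram _ k); [|assoc_tac|gram_tac].
by rewrite hk; exact: Z0_zclosure.
Qed.
Lemma N_classified D : [\/ D = N0, D = N1 | D = N2] -> classified D.
Proof.
have [k hk] := C3_Ds (Or31 _ _ (erefl 0)).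
case=> ->; apply: (@classified_assoc_gram _ k);
  [|assoc_tac|gram_tac| |assoc_tac|gram_tac| |assoc_tac|gram_tac];
  rewrite hk; [exact: N0_zclosure|exact: N1_zclosure|exact: N2_zclosure].
Qed.

Lemma E4_classified l1 l3 : lvals l1 -> lvals l3 ->
  [\/ l1 = 0, l3 = 0 | l1 = h /\ l3 = h] -> classified (E4 l1 l3).
Proof.
move=> h1 h3 hl.
have f1 : holds Gram (E4 l1 l3) by gram_by (amul_E4 _ _) (tr_E4 _ _).
have f2 : holds Assoc2 (E4 l1 l3) by assoc2_tac.
have f3 : holds Quart (E4 l1 l3) by weight_tac.
have kb : l1 = 0 -> classified (E4 l1 l3).
  move=> E; rewrite E in f1 f2 f3 *; case: h3 => E3; rewrite E3 in f1 f2 f3 *.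
  - have f4 : holds (Wlin 0 1) (E4 0 0) by weight_tac.
    at_tac 4%N.
  - have f4 : holds (Wdet 1 0 1) (E4 0 1) by weight_tac.
    have f5 : holds (Wdet 3 2 (-2)) (E4 0 1) by weight_tac.
    at_tac 5%N.
  - have f4 : holds (Wdet 1 0 2) (E4 0 h) by weight_tac.
    have f5 : holds (Wdet 3 2 (-4)) (E4 0 h) by weight_tac.
    at_tac 6%N.
case: hl => [//|E|[E E3]]; last first.
  rewrite E E3 in f1 f2 f3 *.
  have f4 : holds (Wdet 1 1 (-2)) (E4 h h) by weight_tac.
  at_tac 9%N.
case: h1 => [//||] E1; rewrite E E1 in f1 f2 f3 *.
- have f4 : holds (Wdet 1 0 1) (E4 1 0) by weight_tac.
  have f5 : holds (Wdet 2 2 (-3)) (E4 1 0) by weight_tac.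
  at_tac 7%N.
- have f4 : holds (Wdet 1 0 1) (E4 h 0) by weight_tac.
  have f5 : holds (Wdet 1 1 (-3)) (E4 h 0) by weight_tac.
  at_tac 8%N.
Qed.

Lemma E5_scale (g l1 l2 : K) : g != 0 -> iso (E5 g l1 l2) (E5 1 l1 l2).
Proof.
move=> g0; have r2 : sqrtC g ^+ 2 = g by exact: sqrtCK.
have r0 : sqrtC g != 0 by rewrite -sqrf_eq0 r2.
rewrite -[in X in iso X _]r2; move: (sqrtC g) r0 => r r0; apply: iso_sym.
by iso_by b1 b2 (Vec 0 0 r) r.
Qed.

Lemma E5_diag_classified g l : l = 0 \/ l = h -> classified (E5 g l l).
Proof.
move=> hl.
have f1 : holds (Wdet 3 1 0) (E5 1 l l) by weight_tac.
have f1' : holds (Wdet 3 1 0) (E5 0 l l) by weight_tac.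
have f2' : holds Gram (E5 0 l l) by gram_by (amul_E5 _ _ _) (tr_E5 _ _ _).
suff [h0 h1] : classified (E5 0 l l) /\ classified (E5 1 l l).
  have [->//|g0] := eqVneq g 0.
  exact: classified_iso (E5_scale _ _ g0) h1.
case: hl => E; rewrite E in f1 f1' f2' *.
- have f3 : holds (Wlin 0 1) (E5 1 0 0) by weight_tac.
  have f3' : holds (Wlin 0 1) (E5 0 0 0) by weight_tac.
  by split; [at_none 10%N E5_zclosure|at_tac 10%N].
- have f3 : holds (Wlin 1 (-3)) (E5 1 h h) by weight_tac.
  have f3' : holds (Wlin 1 (-3)) (E5 0 h h) by weight_tac.
  by split; [at_none 11%N E5_zclosure|at_tac 11%N].
Qed.

Lemma E5_off_classified l : l = 1 \/ l = h -> classified (E5 0 l 0).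
Proof.
move=> hl.
have f1 : holds (Wdet 3 1 0) (E5 0 l 0) by weight_tac.
have f2 : holds Gram (E5 0 l 0) by gram_by (amul_E5 _ _ _) (tr_E5 _ _ _).
have f3 : holds Assoc2 (E5 0 l 0) by assoc2_tac.
case: hl => E; rewrite E in f1 f2 f3 *.
- have f4 : holds (Wdet 1 0 1) (E5 0 1 0) by weight_tac.
  at_tac 19%N.
- have f4 : holds (Wdet 1 0 2) (E5 0 h 0) by weight_tac.
  at_tac 20%N.
Qed.

Lemma E8_scale (g l : K) : g != 0 -> iso (E8 g l) (E8 1 l).
Proof.
by move=> g0; apply: iso_sym; iso_by b1 b2 (Vec 0 0 g^-1) g^-1; rewrite ?invr_eq0.
Qed.
Lemma E11_scale (g l : K) : g != 0 -> iso (E11 g l) (E11 1 l).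
Proof.
by move=> g0; apply: iso_sym; iso_by b1 b2 (Vec 0 0 g^-1) g^-1; rewrite ?invr_eq0.
Qed.

Lemma E8_classified g l : lvals l -> classified (E8 g l).
Proof.
move=> hl.
have f1 : holds (Wdet 5 2 0) (E8 1 l) by weight_tac.
have f1' : holds (Wdet 5 2 0) (E8 0 l) by weight_tac.
have f2 : holds Gram (E8 1 l) by gram_by (amul_E8 _ _) (tr_E8 _ _).
have f2' : holds Gram (E8 0 l) by gram_by (amul_E8 _ _) (tr_E8 _ _).
have f3' : holds Assoc2 (E8 0 l) by nil_assoc2_tac.
suff [h0 h1] : classified (E8 0 l) /\ classified (E8 1 l).
  have [->//|g0] := eqVneq g 0.
  exact: classified_iso (E8_scale _ g0) h1.
case: hl => E; rewrite E in f1 f1' f2 f2' f3' *.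
- have f3 : holds (Wlin 0 1) (E8 1 0) by weight_tac.
  by split; [at_none 16%N E8_zclosure|at_tac 16%N].
- have f3 : holds (Wlin 2 (-5)) (E8 1 1) by weight_tac.
  by split; [at_none 17%N E8_zclosure|at_tac 17%N].
- have f3 : holds (Wlin 1 (-5)) (E8 1 h) by weight_tac.
  by split; [at_none 18%N E8_zclosure|at_tac 18%N].
Qed.

Lemma E10_classified l : lvals l -> classified (E10 l).
Proof.
move=> hl.
have f1 : holds (Wdet 2 1 0) (E10 l) by weight_tac.
have f2 : holds Gram (E10 l) by gram_by (amul_E10 _) (tr_E10 _).
have f3 : holds Assoc2 (E10 l) by nil_assoc2_tac.
case: hl => E; rewrite E in f1 f2 f3 *.
- have f4 : holds (Wlin 0 1) (E10 0) by weight_tac.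
  at_tac 12%N.
- have f4 : holds (Wlin 1 (-2)) (E10 1) by weight_tac.
  at_tac 13%N.
- have f4 : holds (Wlin 1 (-4)) (E10 h) by weight_tac.
  at_tac 14%N.
Qed.

Lemma E11_classified g l : lvals l -> classified (E11 g l).
Proof.
move=> hl.
have f1 : holds (Wdet 3 2 0) (E11 1 l) by weight_tac.
have f1' : holds (Wdet 3 2 0) (E11 0 l) by weight_tac.
have f2 : holds Gram (E11 1 l) by gram_by (amul_E11 _ _) (tr_E11 _ _).
have f2' : holds Gram (E11 0 l) by gram_by (amul_E11 _ _) (tr_E11 _ _).
have f3' : holds Assoc2 (E11 0 l) by nil_assoc2_tac.
suff [h0 h1] : classified (E11 0 l) /\ classified (E11 1 l).
  have [->//|g0] := eqVneq g 0.
  exact: classified_iso (E11_scale _ g0) h1.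
case: hl => E; rewrite E in f1 f1' f2 f2' f3' *.
- have f3 : holds (Wlin 0 1) (E11 1 0) by weight_tac.
  by split; [at_none 10%N E11_E5_zclosure0|at_none 10%N E11_E5_zclosure].
- by split; [at_none 15%N E11_zclosure|at_tac 15%N].
- have f3 : holds (Wlin 1 (-3)) (E11 1 h) by weight_tac.
  by split; [at_none 11%N E11_E5_zclosure0|at_none 11%N E11_E5_zclosure].
Qed.

(** The algebra with basis [x, x^2, x^3] and [x^4 = t1 x + t2 x^2 + t3 x^3]. *)
Definition Mono3 (t1 t2 t3 : K) (w : vec K) : alg K :=
  let T := Vec t1 t2 t3 in let U := Vec (t3 * t1) (t1 + t3 * t2) (t2 + t3 * t3) in
  Alg b2 b3 T T U (Vec (v3 U * t1) (v1 U + v3 U * t2) (v2 U + v3 U * t3)) w.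
(** In [C3 k1 k2] the generator [x = (r1, r2, r3)] has [lam (x^n) = k1 r1^n + k2 r2^n]. *)
Definition Mono (r1 r2 r3 k1 k2 : K) := Mono3 (r1 * r2 * r3)
  (- (r1 * r2 + r1 * r3 + r2 * r3)) (r1 + r2 + r3)
  (Vec (k1 * r1 + k2 * r2) (k1 * r1 ^+ 2 + k2 * r2 ^+ 2) (k1 * r1 ^+ 3 + k2 * r2 ^+ 3)).

(** The determinant of [x], [x^2], [x^3] for [x = (r1, r2, r3)] in [C3]. *)
Definition vdm (r1 r2 r3 : K) := r1 * r2 * r3 * ((r2 - r1) * (r3 - r1) * (r3 - r2)).

Lemma Mono_iso r1 r2 r3 k1 k2 : vdm r1 r2 r3 != 0 ->
  iso (Mono r1 r2 r3 k1 k2) (C3 k1 k2).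
Proof.
rewrite /vdm => v0; apply: iso_sym.
iso_by (Vec r1 r2 r3) (Vec (r1 ^+ 2) (r2 ^+ 2) (r3 ^+ 2))
  (Vec (r1 ^+ 3) (r2 ^+ 3) (r3 ^+ 3))
  (r1 * r2 * r3 * ((r2 - r1) * (r3 - r1) * (r3 - r2))).
Qed.

Lemma exists_notin (l : seq K) : exists s, s \notin l.
Proof.
pose P := \prod_(x <- l) ('X - x%:P).
have [//|nex] := pselect (exists s, s \notin l).
have : P = 0.
  apply: poly_eq0_infinite => x; apply/rootP; rewrite root_prod_XsubC.
  by apply: contraT => xl; case: nex; exists x.
by move/eqP; rewrite /P (negPf (monic_neq0 (monic_prod_XsubC _ _ _))).
Qed.

(** Moving the three roots at the different speeds 1, 2, 3 makes them distinct and nonzero for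
    almost all [s]. *)
Lemma Mono_zclosure r1 r2 r3 k1 k2 : zcl (C3 k1 k2) (ofalg (Mono r1 r2 r3 k1 k2)).
Proof.
pose w s := vdm (r1 + s) (r2 + 2 * s) (r3 + 3 * s).
have pw : ppoly w.
  rewrite /w /vdm; repeat first
  [ exact: ppoly_id | exact: (fr_const (ppoly_funring _))
  | apply: (fr_add (ppoly_funring _)) | apply: (fr_sub (ppoly_funring _))
  | apply: (fr_opp (ppoly_funring _)) | apply: (fr_mul (ppoly_funring _)) ].
have [s1 ws1] : exists s, w s != 0.
  (* The zeros of the six linear factors of [w]. *)
  have [s] := exists_notin [:: - r1; - r2 / 2; - r3 / 3; r1 - r2; (r1 - r3) / 2; r2 - r3].
  have lin (a b d : K) : d != 0 -> d * a = d * s - b -> s != a -> b != 0.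
    move=> d0 E; apply: contraNneq => b0; apply/eqP/(mulfI d0).
    by rewrite E b0 subr0.
  rewrite !inE !negb_or => /and5P [s1 s2 s3 s4 /andP [s5 s6]].
  exists s; rewrite /w /vdm; rewrite !mulf_neq0 //.
  - by apply: (lin _ _ 1) s1; [rewrite ?oner_eq0 ?pnatr_eq0|ring].
  - by apply: (lin _ _ 2) s2; [rewrite ?oner_eq0 ?pnatr_eq0|fld].
  - by apply: (lin _ _ 3) s3; [rewrite ?oner_eq0 ?pnatr_eq0|fld].
  - by apply: (lin _ _ 1) s4; [rewrite ?oner_eq0 ?pnatr_eq0|ring].
  - by apply: (lin _ _ 2) s5; [rewrite ?oner_eq0 ?pnatr_eq0|fld].
  - by apply: (lin _ _ 1) s6; [rewrite ?oner_eq0 ?pnatr_eq0|ring].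
apply: (@zclosure_curve K (fun s => Mono (r1 + s) (r2 + 2 * s) (r3 + 3 * s) k1 k2)
  w _ _ 0 s1) => //.
- pp_tac.
- by move=> s ws; exact: Mono_iso.
- by rewrite !mulr0 !addr0; exact: iso_refl.
Qed.

Lemma Mono_classified r1 r2 r3 k1 k2 : [\/ k1 = 0 /\ k2 = 0, k1 = 1 /\ k2 = 0,
  k1 = h /\ k2 = 0 | k1 = h /\ k2 = h] -> classified (Mono r1 r2 r3 k1 k2).
Proof.
move=> hk; have [v0|v0] := eqVneq (vdm r1 r2 r3) 0; last first.
  exact: classified_iso (Mono_iso _ _ v0) (C3_classified hk).
have [k hDs] : exists k, Ds k = C3 k1 k2.
  by case: hk => -[-> ->]; [exists (inord 0)|exists (inord 1)|exists (inord 2)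
    |exists (inord 3)]; rewrite /Ds inordK.
apply: (@classified_assoc_gram _ k).
- by rewrite hDs; exact: Mono_zclosure.
- assoc_tac.
(* The Gram determinant of [x], [x^2], [x^3] is the square of [vdm]. *)
apply: gram_basis; rewrite -[RHS](mul0r (vdm r1 r2 r3)) -v0; unf; rewrite /vdm; ring.
Qed.

(** * Classification *)

(** [lin1] and [lin2] reduce an equation to a ring identity, once it is known to be a
    multiple, or a combination, of given equations. *)
Lemma lin1 (k A B X Y : K) : A = B -> X - Y = k * (A - B) -> X = Y.
Proof. by move=> -> /eqP; rewrite subrr mulr0 subr_eq0 => /eqP. Qed.
Lemma lin2 (k k' A B A' B' X Y : K) : A = B -> A' = B' ->
  X - Y = k * (A - B) + k' * (A' - B') -> X = Y.
Proof. by move=> -> -> /eqP; rewrite !subrr !mulr0 addr0 subr_eq0 => /eqP. Qed.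
Lemma exp0 n (x : K) : x ^+ n.+1 = 0 -> x = 0.
Proof. by move/eqP; rewrite expf_eq0 /= => /eqP. Qed.
(** The hypothesis is the cubic identity at an idempotent with [lam e = l]. *)
Lemma lvalsP (l : K) : l = 3 * l ^+ 2 - 2 * l ^+ 3 -> lvals l.
Proof.
move=> e; have : l * (l - 1) * (2 * l - 1) = 0 by apply: (lin1 (k := 1) e); ring.
move/eqP; rewrite !mulf_eq0 => /orP[/orP[/eqP l0|/eqP l1]|/eqP l2].
- exact: Or31.
- by apply: Or32; apply: (lin1 (k := 1) l1); ring.
- by apply: Or33; apply: (lin1 (k := h) l2); fld.
Qed.

Lemma amul_b1 D x : amul D b1 x = app (Mat (p11 D) (p12 D) (p13 D)) x.
Proof. by apply: vecP => /=; ring. Qed.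
Lemma amul_b2 D x : amul D b2 x = app (Mat (p12 D) (p22 D) (p23 D)) x.
Proof. by apply: vecP => /=; ring. Qed.
Lemma amul_b3 D x : amul D b3 x = app (Mat (p13 D) (p23 D) (p33 D)) x.
Proof. by apply: vecP => /=; ring. Qed.
(** The single factors are moved to the left, where [amul_b1], [amul_b2] and [amul_b3] can rewrite
    them. *)
Lemma jordan_left D : jordan D -> forall x y z t, let m := amul D in
  vadd (m t (m z (m x y))) (vadd (m y (m z (m x t))) (m x (m z (m y t))))
  = vadd (m (m x y) (m z t)) (vadd (m (m x t) (m y z)) (m (m x z) (m y t))).
Proof.
move=> j x y z t; rewrite /= -j.1 /=.
by rewrite !(amulC D z) !(amulC D t) !(amulC D y) !(amulC D x).
Qed.

(* The equation is [k] times the coordinate [p] of the Jordan identity at [x], [y], [z], [t]; the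
   basis vectors are chosen so that this coordinate involves little besides the entry sought. *)
Tactic Notation "jor" uconstr(j) uconstr(p) uconstr(x) uconstr(y) uconstr(z) uconstr(t)
    uconstr(k) :=
  refine (@lin1 k _ _ _ _ (congr1 p (jordan_left j x y z t)) _);
  rewrite ?amul_b1 ?amul_b2 ?amul_b3; unf; fld.
Lemma jordan_lam D : jordan D -> forall x y z, let l := lam D in let m := amul D in
  l (m z (m x y)) = l (m x y) * l z + l (m y z) * l x + l (m x z) * l y
                       - 2 * (l x * l y * l z).
Proof. by move=> j x y z; rewrite /= (amulC D z) j.2. Qed.
Tactic Notation "jlam" uconstr(j) uconstr(x) uconstr(y) uconstr(z) uconstr(k) :=
  refine (@lin1 k _ _ _ _ (jordan_lam j x y z) _);
  rewrite ?amul_b1 ?amul_b2 ?amul_b3; unf; fld.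
(* The right side of [jordan_lam] is symmetric, so the difference of two instances that permute the
   arguments says that [lam] vanishes on an associator. In particular it vanishes on eigenvectors of
   [L_e] for 1/2. *)
Tactic Notation "jlam2" uconstr(j) uconstr(x) uconstr(y) uconstr(z) uconstr(x') uconstr(y')
    uconstr(z') uconstr(k) :=
  refine (@lin2 k (- k) _ _ _ _ _ _ (jordan_lam j x y z) (jordan_lam j x' y' z') _);
  rewrite ?amul_b1 ?amul_b2 ?amul_b3; unf; fld.

(** * Peirce cases: in [case_uv] the idempotent [b1] acts as [u] on [b2] and as [v] on [b3] *)

Lemma case_hh (a1 a2 a3 c1 c2 c3 d1 d2 d3 l1 l2 l3 : K) :
  let E := Alg b1 (vscale h b2) (vscale h b3) (Vec a1 a2 a3) (Vec c1 c2 c3)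
    (Vec d1 d2 d3) (Vec l1 l2 l3) in
  jordan E -> classified E.
Proof.
move=> E j; rewrite {}/E in j *.
have E1 : a2 = 0 by jor j v2 b1 b2 b1 b2 (-4).
have E2 : a3 = 0 by jor j v3 b1 b2 b1 b2 (-4).
have E3 : c2 = 0 by jor j v2 b1 b2 b1 b3 (-4).
have E4 : c3 = 0 by jor j v3 b1 b2 b1 b3 (-4).
have E5 : d2 = 0 by jor j v2 b1 b3 b1 b3 (-4).
have E6 : d3 = 0 by jor j v3 b1 b3 b1 b3 (-4).
rewrite {}E1 {}E2 {}E3 {}E4 {}E5 {}E6 in j *.
(* Here [b2 (b2 (b2 b2)) = a1^2 / 2 b1], whereas [(b2 b2) (b2 b2) = a1^2 b1]. *)
have E1 : a1 = 0 by apply: (@exp0 1); jor j v1 b2 b2 b2 b2 (- 2 / 3).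
have E2 : d1 = 0 by apply: (@exp0 1); jor j v1 b3 b3 b3 b3 (- 2 / 3).
rewrite {}E1 {}E2 in j *.
have E1 : c1 = 0.
  by apply: (@exp0 1); jor j v1 b2 b3 b2 b3 (-1).
have E2 : l2 = 0 by jlam2 j b1 b1 b2 b1 b2 b1 4.
have E3 : l3 = 0 by jlam2 j b1 b1 b3 b1 b3 b1 4.
rewrite {}E1 {}E2 {}E3 in j *.
have hl : lvals l1 by apply: lvalsP; jlam j b1 b1 b1 1.
exact: E10_classified.
Qed.

Lemma F4_case (r s l1 l2 l3 : K) :
  jordan (Alg b1 (vscale h b2) o (Vec r 0 s) o b3 (Vec l1 l2 l3)) ->
  classified (Alg b1 (vscale h b2) o (Vec r 0 s) o b3 (Vec l1 l2 l3)).
Proof.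
move=> j.
have E1 : r = 0 by apply: (@exp0 1); jor j v1 b2 b2 b2 b2 (- 2 / 3).
rewrite {}E1 in j *.
have E2 : s = 0 by apply: (@exp0 1); jor j v3 b2 b2 b2 b2 (- 1 / 3).
have E3 : l2 = 0 by jlam2 j b1 b1 b2 b1 b2 b1 4.
rewrite {}E2 {}E3 in j *.
have h1 : lvals l1 by apply: lvalsP; jlam j b1 b1 b1 1.
have h3 : lvals l3 by apply: lvalsP; jlam j b3 b3 b3 1.
(* Two orthogonal idempotents on which [lam] does not vanish both have [lam] equal to 1/2. *)
have e1 : l1 * l3 * (1 - 2 * l1) = 0 by jlam j b1 b3 b1 (-1).
have e3 : l1 * l3 * (1 - 2 * l3) = 0 by jlam j b3 b1 b3 (-1).
rewrite (_ : Vec 0 0 0 = o) //; apply: E4_classified => //.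
have [->|l10] := eqVneq l1 0; first exact: Or31.
have [->|l30] := eqVneq l3 0; first exact: Or32.
have hh (l : K) : 1 - 2 * l = 0 -> l = h by move=> e; apply: (lin1 (k := - h) e); fld.
move/eqP: e1; move/eqP: e3; rewrite !mulf_eq0 (negPf l10) (negPf l30) /=.
by move=> /eqP /hh -> /eqP /hh ->; exact: Or33.
Qed.

Lemma E5_swap (g l1 l2 : K) : iso (E5 g l1 l2) (E5 g l2 l1).
Proof. by iso_by b2 b1 b3 (-1). Qed.

(** Vanishing of [lam] on associators gives [r * (l1 - l2) = 0]: the algebra with nonzero [b3^2]
    requires [l1 = l2], so the algebras with [b3^2 = 0] and [l1 != l2] are not its limits. *)
Lemma E5_case (r s l1 l2 l3 : K) :
  jordan (Alg b1 o (vscale h b3) b2 (vscale h b3) (Vec r s 0) (Vec l1 l2 l3)) ->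
  classified (Alg b1 o (vscale h b3) b2 (vscale h b3) (Vec r s 0) (Vec l1 l2 l3)).
Proof.
move=> j.
have E1 : s = r.
  apply/eqP; rewrite -subr_eq0; apply/eqP; apply: (@exp0 1).
  (* The two coordinates are multiples of [r * (s - r)] and [s * (r - s)]; together they give
     [(s - r) ^+ 2]. *)
  refine (@lin2 (- 2 / 3) (- 2 / 3) _ _ _ _ _ _ (congr1 v1 (jordan_left j b3 b3 b3 b3))
    (congr1 v2 (jordan_left j b3 b3 b3 b3)) _).
  by rewrite ?amul_b1 ?amul_b2 ?amul_b3; unf; fld.
have E3 : l3 = 0 by jlam2 j b1 b1 b3 b1 b3 b1 4.
rewrite {}E1 {}E3 in j *.
have h1 : lvals l1 by apply: lvalsP; jlam j b1 b1 b1 1.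
have h2 : lvals l2 by apply: lvalsP; jlam j b2 b2 b2 1.
have e1 : l1 * l2 * (1 - 2 * l1) = 0 by jlam j b1 b2 b1 (-1).
have e2 : l1 * l2 * (1 - 2 * l2) = 0 by jlam j b2 b1 b2 (-1).
have e3 : r * (l1 - l2) = 0 by jlam2 j b3 b3 b1 b3 b1 b3 2.
have hh (l : K) : 1 - 2 * l = 0 -> l = h by move=> e; apply: (lin1 (k := - h) e); fld.
have off l : lvals l -> l != 0 -> classified (E5 0 l 0).
  case=> -> ln; [by rewrite eqxx in ln|apply: E5_off_classified; by [left|right]..].
have [E|l12] := eqVneq l1 l2.
  rewrite -E in e1 *; apply: E5_diag_classified.
  have [->|l10] := eqVneq l1 0; [by left|right].
  by apply: hh; move/eqP: e1; rewrite !mulf_eq0 (negPf l10) /= => /eqP.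
move/eqP: e3; rewrite mulf_eq0 subr_eq0 (negPf l12) orbF => /eqP ->.
have [l10|l10] := eqVneq l1 0.
  rewrite l10 eq_sym in l12 *; apply: classified_iso (off l2 h2 l12); exact: E5_swap.
have [->|l20] := eqVneq l2 0; first exact: off.
move/eqP: e1; move/eqP: e2; rewrite !mulf_eq0 (negPf l10) (negPf l20) /=.
by move=> /eqP /hh e2 /eqP /hh e1; rewrite e1 e2 eqxx in l12.
Qed.

Lemma case_h0 (a1 a2 a3 c1 c2 c3 d1 d2 d3 l1 l2 l3 : K) :
  let E := Alg b1 (vscale h b2) o (Vec a1 a2 a3) (Vec c1 c2 c3)
    (Vec d1 d2 d3) (Vec l1 l2 l3) in
  jordan E -> classified E.
Proof.
move=> E j; rewrite {}/E in j *.
have E1 : a2 = 0 by jor j v2 b1 b2 b1 b2 (-4).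
have E2 : c1 = 0 by jor j v1 b1 b2 b1 b3 4.
have E3 : c3 = 0 by jor j v3 b1 b2 b1 b3 4.
have E4 : d1 = 0 by jor j v1 b1 b3 b3 b1 (-1).
have E5 : d2 = 0 by jor j v2 b1 b3 b1 b3 (-4).
rewrite {}E1 {}E2 {}E3 {}E4 {}E5 in j *.
(* The vector [b3] spans the zero space, with [b3^2 = d3 b3], and acts on [b2] as [c2]. If [d3] is
   nonzero, the idempotent [b3 / d3] acts on [b2] as 0 or 1/2, leading to [E4] or [E5]; otherwise
   [b3] is nilpotent. *)
have ek : c2 * (2 * c2 - d3) = 0 by jor j v2 b3 b3 b1 b2 2.
have [d30|d30] := eqVneq d3 0.
  rewrite {}d30 in j ek *.
  have E1 : c2 = 0 by apply: (@exp0 1); apply: (lin1 (k := h) ek); fld.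
  rewrite {}E1 in j ek *.
  have E1 : a1 = 0 by apply: (@exp0 1); jor j v1 b2 b2 b2 b2 (- 2 / 3).
  have E2 : l2 = 0 by jlam2 j b1 b1 b2 b1 b2 b1 4.
  rewrite {}E1 {}E2 in j *.
  have E1 : l3 = 0 by apply: (@exp0 2); jlam j b3 b3 b3 h.
  rewrite {}E1 in j *.
  have hl : lvals l1 by apply: lvalsP; jlam j b1 b1 b1 1.
  apply: (@classified_iso _ _ _ _ (E11 a3 l1)); last exact: E11_classified.
  by apply: iso_eq; congr Alg; apply: vecP; rewrite /=; ring.
have [c20|c20] := eqVneq c2 0.
  rewrite {}c20 in j *.
  have i : iso (Alg b1 (vscale h b2) o (Vec a1 0 a3) o (Vec 0 0 d3) (Vec l1 l2 l3))
     (Alg b1 (vscale h b2) o (Vec a1 0 (a3 * d3)) o b3 (Vec l1 l2 (l3 / d3))).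
    by iso_by b1 b2 (Vec 0 0 d3^-1) (d3^-1).
  exact: classified_iso i (F4_case (jordan_iso i j)).
have E1 : d3 = 2 * c2.
  apply/eqP; rewrite eq_sym -subr_eq0; move/eqP: ek.
  by rewrite mulf_eq0 (negPf c20).
rewrite {}E1 {ek d30} in j *.
have i : iso (Alg b1 (vscale h b2) o (Vec a1 0 a3) (Vec 0 c2 0) (Vec 0 0 (2 * c2))
    (Vec l1 l2 l3))
   (Alg b1 o (vscale h b3) b2 (vscale h b3) (Vec a1 (a3 * (2 * c2)) 0)
     (Vec l1 (l3 / (2 * c2)) l2)).
  by iso_by b1 (Vec 0 0 (2 * c2)^-1) b2 (- (2 * c2)^-1).
exact: classified_iso i (E5_case (jordan_iso i j)).
Qed.
Lemma case_1h_centered (a1 k d1 d2 l1 l2 l3 : K) :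
  let E := Alg b1 b2 (vscale h b3) (Vec a1 0 0) (Vec 0 0 k)
    (Vec d1 d2 0) (Vec l1 l2 l3) in
  jordan E -> classified E.
Proof.
move=> E j; rewrite {}/E in j *.
have E1 : a1 = 4 * k ^+ 2 by jor j v3 b2 b2 b1 b3 4.
have E3 : l3 = 0 by jlam2 j b1 b1 b3 b1 b3 b1 4.
rewrite {}E1 {}E3 in j *.
have [k0|k0] := eqVneq k 0.
  rewrite {}k0 in j *.
  have E1 : d1 = 0 by apply: (@exp0 1); jor j v1 b3 b3 b3 b3 (- 2 / 3).
  rewrite {}E1 in j *.
  have E1 : l2 = 0 by apply: (@exp0 2); jlam j b2 b2 b2 h.
  rewrite {}E1 in j *.
  have hl : lvals l1 by apply: lvalsP; jlam j b1 b1 b1 1.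
  apply: (@classified_iso _ _ _ _ (E8 d2 l1)); last exact: E8_classified.
  by iso_by b1 b3 b2 (-1).
have i : iso (Alg b1 b2 (vscale h b3) (Vec (4 * k ^+ 2) 0 0) (Vec 0 0 k)
    (Vec d1 d2 0) (Vec l1 l2 0))
  (Alg b1 (vscale h b2) o (Vec (d1 + 2 * k * d2) 0 (d1 - 2 * k * d2)) o b3
   (Vec (h * l1 + (4 * k)^-1 * l2) 0 (h * l1 - (4 * k)^-1 * l2))).
  (* As [b2^2 = 4 k^2 b1], the vectors [(b1 + b2 / (2 k)) / 2] and [(b1 - b2 / (2 k)) / 2] are
     orthogonal idempotents; the first acts on [b3] as 1/2 and the second kills it. *)
  by iso_by (Vec h (4 * k)^-1 0) b3 (Vec h (- (4 * k)^-1) 0) ((4 * k)^-1).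
exact: classified_iso i (F4_case (jordan_iso i j)).
Qed.

Lemma case_1h (a1 a2 a3 c1 c2 c3 d1 d2 d3 l1 l2 l3 : K) :
  let E := Alg b1 b2 (vscale h b3) (Vec a1 a2 a3) (Vec c1 c2 c3)
    (Vec d1 d2 d3) (Vec l1 l2 l3) in
  jordan E -> classified E.
Proof.
move=> E j; rewrite {}/E in j *.
have E1 : a3 = 0 by jor j v3 b1 b2 b1 b2 (-4).
have E2 : d3 = 0 by jor j v3 b1 b3 b1 b3 (-4).
have E3 : c1 = 0 by jor j v1 b1 b2 b1 b3 4.
have E4 : c2 = 0 by jor j v2 b1 b2 b1 b3 4.
rewrite {}E1 {}E2 {}E3 {}E4 in j *.
have i : iso (Alg b1 b2 (vscale h b3) (Vec a1 a2 0) (Vec 0 0 c3) (Vec d1 d2 0)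
    (Vec l1 l2 l3))
  (Alg b1 b2 (vscale h b3) (Vec (a1 + a2 ^+ 2 / 4) 0 0) (Vec 0 0 (c3 - a2 / 4))
    (Vec (d1 + d2 * a2 / 2) d2 0) (Vec l1 (l2 - l1 * a2 / 2) l3)).
  (* Completing the square in the unital algebra spanned by [b1] and [b2]. *)
  by iso_by b1 (Vec (- a2 / 2) 1 0) b3 1.
exact: classified_iso i (case_1h_centered (jordan_iso i j)).
Qed.

Definition nonmono D := forall x, det3 x (amul D x x) (amul D x (amul D x x)) = 0.

Lemma nonmono_iso D E : iso D E -> nonmono D -> nonmono E.
Proof.
case=> B dB [hm _] hD x; have := hD (app B x); rewrite !hm.
have := detm_comp B (Mat x (amul E x x) (amul E x (amul E x x))).
by rewrite /compm /detm /= => -> /eqP; rewrite mulf_eq0 => /orP[/negPn|/eqP //]; rewrite dB.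
Qed.

Lemma case_00 (a1 a2 a3 c1 c2 c3 d1 d2 d3 l1 l2 l3 : K) :
  let E := Alg b1 o o (Vec a1 a2 a3) (Vec c1 c2 c3) (Vec d1 d2 d3) (Vec l1 l2 l3) in
  jordan E -> nonmono E -> classified E.
Proof.
move=> E j H; rewrite {}/E in j H *.
have E1 : a1 = 0 by jor j v1 b1 b2 b2 b1 (-1).
have E2 : c1 = 0 by jor j v1 b1 b2 b3 b1 (-1).
have E3 : d1 = 0 by jor j v1 b1 b3 b3 b1 (-1).
rewrite {}E1 {}E2 {}E3 in j H *.
have H2 (y z : K) : y * (y ^+ 2 * a3 + 2 * (y * z) * c3 + z ^+ 2 * d3)
   - z * (y ^+ 2 * a2 + 2 * (y * z) * c2 + z ^+ 2 * d2) = 0.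
  have := H; rewrite /nonmono; set D := Alg _ _ _ _ _ _ _ => {}H.
  pose f s := det3 (Vec s y z) (amul D (Vec s y z) (Vec s y z))
    (amul D (Vec s y z) (amul D (Vec s y z) (Vec s y z))).
  (* With [w = y b2 + z b3], [f] is a combination of [s], [s^2] and [s^3]; this expression is six
     times the coefficient of [s^3], the determinant of [w] and [w^2] in the zero space. Hence [w^2]
     is always a multiple of [w]. *)
  have f0 : f 2 - 3 * f 1 - f (-1) = 0 by rewrite /f !H; ring.
  by apply: (lin1 (k := 6^-1) f0); rewrite /f /D; unf; fld.
have E1 : a3 = 0 by apply: (lin1 (k := 1) (H2 1 0)); ring.
have E2 : d2 = 0 by apply: (lin1 (k := -1) (H2 0 1)); ring.
rewrite {}E1 {}E2 in j H H2 *.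
have E3 : a2 = 2 * c3 by apply: (lin2 (k := - h) (k' := h) (H2 1 1) (H2 1 (-1))); fld.
have E4 : d3 = 2 * c2 by apply: (lin2 (k := h) (k' := h) (H2 1 1) (H2 1 (-1))); fld.
rewrite {}E3 {}E4 {H H2} in j *.
(* Now [w^2 = 2 ell(w) w] for the linear form [ell] with values [c3], [c2] on [b2], [b3]. If it is
   nonzero, there is an idempotent in the zero space, acting as 1/2 on the kernel of [ell]. *)
have [c30|c30] := eqVneq c3 0; last first.
  have i : iso (Alg b1 o o (Vec 0 (2 * c3) 0) (Vec 0 c2 c3) (Vec 0 0 (2 * c2))
     (Vec l1 l2 l3))
   (Alg b1 (vscale h b2) o (Vec 0 0 0) o b3
    (Vec (l2 / (2 * c3)) (2 * c2 * l2 - 2 * c3 * l3) l1)).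
    by iso_by (Vec 0 (2 * c3)^-1 0) (Vec 0 (2 * c2) (- (2 * c3))) b1 (-1).
  exact: classified_iso i (F4_case (jordan_iso i j)).
rewrite {}c30 in j *; have [c20|c20] := eqVneq c2 0; last first.
  have i : iso (Alg b1 o o (Vec 0 (2 * 0) 0) (Vec 0 c2 0) (Vec 0 0 (2 * c2))
     (Vec l1 l2 l3))
   (Alg b1 (vscale h b2) o (Vec 0 0 0) o b3 (Vec (l3 / (2 * c2)) l2 l1)).
    by iso_by (Vec 0 0 (2 * c2)^-1) b2 b1 (- (2 * c2)^-1).
  exact: classified_iso i (F4_case (jordan_iso i j)).
rewrite {}c20 in j *.
have E1 : l2 = 0 by apply: (@exp0 2); jlam j b2 b2 b2 h.
have E2 : l3 = 0 by apply: (@exp0 2); jlam j b3 b3 b3 h.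
rewrite {}E1 {}E2 in j *.
have hl : lvals l1 by apply: lvalsP; jlam j b1 b1 b1 1.
apply: (@classified_iso _ _ _ _ (Z0 l1)); last exact: Z0_classified.
by apply: iso_eq; congr Alg; apply: vecP; rewrite /=; ring.
Qed.

(** The algebra is the direct sum of the unital algebra on [b1], [b2] and the line of [b3], each
    generated by one element; a general element then generates the whole. *)
Lemma case_10 (a1 a2 a3 c1 c2 c3 d1 d2 d3 l1 l2 l3 : K) :
  let E := Alg b1 b2 o (Vec a1 a2 a3) (Vec c1 c2 c3) (Vec d1 d2 d3) (Vec l1 l2 l3) in
  jordan E -> ~ nonmono E.
Proof.
move=> E j H; rewrite {}/E in j H *.
have E1 : a3 = 0 by jor j v3 b1 b2 b2 b1 (-1).
have E2 : c1 = 0 by jor j v1 b1 b2 b1 b3 1.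
have E3 : c2 = 0 by jor j v2 b1 b2 b1 b3 1.
have E4 : c3 = 0 by jor j v3 b1 b2 b1 b3 1.
have E5 : d1 = 0 by jor j v1 b1 b3 b3 b1 (-1).
have E6 : d2 = 0 by jor j v2 b1 b3 b3 b1 (-1).
rewrite {}E1 {}E2 {}E3 {}E4 {}E5 {}E6 {j} in H.
pose f s : K := (s ^+ 2 + s * a2 - a1) * (s ^+ 2 + s * a2 - a1 - d3 * (2 * s + a2) + d3 ^+ 2).
have f0 s : f s = 0 by apply: (lin1 (k := 1) (H (Vec s 1 1))); rewrite /f; unf; ring.
(* The fourth difference of the monic quartic [f] is [4!]. *)
have /eqP : (24 : K) = 0.
  rewrite (_ : 24 = f 4 - 4 * f 3 + 6 * f 2 - 4 * f 1 + f 0); last by rewrite /f; ring.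
  by rewrite !f0; ring.
by rewrite pnatr_eq0.
Qed.

(** This is the Jordan algebra of the symmetric form with matrix [a, c; c, d]. A square root of the
    unit proportional to [b2] gives two orthogonal idempotents, and the orthogonal complement of
    [b2] lies in the half spaces of both. *)
Lemma spin_case_nz (a c d l1 l2 l3 : K) : a != 0 ->
  let E := Alg b1 b2 b3 (Vec a 0 0) (Vec c 0 0) (Vec d 0 0) (Vec l1 l2 l3) in
  jordan E -> classified E.
Proof.
move=> a0 E j; rewrite {}/E in j *.
have r2 : sqrtC a ^+ 2 = a by exact: sqrtCK.
have r0 : sqrtC a != 0 by rewrite -sqrf_eq0 r2.
rewrite -{}r2 {a0} in j *; move: (sqrtC a) r0 j => r r0 j.
have i : iso (Alg b1 b2 b3 (Vec (r ^+ 2) 0 0) (Vec c 0 0) (Vec d 0 0) (Vec l1 l2 l3))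
  (Alg b1 o (vscale h b3) b2 (vscale h b3)
    (Vec (d - c ^+ 2 / r ^+ 2) (d - c ^+ 2 / r ^+ 2) 0)
   (Vec (h * l1 + (2 * r)^-1 * l2) (h * l1 - (2 * r)^-1 * l2) (l3 - c / r ^+ 2 * l2))).
  by iso_by (Vec h (2 * r)^-1 0) (Vec h (- (2 * r)^-1) 0) (Vec 0 (- c / r ^+ 2) 1) (- (2 * r)^-1).
exact: classified_iso i (E5_case (jordan_iso i j)).
Qed.

(** A nonzero form takes a nonzero value at [b2], [b3] or [b2 + b3]; the zero form gives [U0]. *)
Lemma spin_case (a c d l1 l2 l3 : K) :
  let E := Alg b1 b2 b3 (Vec a 0 0) (Vec c 0 0) (Vec d 0 0) (Vec l1 l2 l3) in
  jordan E -> classified E.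
Proof.
move=> E j; rewrite {}/E in j *.
have [a0|a0] := eqVneq a 0; last exact: spin_case_nz.
have [d0|d0] := eqVneq d 0; last first.
  have i : iso (Alg b1 b2 b3 (Vec a 0 0) (Vec c 0 0) (Vec d 0 0) (Vec l1 l2 l3))
    (Alg b1 b2 b3 (Vec d 0 0) (Vec c 0 0) (Vec a 0 0) (Vec l1 l3 l2)).
    by iso_by b1 b3 b2 (-1).
  exact: classified_iso i (spin_case_nz d0 (jordan_iso i j)).
rewrite {}a0 {}d0 in j *; have [c0|c0] := eqVneq c 0; last first.
  have i : iso (Alg b1 b2 b3 (Vec 0 0 0) (Vec c 0 0) (Vec 0 0 0) (Vec l1 l2 l3))
    (Alg b1 b2 b3 (Vec (2 * c) 0 0) (Vec c 0 0) (Vec 0 0 0) (Vec l1 (l2 + l3) l3)).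
    by iso_by b1 (Vec 0 1 1) b3 1.
  have c2 : 2 * c != 0 by rewrite mulf_neq0 ?pnatr_eq0.
  exact: classified_iso i (spin_case_nz c2 (jordan_iso i j)).
rewrite {}c0 in j *.
have E1 : l2 = 0 by apply: (@exp0 2); jlam j b2 b2 b2 h.
have E2 : l3 = 0 by apply: (@exp0 2); jlam j b3 b3 b3 h.
rewrite {}E1 {}E2 in j *.
have hl : lvals l1 by apply: lvalsP; jlam j b1 b1 b1 1.
exact: U0_classified.
Qed.

Lemma case_11 (a1 a2 a3 c1 c2 c3 d1 d2 d3 l1 l2 l3 : K) :
  let E := Alg b1 b2 b3 (Vec a1 a2 a3) (Vec c1 c2 c3) (Vec d1 d2 d3) (Vec l1 l2 l3) in
  jordan E -> nonmono E -> classified E.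
Proof.
move=> E j H; rewrite {}/E in j H *.
have H2 (y z : K) : y * (y ^+ 2 * a3 + 2 * (y * z) * c3 + z ^+ 2 * d3)
   - z * (y ^+ 2 * a2 + 2 * (y * z) * c2 + z ^+ 2 * d2) = 0.
  have := H; rewrite /nonmono; set D := Alg _ _ _ _ _ _ _ => {}H.
  pose f s := det3 (Vec s y z) (amul D (Vec s y z) (Vec s y z))
    (amul D (Vec s y z) (amul D (Vec s y z) (Vec s y z))).
  (* The third difference of the cubic [f] is six times its leading coefficient, the determinant of
     [w] and [w^2] modulo the unit. *)
  have f0 : f 3 - 3 * f 2 + 3 * f 1 - f 0 = 0.
    by rewrite /f !H; ring.
  by apply: (lin1 (k := 6^-1) f0); rewrite /f /D; unf; fld.
have E1 : a3 = 0 by apply: (lin1 (k := 1) (H2 1 0)); ring.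
have E2 : d2 = 0 by apply: (lin1 (k := -1) (H2 0 1)); ring.
rewrite {}E1 {}E2 in j H H2 *.
have E3 : a2 = 2 * c3 by apply: (lin2 (k := - h) (k' := h) (H2 1 1) (H2 1 (-1))); fld.
have E4 : d3 = 2 * c2 by apply: (lin2 (k := h) (k' := h) (H2 1 1) (H2 1 (-1))); fld.
rewrite {}E3 {}E4 {H H2} in j *.
have i : iso (Alg b1 b2 b3 (Vec a1 (2 * c3) 0) (Vec c1 c2 c3) (Vec d1 0 (2 * c2))
   (Vec l1 l2 l3))
  (Alg b1 b2 b3 (Vec (a1 + c3 ^+ 2) 0 0) (Vec (c1 + c2 * c3) 0 0) (Vec (d1 + c2 ^+ 2) 0 0)
   (Vec l1 (l2 - c3 * l1) (l3 - c2 * l1))).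
  (* Subtracting multiples of the unit removes the linear term of [w^2] and leaves a quadratic
     form. *)
  by iso_by b1 (Vec (- c3) 1 0) (Vec (- c2) 0 1) 1.
exact: classified_iso i (spin_case (jordan_iso i j)).
Qed.

(** * Choosing a basis: powers, idempotents, nil algebras *)

Lemma iso_change D B : detm B != 0 -> iso D (trans (invm B) B D).
Proof.
by move=> dB; exists B => //; split=> *; rewrite ?amul_trans ?lam_trans ?invmK.
Qed.

Lemma vscale_eq0 (a : K) x : a != 0 -> vscale a x = o -> x = o.
Proof. by move=> a0 e; rewrite -(scale1v x) -(mulVf a0) -scalevA e; apply: vecP => /=; ring. Qed.

Lemma det3_dep x y z : det3 x y z = 0 -> exists a b c,
  [\/ a != 0, b != 0 | c != 0] /\ vadd (vscale a x) (vadd (vscale b y) (vscale c z)) = o.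
Proof.
move=> d0; have : \det (mx_of (Mat x y z)) == 0.
  apply: contraT => dn; have u : mx_of (Mat x y z) \in unitmx by rewrite unitmxE unitfE.
  by have := detm_of_mx u; rewrite mx_ofK /detm d0 eqxx.
move=> /det0P [v v0 /rowP hv].
exists (v 0 (@Ordinal 3 0 isT)), (v 0 (@Ordinal 3 1 isT)), (v 0 (@Ordinal 3 2 isT)).
split.
  have [e0|] := eqVneq (v 0 (@Ordinal 3 0 isT)) 0; last by move=> ?; apply: Or31.
  have [e1|] := eqVneq (v 0 (@Ordinal 3 1 isT)) 0; last by move=> ?; apply: Or32.
  apply: Or33; apply: contraNneq v0 => e2; apply/eqP/rowP.
  by elim/ord3P; rewrite mxE.
have := (hv (@Ordinal 3 0 isT), hv (@Ordinal 3 1 isT), hv (@Ordinal 3 2 isT)).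
rewrite !mxE !sum_ord3 !mxE /= => -[[h1 h2] h3].
by apply: vecP; rewrite /= ?h1 ?h2 ?h3.
Qed.

Lemma complete1 x : x <> o -> exists y z, det3 x y z != 0.
Proof.
move=> x0; have [e1|n1] := eqVneq (v1 x) 0; last first.
  by exists b2, b3; rewrite (_ : det3 _ _ _ = v1 x) //; rewrite /det3 /=; ring.
have [e2|n2] := eqVneq (v2 x) 0; last first.
  exists b1, b3; rewrite (_ : det3 _ _ _ = - v2 x) ?oppr_eq0 //; rewrite /det3 /=; ring.
have [e3|n3] := eqVneq (v3 x) 0; first by case: x0; apply: vecP.
by exists b1, b2; rewrite (_ : det3 _ _ _ = v3 x) //; rewrite /det3 /=; ring.
Qed.

Lemma complete2 x y : (forall k, x <> vscale k y) -> y <> o -> exists z, det3 x y z != 0.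
Proof.
move=> xy y0; pose d z := det3 x y z.
have [e1|n1] := eqVneq (d b1) 0; last by exists b1.
have [e2|n2] := eqVneq (d b2) 0; last by exists b2.
have [e3|n3] := eqVneq (d b3) 0; last by exists b3.
have E1 : v2 x * v3 y = v3 x * v2 y by apply: (lin1 (k := 1) e1); rewrite /d /det3 /=; ring.
have E2 : v1 x * v3 y = v3 x * v1 y by apply: (lin1 (k := -1) e2); rewrite /d /det3 /=; ring.
have E3 : v1 x * v2 y = v2 x * v1 y by apply: (lin1 (k := 1) e3); rewrite /d /det3 /=; ring.
have [z1|n1] := eqVneq (v1 y) 0; last first.
  case: (xy (v1 x / v1 y)); apply: vecP; rewrite /=; first by rewrite mulfVK.
    by rewrite mulrAC E3 mulfK.
  by rewrite mulrAC E2 mulfK.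
have [z2|n2] := eqVneq (v2 y) 0; last first.
  case: (xy (v2 x / v2 y)); apply: vecP; rewrite /=; last by rewrite mulrAC E1 mulfK.
    by rewrite mulrAC -E3 mulfK.
  by rewrite mulfVK.
have [z3|n3] := eqVneq (v3 y) 0; first by case: y0; apply: vecP.
case: (xy (v3 x / v3 y)); apply: vecP; rewrite /=; last by rewrite mulfVK.
  by rewrite mulrAC -E2 mulfK.
by rewrite mulrAC -E1 mulfK.
Qed.

Lemma vadd3I x y : vadd x (vadd x x) = vadd y (vadd y y) -> x = y.
Proof.
move=> e; apply: vecP;
  [have := congr1 v1 e|have := congr1 v2 e|have := congr1 v3 e];
  by rewrite /= => {}e; apply: (lin1 (k := 3^-1) e); fld.
Qed.

Section Powers.
Variables (D : alg K) (j : jordan D) (x : vec K).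
Let m := amul D.
Let x2 := m x x.
Let x3 := m x x2.
Let x4 := m x x3.
Let x5 := m x x4.
(** Power-associativity up to degree six, which is what the table of [Mono3] involves. The identity
    at four equal arguments is three times this equation. *)
Lemma power22 : m x2 x2 = x4.
Proof. by have := jordan_left j x x x x; rewrite -/m -/x2 -/x3 -/x4 => /vadd3I. Qed.
Let mC u v : m u v = m v u. Proof. exact: amulC. Qed.
Lemma power23 : m x2 x3 = x5.
Proof.
have := jordan_left j x2 x x x; rewrite /= -/m (mC x2 x) -/x2 -/x3 -/x4 -/x5 (mC x3 x2).
move: x5 (m x2 x3) => u v e.
coordwise e; apply: (lin1 (k := - h) e); fld.
Qed.
Lemma power33 : m x3 x3 = m x x5.
Proof.
have := jordan_left j x2 x2 x x; have := jordan_left j x3 x x x.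
rewrite /= -/m (mC x3 x) (mC x2 x) -/x2 -/x3 -/x4 -/x5 power22.
rewrite (mC x4 x2) -/x5 -/x4.
move: (m x x5) (m x3 x3) (m x2 x4) => u v w e1 e2.
apply: vecP;
  [have := congr1 v1 e1|have := congr1 v2 e1|have := congr1 v3 e1];
  [have := congr1 v1 e2|have := congr1 v2 e2|have := congr1 v3 e2];
  rewrite [in X in X -> _]/= => {}e2; rewrite [in X in X -> _]/= => {}e1;
  apply: (lin2 (k := - 5^-1) (k' := - (3 / 5)) e1 e2); fld.
Qed.
End Powers.

Lemma idempotent_or_nil D : jordan D -> nonmono D ->
  (exists2 e, e <> o & amul D e e = e) \/ (forall x, amul D x (amul D x x) = o).
Proof.
move=> j H; have [?|nex] := pselect (exists2 e, e <> o & amul D e e = e); first by left.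
right=> x; pose m := amul D; set x2 := amul D x x; set x3 := amul D x x2.
have [//|x30] := pselect (x3 = o); case: nex.
have x20 : x2 <> o by move=> e; apply: x30; rewrite /x3 e; apply: vecP => /=; ring.
have x0 : x <> o by move=> e; apply: x20; rewrite /x2 e; apply: vecP => /=; ring.
have [a [b [c [abc e]]]] := det3_dep (H x); rewrite -/x2 -/x3 in e.
have p22 : amul D x2 x2 = amul D x x3 by exact: power22.
have m0 y : amul D y o = o by apply: vecP => /=; ring.
have [a0|a0] := eqVneq a 0; last first.
  (* The relation becomes [x = x u] with [u = be x + ga x^2], and then also [x^2 u = x^2]; hence
     [u u = u]. *)
  pose be := - (b / a); pose ga := - (c / a).
  have hx : x = vadd (vscale be x2) (vscale ga x3).
    coordwise e; apply: (lin1 (k := a^-1) e); rewrite /be /ga [LHS]/=; fld.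
  pose u := vadd (vscale be x) (vscale ga x2).
  have ux : amul D x u = x by rewrite amulDr !amulZr -/x2 -/x3 -hx.
  have ux2 : amul D x2 u = x2.
    transitivity (amul D x (vadd (vscale be x2) (vscale ga x3))); last by rewrite -hx.
    by rewrite !amulDr !amulZr p22 (amulC D x2 x).
  exists u; first by move=> u0; apply: x0; rewrite -ux u0.
  by rewrite {1}/u amulDl !amulZl ux ux2.
have [b0|b0] := eqVneq b 0.
  case: abc => [| |c0]; rewrite ?a0 ?b0 ?eqxx //; case: x30.
  rewrite a0 b0 in e; coordwise e; apply: (lin1 (k := c^-1) e); rewrite [LHS]/=; fld.
(* Here [x^2 = ga x^3], so [ga x^4 = x^3] and [ga^2 x^2] is idempotent. *)
pose ga := - (c / b).
have hx : x2 = vscale ga x3.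
  rewrite a0 in e; coordwise e; apply: (lin1 (k := b^-1) e); rewrite /ga [LHS]/=; fld.
exists (vscale (ga ^+ 2) x2).
  move=> u0; apply: (x20); apply: vscale_eq0 u0.
  by rewrite expf_neq0 //; apply/eqP => g0; apply: (x20); rewrite hx g0; apply: vecP => /=; ring.
have g4 : vscale ga (amul D x x3) = x3 by rewrite -amulZr -hx.
rewrite amulZl amulZr p22 scalevA -exprD (_ : 2 + 2 = 3 + 1)%N // exprD -scalevA expr1 g4.
by rewrite [in RHS]hx scalevA -exprSr.
Qed.

Lemma nil_normal (a1 a2 a3 c1 c2 c3 d1 d2 d3 l1 l2 l3 : K) :
  let E := Alg b2 o (Vec a1 a2 a3) o (Vec c1 c2 c3) (Vec d1 d2 d3) (Vec l1 l2 l3) in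
  jordan E -> (forall x, amul E x (amul E x x) = o) -> classified E.
Proof.
move=> E j nil; rewrite {}/E in j nil *.
have := nil; set D := Alg _ _ _ _ _ _ _ => {}nil.
pose N y := amul D y (amul D y y).
(* As a function of [t], the cube of [b3 + t b1] is polynomial. Its values at 1 and -1 give the
   coefficient of [t^2] here; in [odd] they give that of [t], because [b1^3 = 0]. *)
have even (p : vec K -> K) : p o = 0 ->
   h * (p (N (Vec 1 0 1)) + p (N (Vec (-1) 0 1))) - p (N b3) = 0.
  by move=> p0; rewrite /N !nil p0 subr0 addr0 mulr0.
have odd (p : vec K -> K) : p o = 0 ->
   h * (p (N (Vec 1 0 1)) - p (N (Vec (-1) 0 1))) = 0.
  by move=> p0; rewrite /N !nil p0 subrr mulr0.
have E1 : c1 = - (2 * a1 * a3).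
  by apply: (lin1 (k := 1) (even v1 erefl)); rewrite /N /D; unf; fld.
have E2 : c2 = - (2 * (a1 + a2 * a3)).
  by apply: (lin1 (k := 1) (even v2 erefl)); rewrite /N /D; unf; fld.
have E3 : c3 = - (2 * a3 ^+ 2).
  by apply: (lin1 (k := 1) (even v3 erefl)); rewrite /N /D; unf; fld.
have E4 : a3 = 0.
  apply: (@exp0 2).
  apply: (lin2 (k := 8^-1) (k' := 3 / 8 * a3) (congr1 v3 (jordan_left j b1 b1 b1 b3)) E3).
  by rewrite ?amul_b1 ?amul_b2 ?amul_b3; unf; fld.
have {}E1 : c1 = 0 by rewrite E1 E4 mulr0 oppr0.
have {}E2 : c2 = - (2 * a1) by rewrite E2 E4 mulr0 addr0.
have {}E3 : c3 = 0 by rewrite E3 E4 expr2 !mulr0 oppr0.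
rewrite /N /D in odd; rewrite /D in nil *; clear even; clear N; clear D.
rewrite {}E1 {}E2 {}E3 {}E4 in j nil odd *.
have E5 : d3 = 0.
  apply: (@exp0 1); apply: (lin1 (k := 1) (congr1 v3 (nil b3))).
  by rewrite !amul_b3; unf; fld.
rewrite {}E5 in j nil odd *.
have E1 : a1 = 0 by apply: (@exp0 2); jor j v2 b3 b3 b3 b2 (- 16^-1).
rewrite {}E1 in j nil odd *.
have E1 : d1 = 0.
  by apply: (lin1 (k := 1) (odd v2 erefl)); unf; fld.
rewrite {}E1 {nil odd} in j *.
have i : iso (Alg b2 o (Vec 0 a2 0) o (Vec 0 (- (2 * 0)) 0) (Vec 0 d2 0) (Vec l1 l2 l3))
   (Alg b2 o o o o (Vec 0 (d2 - a2 ^+ 2) 0) (Vec l1 l2 (l3 - a2 * l1))).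
  (* The products of [b1] and [b3] lie on the line of [b2], and this diagonalizes the resulting
     form. *)
  by iso_by b1 b2 (Vec (- a2) 0 1) 1.
have {}j := jordan_iso i j; apply: classified_iso i _; move: j.
move: (l3 - _) (d2 - _) => m g j.
have e1 : l2 * (l2 - 2 * l1 ^+ 2) = 0 by jlam j b2 b1 b1 (-1).
have e2 : 3 * l1 * l2 - 2 * l1 ^+ 3 = 0 by jlam j b1 b1 b1 (-1).
have [l20 l10] : l2 = 0 /\ l1 = 0.
  move/eqP: e1; rewrite mulf_eq0 => /orP[/eqP l20|]; last rewrite subr_eq0 => /eqP E.
    by split=> //; apply: (@exp0 2); apply: (lin1 (k := - h) e2); rewrite l20; fld.
  have l10 : l1 = 0 by apply: (@exp0 2); apply: (lin1 (k := 4^-1) e2); rewrite E; fld.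
  by rewrite E l10 expr2 !mulr0.
rewrite {}l20 {}l10 in j *.
have m0 : m = 0 by apply: (@exp0 2); jlam j b3 b3 b3 h.
rewrite {}m0.
have [->|g0] := eqVneq g 0.
  by rewrite (_ : Vec 0 0 0 = o) //; apply: N_classified; apply: Or32.
apply: (@classified_iso _ _ _ _ N2); last by apply: N_classified; apply: Or33.
have r2 : sqrtC (- g) ^+ 2 = - g by exact: sqrtCK.
have r0 : sqrtC (- g) != 0 by rewrite -sqrf_eq0 r2 oppr_eq0.
have -> : g = - sqrtC (- g) ^+ 2 by rewrite r2 opprK.
move: (sqrtC (- g)) r0 => r r0.
(* Since [b3^2 = - r^2 b2], the vectors [b1 + b3 / r] and [b1 - b3 / r] have square zero and product
   [2 b2]. *)
by iso_by (Vec 1 0 r^-1) (Vec 1 0 (- r^-1)) (Vec 0 2 0) (4 * r^-1).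
Qed.

Lemma nil_case D : jordan D -> (forall x, amul D x (amul D x x) = o) -> classified D.
Proof.
move=> j nil; have [sq|/existsNP [x x20]] := pselect (forall x, amul D x x = o).
  have pol x y : amul D x y = o.
    have e := sq (vadd x y).
    rewrite amulDl !amulDr !sq (amulC D y x) in e.
    apply: vecP; [have := congr1 v1 e|have := congr1 v2 e|have := congr1 v3 e];
    by move: (amul D x y) => u; rewrite [in X in X -> _]/= => {}e;
      apply: (lin1 (k := h) e); rewrite [LHS]/=; fld.
  have -> : D = N0.
    apply: alg_ext => [x y|x].
      by rewrite pol; apply: vecP => /=; ring.
    rewrite (_ : lam N0 x = 0); last by rewrite /lam /=; ring.
    apply: (@exp0 2); have := jordan_lam j x x x.
    have lam0 E : lam E o = 0 by rewrite /lam /=; ring.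
    rewrite /= !pol lam0 => e.
    apply: (lin1 (k := h) e); move: (lam D x) => l; fld.
  by apply: N_classified; apply: Or31.
set z := amul D x x in x20.
have xz : amul D x z = o by exact: nil.
have zz : amul D z z = o.
  by rewrite power22 // -/z xz; apply: vecP => /=; ring.
have [y yb] : exists y, det3 x z y != 0.
  apply: complete2 => // k xk; apply: x20.
  rewrite /z xk amulZl amulZr zz; apply: vecP => /=; ring.
set B := Mat x z y; have dB : detm B != 0 by [].
have i := iso_change D dB; set E := trans _ _ _ in i.
have hE u : app (invm B) (app B u) = u by exact: invmKV.
have E11 : p11 E = b2 by rewrite /E /= -/z -[z]/(r2 B) -app_b2 hE.
have E12 : p12 E = o by rewrite /E /= xz; apply: vecP => /=; ring.
have E22 : p22 E = o by rewrite /E /= zz; apply: vecP => /=; ring.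
apply: (classified_iso i); move: (jordan_iso i j).
have nilE u : amul E u (amul E u u) = o.
  by rewrite !amul_trans invmK // nil; apply: vecP => /=; ring.
move: E11 E12 E22 nilE; clear i; move: E => [? ? [? ? ?] ? [? ? ?] [? ? ?] [? ? ?]] /=.
by move=> -> -> -> nilE jE; apply: nil_normal.
Qed.

(** The identity makes [2 X^3 - 3 X^2 + X] annihilate [L_e], so each vector is a sum of three
    eigenvectors. Decomposing [y] and [z] in any basis [e], [y], [z] writes its determinant as a sum
    of nine, which cannot all vanish. *)
Lemma peirce_basis D e : jordan D -> amul D e e = e -> e <> o ->
  exists u v y z, [/\ lvals u, lvals v, det3 e y z != 0, amul D e y = vscale u y
    & amul D e z = vscale v z].
Proof.
move=> j ee e0; pose L := amul D e.
have cubic y : vadd (L y) (vscale 2 (L (L (L y)))) = vscale 3 (L (L y)).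
  have := jordan_left j e e e y; rewrite /= !ee -!/(L _) (amulC D y) -/(L _) => E.
  rewrite (amulC D (L y)) -/(L (L y)) in E.
  apply: vecP; [have := congr1 v1 E|have := congr1 v2 E|have := congr1 v3 E];
  move: (L y) (L (L y)) (L (L (L y))) E => a b c _;
  rewrite [in X in X -> _]/= => {}E; apply: (lin1 (k := 1) E); rewrite [LHS]/=; fld.
have [y [z dyz]] := complete1 e0.
have [//|nex] := pselect (exists u v y z, [/\ lvals u, lvals v, det3 e y z != 0,
  amul D e y = vscale u y & amul D e z = vscale v z]).
have det0 u v (p q : vec K) : lvals u -> lvals v -> L p = vscale u p -> L q = vscale v q ->
    det3 e p q = 0.
  by move=> hu hv hp hq; apply/eqP; apply: contraT => d; case: nex; exists u, v, p, q.
(* The projections onto the Peirce spaces, as polynomials in [L e]. *)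
pose P1 y := vsub (vscale 2 (L (L y))) (L y).
pose Ph y := vscale 4 (vsub (L y) (L (L y))).
pose P0 y := vadd y (vsub (vscale 2 (L (L y))) (vscale 3 (L y))).
have L1 x : L (P1 x) = vscale 1 (P1 x).
  move: (cubic x); rewrite /P1 /vsub /L !(amulDr, amulZr) -!/(L _).
  move: (L x) (L (L x)) (L (L (L x))) => a b c E.
  coordwise E; apply: (lin1 (k := 1) E); rewrite /=; fld.
have Lh x : L (Ph x) = vscale h (Ph x).
  move: (cubic x); rewrite /Ph /vsub /L !(amulDr, amulZr) -!/(L _).
  move: (L x) (L (L x)) (L (L (L x))) => a b c E.
  coordwise E; apply: (lin1 (k := -2) E); rewrite /=; fld.
have L0 x : L (P0 x) = vscale 0 (P0 x).
  move: (cubic x); rewrite /P0 /vsub /L !(amulDr, amulZr) -!/(L _).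
  move: (L x) (L (L x)) (L (L (L x))) => a b c E.
  coordwise E; apply: (lin1 (k := 1) E); rewrite /=; fld.
have PE x : x = vadd (P1 x) (vadd (Ph x) (P0 x)).
  by rewrite /P1 /Ph /P0; apply: vecP; rewrite /vsub /vadd /vscale; cbn [v1 v2 v3]; fld.
have v0 : lvals (0 : K) by exact: Or31.
have vv1 : lvals (1 : K) by exact: Or32.
have vh : lvals h by exact: Or33.
case/eqP: dyz; rewrite (PE y) (PE z).
have det_sum a b c a' b' c' : det3 e (vadd a (vadd b c)) (vadd a' (vadd b' c')) =
  det3 e a a' + det3 e a b' + det3 e a c' + (det3 e b a' + det3 e b b' + det3 e b c')
  + (det3 e c a' + det3 e c b' + det3 e c c') by rewrite /det3 /=; ring.
rewrite det_sum (det0 1 1) // (det0 1 h) // (det0 1 0) // (det0 h 1) // (det0 h h) //.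
by rewrite (det0 h 0) // (det0 0 1) // (det0 0 h) // (det0 0 0) // !addr0.
Qed.

Lemma idempotent_case D e : jordan D -> nonmono D -> amul D e e = e -> e <> o ->
  classified D.
Proof.
move=> j H ee e0; have [u [v [y [z [hu hv dyz ey ez]]]]] := peirce_basis j ee e0.
(* The case lemmas cover the pairs of eigenvalues in one order only; exchanging [y] and [z] gives
   the others. *)
have ordered u' v' y' z' : [\/ u' = 1, v' = 0 | u' = h /\ v' = h] -> lvals u' -> lvals v' ->
    det3 e y' z' != 0 -> amul D e y' = vscale u' y' -> amul D e z' = vscale v' z' ->
    classified D.
  move=> huv {}hu {}hv {}dyz {}ey {}ez.
  set B := Mat e y' z'; have dB : detm B != 0 by [].
  have i := iso_change D dB; set E := trans _ _ _ in i.
  have hE w : app (invm B) (app B w) = w by exact: invmKV.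
  have E11 : p11 E = b1 by rewrite /E /= ee -[e]/(r1 B) -app_b1 hE.
  have E12 : p12 E = vscale u' b2 by rewrite /E /= ey appZ -[y']/(r2 B) -app_b2 hE.
  have E13 : p13 E = vscale v' b3 by rewrite /E /= ez appZ -[z']/(r3 B) -app_b3 hE.
  apply: (classified_iso i); move: (jordan_iso i j) (nonmono_iso i H) E11 E12 E13.
  clear i; move: E => [? ? ? [a1 a2 a3] [c1 c2 c3] [d1 d2 d3] [l1 l2 l3]] /= jE HE E11 E12 E13.
  rewrite {}E11 {}E12 {}E13 in jE HE *.
  have s1 w : vscale 1 w = w by exact: scale1v.
  have s0 w : vscale 0 w = o by apply: vecP => /=; ring.
  case: huv => [u1|v0|[uh vh]].
  - case: hv => vE; rewrite u1 vE ?s1 ?s0 in jE HE *.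
    + by case: (case_10 jE).
    + exact: case_11.
    + exact: case_1h.
  - case: hu => uE; rewrite uE v0 ?s1 ?s0 in jE HE *.
    + exact: case_00.
    + by case: (case_10 jE).
    + exact: case_h0.
  - by rewrite uh vh in jE *; exact: case_hh.
have dzy : det3 e z y != 0.
  by rewrite (_ : det3 e z y = - det3 e y z) ?oppr_eq0 //; rewrite /det3; ring.
have flip : [\/ v = 1, u = 0 | u = h /\ v = h] -> classified D.
  move=> hvu; apply: (ordered v u z y) => //;
  by case: hvu => [?|?|[? ?]]; [exact: Or31|exact: Or32|exact: Or33].
have straight : [\/ u = 1, v = 0 | u = h /\ v = h] -> classified D.
  by move=> huv; exact: (ordered u v y z).
case: hu => uE; first by apply: flip; apply: Or32.
  by apply: straight; apply: Or31.
case: hv => vE; first by apply: straight; apply: Or32.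
  by apply: flip; apply: Or31.
by apply: straight; apply: Or33.
Qed.

(** * Algebras generated by one element *)

Lemma quadratic_roots (b c : K) : exists r s, r + s = b /\ r * s = c.
Proof.
pose d := sqrtC (b ^+ 2 - 4 * c); have d2 : d ^+ 2 = b ^+ 2 - 4 * c by exact: sqrtCK.
exists ((b + d) / 2), ((b - d) / 2); split; first fld.
by apply: (lin1 (k := - 4^-1) d2); fld.
Qed.
Lemma cubic_roots (t1 t2 t3 r : K) : r ^+ 3 = t3 * r ^+ 2 + t2 * r + t1 ->
  exists s u, [/\ t1 = r * s * u, t2 = - (r * s + r * u + s * u) & t3 = r + s + u].
Proof.
move=> hr; have [s [u [h1 h2]]] := quadratic_roots (t3 - r) (r ^+ 2 - t3 * r - t2).
exists s, u; split.
- by rewrite -mulrA h2; apply: (lin1 (k := -1) hr); ring.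
- have -> : r * s + r * u + s * u = r * (s + u) + s * u by ring.
  by rewrite h1 h2; ring.
- by rewrite -addrA h1; ring.
Qed.
Lemma cubic_root (t1 t2 t3 : K) : exists r, r ^+ 3 = t3 * r ^+ 2 + t2 * r + t1.
Proof.
have [r hr] := @solve_monicpoly K 3 (fun i => [:: t1; t2; t3]`_i) isT.
by exists r; rewrite hr !big_ord_recl big_ord0 /=; ring.
Qed.

(** Put [al = p + s] and [be = p - s]. The cubic identity says that [lam (x^n)] is the mean of
    [al^n] and [be^n]; comparing with the relation for [x^4] at [n = 4] and [n = 5] gives [e1] and
    [e2]. So, if distinct, [al] and [be] are each zero or a root of [f], and if equal, so is their
    common value. This leaves the four values of [lam] on [C3]. *)
Lemma Mono3_classified (t1 t2 t3 : K) w :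
  jordan (Mono3 t1 t2 t3 w) -> classified (Mono3 t1 t2 t3 w).
Proof.
case: w => p q r j.
have er : r = 3 * p * q - 2 * p ^+ 3 by jlam j b1 b1 b1 1.
pose f (x : K) := x ^+ 3 - (t3 * x ^+ 2 + t2 * x + t1).
have [s s2] : exists s, s ^+ 2 = q - p ^+ 2 by exists (sqrtC (q - p ^+ 2)); exact: sqrtCK.
have eq : q = p ^+ 2 + s ^+ 2 by rewrite s2; ring.
rewrite {}er {}eq {s2} in j *.
have e1 : (p + s) * f (p + s) + (p - s) * f (p - s) = 0.
  by rewrite /f; jlam j b2 b1 b1 (-2).
have e2 : (p + s) ^+ 2 * f (p + s) + (p - s) ^+ 2 * f (p - s) = 0.
  apply: (lin2 (k := -2) (k' := 2 * p - t3) (jordan_lam j b3 b1 b1) e1).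
  by rewrite ?amul_b1 ?amul_b2 ?amul_b3 /f; unf; fld.
have mono (k1 k2 r1 r2 r3 : K) : [\/ k1 = 0 /\ k2 = 0, k1 = 1 /\ k2 = 0,
    k1 = h /\ k2 = 0 | k1 = h /\ k2 = h] ->
    [/\ t1 = r1 * r2 * r3, t2 = - (r1 * r2 + r1 * r3 + r2 * r3) & t3 = r1 + r2 + r3] ->
    p = k1 * r1 + k2 * r2 -> p ^+ 2 + s ^+ 2 = k1 * r1 ^+ 2 + k2 * r2 ^+ 2 ->
    3 * p * (p ^+ 2 + s ^+ 2) - 2 * p ^+ 3 = k1 * r1 ^+ 3 + k2 * r2 ^+ 3 ->
    classified (Mono3 t1 t2 t3
      (Vec p (p ^+ 2 + s ^+ 2) (3 * p * (p ^+ 2 + s ^+ 2) - 2 * p ^+ 3))).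
  move=> hk [-> -> ->] -> -> ->.
  exact: Mono_classified.
have root (x : K) : f x = 0 -> x ^+ 3 = t3 * x ^+ 2 + t2 * x + t1.
  by move=> fx; apply: (lin1 (k := 1) fx); rewrite /f; ring.
have zero : p = 0 -> s = 0 -> classified (Mono3 t1 t2 t3
      (Vec p (p ^+ 2 + s ^+ 2) (3 * p * (p ^+ 2 + s ^+ 2) - 2 * p ^+ 3))).
  move=> p0 s0; have [x /cubic_roots [y [z hx]]] := cubic_root t1 t2 t3.
  by apply: mono hx _ _ _; [exact: (Or41 _ _ _ (conj erefl erefl))|rewrite p0 ?s0; ring..].
have [s0|s0] := eqVneq s 0.
  have [p0|p0] := eqVneq p 0; first exact: zero.
  have fp : f p = 0.
    apply: (mulfI p0); rewrite mulr0; apply: (lin1 (k := h) e1).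
    by rewrite s0 !addr0 !subr0; fld.
  have [y [z hx]] := cubic_roots (root _ fp).
  by apply: mono hx _ _ _; [exact: (Or42 _ _ _ (conj erefl erefl))|rewrite ?s0; ring..].
(* For [s != 0], [e1] and [e2] are a Vandermonde system in [(p + s) * f (p + s)] and
   [(p - s) * f (p - s)]. *)
have [g1 g2] : (p + s) * f (p + s) = 0 /\ (p - s) * f (p - s) = 0.
  move: e1 e2; move: (f (p + s)) (f (p - s)) => A B e1 e2.
  have g1 : (p + s) * A = 0.
    apply: (mulfI s0); rewrite mulr0.
    by apply: (lin2 (k := - h * (p - s)) (k' := h) e1 e2); fld.
  by split=> //; apply: (lin2 (k := 1) (k' := -1) e1 g1); ring.
move/eqP: g1; rewrite mulf_eq0 => /orP[/eqP a0|/eqP fa]; last first.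
  have [b0|b0] := eqVneq (p - s) 0.
    have [y [z hx]] := cubic_roots (root _ fa).
    have sp : s = p by apply/eqP; rewrite eq_sym -subr_eq0 b0.
    by apply: mono hx _ _ _; [exact: (Or43 _ _ _ (conj erefl erefl))|rewrite sp; fld..].
  have fb : f (p - s) = 0.
    by move/eqP: g2; rewrite mulf_eq0 (negPf b0) => /eqP.
  have s20 : 2 * s != 0 by rewrite mulf_neq0 ?pnatr_eq0.
  (* The difference of the two root equations is divided by [2 * s]; the third root is
     [t3 - 2 * p]. *)
  have E2 : t2 = - ((p + s) * (p - s) + (p + s) * (t3 - 2 * p) + (p - s) * (t3 - 2 * p)).
    apply: (mulfI s20); apply: (lin2 (k := -1) (k' := 1) fa fb); rewrite /f; ring.
  have E1 : t1 = (p + s) * (p - s) * (t3 - 2 * p).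
    by apply: (lin1 (k := -1) fa); rewrite /f E2; ring.
  by apply: (mono h h (p + s) (p - s) (t3 - 2 * p)); [exact: (Or44 _ _ _ (conj erefl erefl))
    |split=> //; ring|fld..].
have sp : s = - p by apply/eqP; rewrite -addr_eq0 addrC a0.
have [p0|p0] := eqVneq p 0; first by apply: zero => //; rewrite sp p0 oppr0.
have fb : f (p - s) = 0.
  have pp : p - s != 0 by rewrite sp opprK -mulr2n mulrn_eq0.
  by move/eqP: g2; rewrite mulf_eq0 (negPf pp) => /eqP.
have [y [z hx]] := cubic_roots (root _ fb).
by apply: mono hx _ _ _; [exact: (Or43 _ _ _ (conj erefl erefl))|rewrite sp; fld..].
Qed.

(** With [u] the coordinates of [x^4], this is the companion matrix of multiplication by [x] in the
    basis [x], [x^2], [x^3]. *)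
Lemma app_companion x y z u v : let B := Mat x y z in
  vadd (vscale (v1 v) y) (vadd (vscale (v2 v) z) (vscale (v3 v) (app B u)))
  = app B (Vec (v3 v * v1 u) (v1 v + v3 v * v2 u) (v2 v + v3 v * v3 u)).
Proof. by apply: vecP; rewrite /=; ring. Qed.

Lemma mono_case D x : jordan D -> det3 x (amul D x x) (amul D x (amul D x x)) != 0 ->
  classified D.
Proof.
move=> j; set x2 := amul D x x; set x3 := amul D x x2 => dx.
pose B := Mat x x2 x3; have dB : detm B != 0 by [].
pose u := app (invm B) (amul D x x3).
have x4E : amul D x x3 = app B u by rewrite /u invmK.
have mulB v : amul D x (app B v) =
    vadd (vscale (v1 v) x2) (vadd (vscale (v2 v) x3) (vscale (v3 v) (app B u))).
  by rewrite [app B v](_ : _ = vadd (vscale (v1 v) x) (vadd (vscale (v2 v) x2)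
    (vscale (v3 v) x3))) // !amulDr !amulZr -/x2 -/x3 x4E.
have shift v := app_companion x x2 x3 u v.
have i : iso D (Mono3 (v1 u) (v2 u) (v3 u) (Vec (lam D x) (lam D x2) (lam D x3))).
  apply: (@iso_basis _ _ _ x x2 x3) => //.
  - exact: esym (app_b2 B).
  - exact: esym (app_b3 B).
  - by rewrite power22.
  - by rewrite power23 // -/x2 -/x3 x4E mulB; exact: shift.
  - by rewrite power33 // -/x2 -/x3 x4E mulB shift mulB; exact: shift.
exact: classified_iso i (Mono3_classified (jordan_iso i j)).
Qed.

Lemma all_classified D : jordan D -> classified D.
Proof.
move=> j; have [H|/existsNP [x /eqP hx]] := pselect (nonmono D); last exact: mono_case hx.
have [[e e0 ee]|nil] := idempotent_or_nil j H; first exact: idempotent_case ee e0.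
exact: nil_case.
Qed.

(** * The listed tables are Jordan and are the normal forms *)

Ltac jordan_tac := lazymatch goal with
  | |- jordan (C3 _ _) => apply: (jordanP (amul_C3 _ _) jordan_mC3)
  | |- jordan (E4 _ _) => apply: (jordanP (amul_E4 _ _) jordan_mE4)
  | |- jordan (E5 _ _ _) => apply: (jordanP (amul_E5 _ _ _) (jordan_mE5 _))
  | |- jordan (E8 _ _) => apply: (jordanP (amul_E8 _ _) (jordan_mE8 _))
  | |- jordan (E10 _) => apply: (jordanP (amul_E10 _) jordan_mE10)
  | |- jordan (E11 _ _) => apply: (jordanP (amul_E11 _ _) (jordan_mE11 _))
  end; by move=> [? ? ?] [? ? ?] [? ? ?]; rewrite /lam /=; fld.

Lemma Ds_jordan k : jordan (Ds k).
Proof.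
case: k => k hk; rewrite /Ds /=; move: k hk; nat_cases.
all: jordan_tac.
Qed.

Lemma of_tableP (s : seq ('I_(3 + 1) * 'I_(3 + 1) * 'rV[K]_(3 + 1))) D :
  (forall i j k, bpar k == bpar i (+) bpar j ->
    \sum_(r <- s | (r.1 == (i, j)) || (r.1 == (j, i))) r.2 0 k = tab D i j k) ->
  of_table s = ofalg D.
Proof. by move=> e; apply/ffunP => -[[[i j] k] hs]; rewrite !ffunE; apply: e. Qed.

Lemma rigid31E k : tnth (rigid31 K) k = ofalg (Ds k).
Proof.
rewrite (tnth_nth (J1 K)); case: k => k hk; rewrite /Ds /=; move: k hk; nat_cases.
all: apply: of_tableP => i j k; rewrite !big_cons big_nil /Defs.v /Defs.h ?mxE /=.
all: move: i j k; elim/ord4P; elim/ord4P; elim/ord4P => //= _.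
all: by rewrite ?(mulr0, mulr1, addr0, add0r, mul0r).
Qed.

(** * Derivations *)

Notation orb E := (alg_orbit (ofalg E)).

Definition odd_scaling : 'M[K]_(3 + 1) := delta_mx o3 o3.

Lemma row4_odd_scaling x a : row4 x a *m odd_scaling = row4 o a.
Proof.
apply/rowP => i; rewrite mxE sum_ord4 !mxE.
by elim/ord4P: i; rewrite /= ?mulr0 ?mulr1 ?add0r.
Qed.

Lemma odd_scaling_neq0 : odd_scaling != 0.
Proof. by apply/eqP => /matrixP /(_ o3 o3); rewrite !mxE => /eqP; rewrite oner_eq0. Qed.

Lemma superderivation_odd_scaling D : superderivation (ofalg D) false odd_scaling.
Proof.
split=> [[] x /has_parityP /= [u ->]|dx dy x y _ _].
- by rewrite row4_odd_scaling; exact: has_parity_odd.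
- by rewrite row4_odd_scaling; exact: has_parity_even.
rewrite (row4E x) (row4E y) !(row4_odd_scaling, smul_row4) mul0n expr0 scale1r row4D.
have l0 : lam D o = 0 by rewrite /lam /=; ring.
rewrite !l0; congr row4; last by ring.
by apply: vecP; rewrite /=; ring.
Qed.

Lemma delta_row4 : [/\ delta_mx 0 o0 = row4 b1 (0 : K), delta_mx 0 o1 = row4 b2 (0 : K),
  delta_mx 0 o2 = row4 b3 (0 : K) & delta_mx 0 o3 = row4 o 1].
Proof. by split; apply/rowP; elim/ord4P; rewrite !mxE. Qed.

(** For an idempotent [e_i], [M e_i = 2 e_i (M e_i)], while [L_(e_i)] has eigenvalues 0 and 1 only;
    so [M e_i = 0]. Then [e_i f = 0] gives [e_i (M f) = 0] for all [i], which leaves [M f] on the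
    line of [f]. *)
Lemma superderivation_C3 d M : superderivation (ofalg (C3 0 0)) d M ->
  M \in <[odd_scaling]>%VS.
Proof.
move=> [hp hm].
clear hp.
have mulE x y a b : smul (ofalg (C3 0 0)) (row4 x a) (row4 y b) =
    row4 (Vec (v1 x * v1 y) (v2 x * v2 y) (v3 x * v3 y)) 0.
  rewrite smul_row4; congr row4; last by rewrite /lam /=; ring.
  by case: x y => [? ? ?] [? ? ?]; apply: vecP; unf; ring.
have half0 (a : K) : a = a + a -> a = 0.
  by move=> e; apply: (lin1 (k := -1) e); ring.
have idem x : [\/ x = b1, x = b2 | x = b3] -> row4 x 0 *m M = 0.
  move=> hx; have := hm false false _ _ (has_parity_even x) (has_parity_even x).
  rewrite {1}mulE (_ : Vec _ _ _ = x); last first.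
    by case: hx => ->; apply: vecP; rewrite /=; ring.
  rewrite muln0 expr0 scale1r [row4 x 0 *m M]row4E.
  move: (vec_of _) (_ 0 o3) => [u1 u2 u3] a.
  rewrite !mulE row4D => /row4_inj [] /= [e1 e2 e3] ->.
  rewrite (_ : Vec u1 u2 u3 = o); first by apply/rowP; elim/ord4P; rewrite !mxE ?addr0.
  by case: hx e1 e2 e3 => -> /=; rewrite !(mul0r, mulr0, mul1r, mulr1, addr0) => e1 e2 e3;
    apply: vecP; rewrite /=; by [|apply: half0].
have [d0 d1 d2 d3] := delta_row4.
have fM x : [\/ x = b1, x = b2 | x = b3] ->
    smul (ofalg (C3 0 0)) (row4 x 0) (row4 o 1 *m M) = 0.
  move=> hx; have := hm false true _ _ (has_parity_even x) (has_parity_odd 1).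
  rewrite (idem x hx) muln0 expr0 scale1r mulE.
  rewrite (_ : Vec _ _ _ = o); last by apply: vecP; rewrite /=; ring.
  have -> : row4 o 0 = 0 by apply/rowP; elim/ord4P; rewrite !mxE.
  have -> (y : 'rV_(3 + 1)) : smul (ofalg (C3 0 0)) 0 y = 0.
    by apply/rowP => i; rewrite smulE big1 ?mxE // => j _; rewrite big1 // => l _;
      rewrite mxE mulr0 mul0r.
  by rewrite mul0mx add0r.
have := (fM _ (Or31 _ _ erefl), fM _ (Or32 _ _ erefl), fM _ (Or33 _ _ erefl)).
have eM : row4 o 1 *m M = row4 (vec_of (row4 o 1 *m M)) (M o3 o3).
  by rewrite [LHS]row4E -d3 -rowE !mxE.
rewrite eM; move: (vec_of _) eM => u eM; rewrite !mulE => -[[h1 h2] h3].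
have u0 : u = o.
  apply: vecP.
  - by move/rowP: h1 => /(_ o0); rewrite !mxE /= mul1r.
  - by move/rowP: h2 => /(_ o1); rewrite !mxE /= mul1r.
  - by move/rowP: h3 => /(_ o2); rewrite !mxE /= mul1r.
apply/vlineP; exists (M o3 o3); apply/row_matrixP => i.
have z0 x : row4 x 0 *m odd_scaling = 0.
  by rewrite row4_odd_scaling; apply/rowP; elim/ord4P; rewrite !mxE.
rewrite !rowE -scalemxAr; elim/ord4P: i.
- by rewrite d0 z0 scaler0 idem //; exact: Or31.
- by rewrite d1 z0 scaler0 idem //; exact: Or32.
- by rewrite d2 z0 scaler0 idem //; exact: Or33.
rewrite d3 eM u0 row4_odd_scaling row4Z mulr1; congr row4.
by apply: vecP; rewrite /= mulr0.
Qed.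

Lemma is_Der_C3 : is_Der (ofalg (C3 0 0)) <[odd_scaling]>%VS.
Proof.
split=> [d M|W h]; first exact: superderivation_C3.
by rewrite -memvE; apply: h; exact: superderivation_odd_scaling.
Qed.

(** The derivation [odd_scaling] makes the derivation space at least one-dimensional, whence the
    bound [16 - 1]; [C3 0 0] attains it. *)
Lemma orbit_dim_le D k : orbit_dim (ofalg D) k -> (k <= 15)%N.
Proof.
move=> [U [hU _] ->]; have : (<[odd_scaling]> <= U)%VS.
  by rewrite -memvE; apply: hU (superderivation_odd_scaling D).
move=> /dimvS; rewrite dim_vline odd_scaling_neq0 => h.
by rewrite (leq_trans (leq_sub2l _ h)).
Qed.

Lemma JS_dim31 : JS_dim K 3 1 15.
Proof.
pose comp := irreducible_componentE (Ds_jordan) (Ds_free) (all_classified).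
split=> [|X l _ [c [/JSP [-> _] _ hd]]]; last exact: orbit_dim_le hd.
exists (zclosure (orb (Ds ord0))); first by apply/comp; exists ord0.
exists (ofalg (Ds ord0)); split=> //; first by apply/JS_ofalg; exact: Ds_jordan.
exists <[odd_scaling]>%VS; first exact: is_Der_C3.
by rewrite dim_vline odd_scaling_neq0.
Qed.
End Classification.

Theorem theoremC (R : realType) :
  let J := tnth (rigid31 R[i]) in
  [/\ JS_dim R[i] 3 1 15,
      injective (fun k : 'I_21 => zclosure (alg_orbit (J k))),
      forall X : set {ffun sc_index 3 1 -> R[i]},
        irreducible_component (JS R[i] 3 1) X <->
        exists k : 'I_21, X = zclosure (alg_orbit (J k)),
      forall k : 'I_21, rigid (J k) &
      JS R[i] 3 1 = zclosure (\bigcup_k alg_orbit (J k))].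
Proof.
move=> J; have JE k : J k = ofalg (Ds R[i] k) by exact: rigid31E.
have -> : J = (fun k => ofalg (Ds R[i] k)) by apply: funext.
have hj := @Ds_jordan R[i]; have hf := @Ds_free R[i]; have hc := @all_classified R[i].
split.
- exact: JS_dim31.
- exact: zclosure_inj hj hf hc.
- exact: irreducible_componentE hj hf hc.
- exact: rigid_Ds hj hf hc.
- exact: JS_zclosure hj hc.
Qed.
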